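(* Let $n\ge 1$ and let $\varphi=(\varphi_1,\ldots,\varphi_{n+1}): E\rightarrow D_{n,1}$ be a $\mathcal{K}_{D_{n,1}}$-geodesic for $(\varphi(0),\varphi'(0))$ with $\varphi'(0)\neq 0$ and $\varphi_i\not\equiv 0$ for $1\leq i\leq n+1$. Then there exist $r_1,\dots,r_{n+1}\in\{0,1\}$, numbers $a_1,\dots,a_{n+1}$, $\alpha_0,\alpha_1,\dots,\alpha_{n+1}$, and a function $B$ on $E$ such that for $\lambda\in E$ $$\varphi_j(\lambda)=\frac{\Big(\frac{\lambda-\alpha_j}{1-\overline{\alpha_j}\lambda}\Big)^{r_j}\, i\,a_j(1-\overline{\alpha_j}\lambda)}{(1-\overline{\alpha_0}\lambda)-\Big(\frac{\lambda-\alpha_{n+1}}{1-\overline{\alpha_{n+1}}\lambda}\Big)^{r_{n+1}}a_{n+1}(1-\overline{\alpha_{n+1}}\lambda)},\qquad 1\leq j\leq n,$$ and $$\varphi_{n+1}(\lambda)=B(\lambda)\exp\left\{-\frac{1}{2}\,\frac{1-\overline{\alpha_0}\lambda+\Big(\frac{\lambda-\alpha_{n+1}}{1-\overline{\alpha_{n+1}}\lambda}\Big)^{r_{n+1}}a_{n+1}(1-\overline{\alpha_{n+1}}\lambda)}{1-\overline{\alpha_0}\lambda-\Big(\frac{\lambda-\alpha_{n+1}}{1-\overline{\alpha_{n+1}}\lambda}\Big)^{r_{n+1}}a_{n+1}(1-\overline{\alpha_{n+1}}\lambda)}\right\},$$ where $r_j=1$ implies $\alpha_j\in E$, and the parameters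 satisfy $$a_j\in\mathbb{C}\setminus\{0\},\quad \alpha_j\in\overline{E}\quad (1\leq j\leq n+1),\qquad \alpha_0\in E,$$ $$\alpha_0=\sum_{j=1}^{n+1}|a_j|^2\alpha_j,\qquad 1+|\alpha_0|^2=\sum_{j=1}^{n+1}|a_j|^2(1+|\alpha_j|^2).$$ Additionally, either $B(\lambda)\equiv 1$ or $B(\lambda)=\frac{\lambda-\gamma}{1-\overline{\gamma}\lambda}$, where $\gamma=\frac{\alpha_0+\overline{a_{n+1}}}{1+\overline{a_{n+1}\alpha_{n+1}}}$ if $r_{n+1}=1$, and $\gamma=\frac{\alpha_0-\overline{a_{n+1}}\alpha_{n+1}}{1-\overline{a_{n+1}}}$ if $r_{n+1}=0$.
   Context: $E$ is the open unit disk in $\mathbb{C}$. For $n,m\geq 1$ the Fock-Bargmann-Hartogs domain is $D_{n,m}=\{(z,w)\in\mathbb{C}^n\times\mathbb{C}^m:\ \|w\|^2<e^{-\|z\|^2}\}$, with $\|\cdot\|$ the Euclidean norm. For a domain $D\subset\mathbb{C}^N$ the Kobayashi pseudometric is, for $(z,\zeta)\in D\times\mathbb{C}^N$, $$\mathcal{K}_D(z,\zeta)=\inf_f\{|\alpha|:\ \exists f:E\to D \text{ holomorphic},\ f(0)=z,\ f'(0)\alpha=\zeta\}.$$ A holomorphic mapping $\varphi:E\to D$ is a $\mathcal{K}_D$-geodesic for $(z,\zeta)$ if $\varphi$ achieves the minimum in this definition, i.e. $\varphi(0)=z$ and $\varphi'(0)\alpha=\zeta$ for some $\alpha$ with $|\alpha|=\mathcal{K}_D(z,\zeta)$.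 *)

(* Defs.v *)
From mathcomp Require Import all_boot all_order all_algebra.
From mathcomp Require Import complex.
From mathcomp Require Import all_classical all_reals all_analysis.

Set Implicit Arguments.
Unset Strict Implicit.
Unset Printing Implicit Defensive.

Import Order.TTheory GRing.Theory Num.Theory.
Import numFieldNormedType.Exports.

Local Open Scope classical_set_scope.
Local Open Scope ring_scope.
Local Open Scope complex_scope.

(* The norm of [R[i]] as a [numDomainType] takes values in [R[i]]; [cmod] is
   the modulus with values in [R]. *)
Definition cmod (R : realType) (z : R[i]) : R := ComplexField.Normc.normc z.

Definition cexp (R : realType) (z : R[i]) : R[i] :=
  (expR (complex.Re z))%:C * (cos (complex.Im z) +i* sin (complex.Im z)).

Definition disk (R : realType) : set R[i] := [set z | cmod z < 1].

Definition closed_disk (R : realType) : set R[i] := [set z | cmod z <= 1].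

Definition enorm (R : realType) (N : nat) (v : 'rV[R[i]]_N) : R :=
  Num.sqrt (\sum_(j < N) cmod (v 0 j) ^+ 2).

(* C^n x C^m is ['rV_(n + m)]: z is [lsubmx v] and w is [rsubmx v]. *)
Definition fock_bargmann_hartogs (R : realType) (n m : nat) :
    set 'rV[R[i]]_(n + m) :=
  [set v | enorm (rsubmx v) ^+ 2 < expR (- enorm (lsubmx v) ^+ 2)].

(* Maps defined on the disk are represented by total functions whose values
   off the disk are irrelevant.  [R[i]^o] is [R[i]] as a normed space over
   itself, so [derivable _ z 1] is complex differentiability at [z] and
   ['D_1 f z] is the complex derivative. *)
Definition holomorphic_disk (R : realType) (N : nat) (D : set 'rV[R[i]]_N)
    (f : R[i]^o -> 'rV[R[i]]_N) : Prop :=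
  (forall z, disk z -> D (f z)) /\ (forall z, disk z -> derivable f z 1).

Definition kobayashi (R : realType) (N : nat) (D : set 'rV[R[i]]_N)
    (z zeta : 'rV[R[i]]_N) : R :=
  inf [set x : R | exists (f : R[i]^o -> 'rV[R[i]]_N) (alpha : R[i]),
    [/\ holomorphic_disk D f, f 0 = z, alpha *: 'D_1 f 0 = zeta
      & x = cmod alpha]].

Definition kobayashi_geodesic (R : realType) (N : nat) (D : set 'rV[R[i]]_N)
    (z zeta : 'rV[R[i]]_N) (phi : R[i]^o -> 'rV[R[i]]_N) : Prop :=
  [/\ holomorphic_disk D phi, phi 0 = z
    & exists alpha : R[i], alpha *: 'D_1 phi 0 = zeta
        /\ cmod alpha = kobayashi D z zeta].

Definition mobius (R : realType) (alpha lambda : R[i]) : R[i] :=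
  (lambda - alpha) / (1 - alpha^* * lambda).

(* Main.v *)
Require Import Defs.
From mathcomp Require Import all_boot all_order all_algebra.
From mathcomp Require Import complex ring lra.
From mathcomp Require Import all_classical all_reals all_analysis.

Import Order.TTheory GRing.Theory Num.Theory.
Import numFieldNormedType.Exports.

(** A geodesic through its own jet at the origin cannot be improved: no disk in the
domain has the same value and a strictly longer derivative in the same direction
([geodesic_not_improvable]). Write the disk as [(z, w)], with [w] the last
component, so that [|w|^2 < exp (- |z|^2)].

The zeros of [w] are treated first. The factor of a zero inside the disk can be
divided out by the maximum principle ([inside_divide_mobius]). If there were two
zeros, [w] would contain a product of two disk automorphisms, for which the
Schwarz-Pick inequality is strict, and the jet could be improved by changing that
product ([improvable_two_zeros]). Hence [w = B exp u], with [B] equal to one or to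
the automorphism vanishing at the only zero, and [2 Re u + |z|^2 <= 0].

The mean over a circle of [|1 - conj s l|^2 (2 Re u + |z|^2)] is nonpositive. By
Parseval it is a function of the jet, plus the mean square of the part of order two
of [(1 - conj s l) z]; the limit of the former as the radius tends to one is the
[defect]. So the defect is nonpositive for every [s], and where it vanishes
[(1 - conj s l) z] is affine ([defect_le0], [defect0_affine]). For given data there
are candidate disks, linear fractional with denominator [1 - conj s l], for which it
vanishes ([disk_z], [disk_u]). If [w] has no zero, either some candidate improves the
jet ([improvable_short]) or the defect vanishes for some [s]; if [w] vanishes at [g],
then a negative defect at [s = g] would allow an improvement obtained by moving
towards a candidate ([defect_one_zero]). In both cases [z] is the [z]-part of a
candidate, and the Borel-Caratheodory inequality, applied to the difference of the
exponents, shows that [u] is its [u]-part ([standard_zero_free],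
[standard_one_zero]). When [w] has a zero, it is the [s] of this candidate.

Finally the Cayley transform sends [2 Re u + |z|^2 < 0] to the unit ball and the
candidate to a quotient of affine functions whose coefficients satisfy the two
stated relations ([standard_ball]); every affine function is a multiple of
[l - alpha] or of [1 - conj alpha l], which gives the exponents [r] and the
parameters [a] and [alpha] ([affine_factor]). The number [gamma] is the value of [s]
expressed through them.

The facts of complex analysis are derived from differentiability at each point of
the disk: Goursat's theorem for rectangles in the logarithmic coordinate makes means
over circles independent of the radius, which gives Cauchy's formula. *)

Local Open Scope classical_set_scope.
Local Open Scope ring_scope.
Local Open Scope complex_scope.

Local Notation Re := (@complex.Re _).
Local Notation Im := (@complex.Im _).
Local Notation "z ^*" := (conjc z) : ring_scope.

Arguments cmod : simpl never.
Arguments cexp : simpl never.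

(** * Modulus, continuity and derivatives *)

Section Modulus.
Context {R : realType}.
Implicit Types (x y : R) (z w a b : R[i]).

Lemma normc_cmod z : `|z| = (cmod z)%:C.
Proof. by []. Qed.

Lemma cmodM z w : cmod (z * w) = cmod z * cmod w.
Proof. exact: ComplexField.Normc.normcM. Qed.

Lemma cmodV z : cmod z^-1 = (cmod z)^-1.
Proof. exact: ComplexField.Normc.normcV. Qed.

Lemma cmod_ge0 z : 0 <= cmod z.
Proof. by case: z => a b; exact: sqrtr_ge0. Qed.

Lemma cmod0 : cmod (0 : R[i]) = 0.
Proof. exact: ComplexField.Normc.normc0. Qed.

Lemma cmod1 : cmod (1 : R[i]) = 1.
Proof. exact: ComplexField.Normc.normc1. Qed.

Lemma cmod_eq0 z : (cmod z == 0) = (z == 0).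
Proof.
apply/eqP/eqP => [|->]; [exact: ComplexField.Normc.eq0_normc|exact: cmod0].
Qed.

Lemma cmod_gt0 z : (0 < cmod z) = (z != 0).
Proof. by rewrite lt_def cmod_eq0 cmod_ge0 andbT. Qed.

Lemma cmodX z k : cmod (z ^+ k) = cmod z ^+ k.
Proof. by elim: k => [|k IH]; rewrite ?expr0 ?cmod1 // !exprS cmodM IH. Qed.

Lemma cmodN z : cmod (- z) = cmod z.
Proof. by case: z => a b; rewrite /cmod /= !sqrrN. Qed.

Lemma cmodBC z w : cmod (z - w) = cmod (w - z).
Proof. by rewrite -cmodN opprB. Qed.

Lemma cmodJ z : cmod z^* = cmod z.
Proof. by case: z => a b; rewrite /cmod /= sqrrN. Qed.

Lemma sqr_cmod z : cmod z ^+ 2 = Re z ^+ 2 + Im z ^+ 2.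
Proof. by case: z => a b; rewrite sqr_sqrtr // addr_ge0 ?sqr_ge0. Qed.

Lemma cmodR x : cmod x%:C = `|x|.
Proof. by rewrite /cmod /= expr0n /= addr0 sqrtr_sqr. Qed.

Lemma cmodR_ge0 x : 0 <= x -> cmod x%:C = x.
Proof. by move=> x0; rewrite cmodR ger0_norm. Qed.

Lemma natRC k : k%:R = (k%:R)%:C :> R[i].
Proof. by rewrite rmorph_nat. Qed.

Lemma cmod_nat k : cmod (k%:R : R[i]) = k%:R.
Proof. by rewrite natRC cmodR_ge0. Qed.

Lemma cmodi : cmod ('i%C : R[i]) = 1.
Proof. by rewrite /cmod /= expr0n /= add0r expr1n sqrtr1. Qed.

Lemma cmodD z w : cmod (z + w) <= cmod z + cmod w.
Proof. by have := ler_normD z w; rewrite lecE => /andP[_]. Qed.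

Lemma cmodB z w : cmod (z - w) <= cmod z + cmod w.
Proof. by rewrite -(cmodN w) cmodD. Qed.

Lemma cmodB_ge z w : cmod z - cmod w <= cmod (z - w).
Proof. by have := cmodD (z - w) w; rewrite subrK; lra. Qed.

Lemma normRe_cmod z : `|Re z| <= cmod z.
Proof.
case: z => a b; rewrite /cmod /= -sqrtr_sqr ler_wsqrtr // lerDl sqr_ge0 //.
Qed.

Lemma normIm_cmod z : `|Im z| <= cmod z.
Proof.
case: z => a b; rewrite /cmod /= -sqrtr_sqr ler_wsqrtr // lerDr sqr_ge0 //.
Qed.

Lemma Re_le_cmod z : Re z <= cmod z.
Proof. exact: le_trans (ler_norm _) (normRe_cmod z). Qed.

Lemma ReD z w : Re (z + w) = Re z + Re w.
Proof. by case: z; case: w. Qed.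
Lemma ImD z w : Im (z + w) = Im z + Im w.
Proof. by case: z; case: w. Qed.
Lemma ReN z : Re (- z) = - Re z.
Proof. by case: z. Qed.
Lemma ImN z : Im (- z) = - Im z.
Proof. by case: z. Qed.
Lemma ReB z w : Re (z - w) = Re z - Re w.
Proof. by case: z; case: w. Qed.
Lemma ImB z w : Im (z - w) = Im z - Im w.
Proof. by case: z; case: w. Qed.
Lemma ReM z w : Re (z * w) = Re z * Re w - Im z * Im w.
Proof. by case: z; case: w. Qed.
Lemma ImM z w : Im (z * w) = Re z * Im w + Im z * Re w.
Proof. by case: z => ? ?; case: w => ? ?. Qed.
Lemma ReJ z : Re z^* = Re z.
Proof. by case: z. Qed.
Lemma ImJ z : Im z^* = - Im z.
Proof. by case: z. Qed.
Lemma ReC x : Re x%:C = x. Proof. by []. Qed.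
Lemma ImC x : Im x%:C = 0. Proof. by []. Qed.
Lemma Re0 : Re (0 : R[i]) = 0. Proof. by []. Qed.
Lemma Im0 : Im (0 : R[i]) = 0. Proof. by []. Qed.
Lemma Re1 : Re (1 : R[i]) = 1. Proof. by []. Qed.
Lemma Im1 : Im (1 : R[i]) = 0. Proof. by []. Qed.
Lemma Rei : Re ('i%C : R[i]) = 0. Proof. by []. Qed.
Lemma Imi : Im ('i%C : R[i]) = 1. Proof. by []. Qed.

Lemma ReCM x z : Re (x%:C * z) = x * Re z.
Proof. by rewrite ReM ReC ImC mul0r subr0. Qed.
Lemma ImCM x z : Im (x%:C * z) = x * Im z.
Proof. by rewrite ImM ReC ImC mul0r addr0. Qed.

Lemma eqReIm z w : Re z = Re w -> Im z = Im w -> z = w.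
Proof. by case: z => ? ?; case: w => ? ? /= -> ->. Qed.

Lemma Re_mk x y : Re (x +i* y) = x. Proof. by []. Qed.
Lemma Im_mk x y : Im (x +i* y) = y. Proof. by []. Qed.

Lemma cmod_mk x y : cmod (x +i* y) = Num.sqrt (x ^+ 2 + y ^+ 2).
Proof. by []. Qed.

Definition ReImE := (Re_mk, Im_mk, ReC, ImC, ReD, ImD, ReN, ImN, ReM, ImM, ReJ, ImJ,
  Re0, Im0, Re1, Im1, Rei, Imi).

Lemma conjD z w : (z + w)^* = z^* + w^*. Proof. exact: rmorphD. Qed.
Lemma conjB z w : (z - w)^* = z^* - w^*. Proof. exact: rmorphB. Qed.
Lemma conjN z : (- z)^* = - z^*. Proof. exact: rmorphN. Qed.
Lemma conjM z w : (z * w)^* = z^* * w^*. Proof. exact: rmorphM. Qed.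
Lemma conjX z k : (z ^+ k)^* = z^* ^+ k. Proof. exact: rmorphXn. Qed.
Lemma conjV z : (z^-1)^* = (z^*)^-1. Proof. exact: conjc_inv. Qed.
Lemma conj1 : (1 : R[i])^* = 1. Proof. exact: conjc1. Qed.
Lemma conj0 : (0 : R[i])^* = 0. Proof. exact: conjc0. Qed.
Lemma conjRC x : (x%:C : R[i])^* = x%:C. Proof. exact: conjc_real. Qed.
Lemma conjK z : z^*^* = z. Proof. exact: conjcK. Qed.
Lemma conji : ('i%C : R[i])^* = - 'i%C. Proof. by apply: eqReIm; rewrite !ReImE ?oppr0. Qed.
Definition conjE := (conjD, conjN, conjM, conjX, conjV, conj1, conj0, conjK,
  conjRC).

Lemma mulzJ z : z * z^* = (cmod z ^+ 2)%:C.
Proof. by apply: eqReIm; rewrite ?ReC ?ImC ?sqr_cmod !ReImE; ring. Qed.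

Lemma addzJ z : z + z^* = (2 * Re z)%:C.
Proof. by apply: eqReIm; rewrite !ReImE; ring. Qed.

Lemma cmod_le_ReIm z : cmod z <= `|Re z| + `|Im z|.
Proof.
have -> : z = (Re z)%:C + 'i%C * (Im z)%:C by exact: complexE.
apply: le_trans (cmodD _ _) _.
by rewrite cmodM cmodi mul1r !cmodR !ReImE !(mul0r, addr0, subr0, add0r, mul1r).
Qed.

Lemma RCD x y : (x + y)%:C = x%:C + y%:C :> R[i]. Proof. exact: rmorphD. Qed.
Lemma RCM x y : (x * y)%:C = x%:C * y%:C :> R[i]. Proof. exact: rmorphM. Qed.
Lemma RCN x : (- x)%:C = - x%:C :> R[i]. Proof. exact: rmorphN. Qed.
Lemma RCV x : (x^-1)%:C = (x%:C)^-1 :> R[i]. Proof. exact: fmorphV. Qed.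
Lemma RC_eq0 x : (x%:C == 0 :> R[i]) = (x == 0). Proof. exact: fmorph_eq0. Qed.

End Modulus.

(* Conversion must not compare moduli, exponentials or integrals by unfolding them. *)
Opaque cmod.

(** A function into the plane, continuous or differentiable at a point: the same
epsilon-delta definition serves for the line and for the plane, which are
distinguished by the distance on the domain. *)
Section Continuity.
Context {R : realType} {T : Type} (d : T -> T -> R).
Implicit Types (F G : T -> R[i]) (t : T).

Definition cont F t := forall e : R, 0 < e ->
  exists2 de : R, 0 < de & forall s, d s t < de -> cmod (F s - F t) <= e.

Lemma cont_cst c t : cont (fun=> c) t.
Proof. by move=> e e0; exists 1 => // s _; rewrite subrr cmod0 ltW. Qed.

Lemma contN F t : cont F t -> cont (fun x => - F x) t.
Proof.
move=> cF e e0; have [de de0 H] := cF e e0; exists de => // s /H.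
by rewrite -opprD cmodN.
Qed.

Lemma contD F G t : cont F t -> cont G t -> cont (fun x => F x + G x) t.
Proof.
move=> cF cG e e0; have e2 : 0 < e / 2 by lra.
have [d1 d10 H1] := cF _ e2; have [d2 d20 H2] := cG _ e2.
exists (Num.min d1 d2) => [|s]; first by rewrite lt_min d10.
rewrite lt_min => /andP[/H1 h1 /H2 h2].
have -> : F s + G s - (F t + G t) = (F s - F t) + (G s - G t) by ring.
by apply: le_trans (cmodD _ _) _; lra.
Qed.

Lemma contB F G t : cont F t -> cont G t -> cont (fun x => F x - G x) t.
Proof. by move=> cF cG; apply: contD => //; exact: contN. Qed.

Lemma cont_bnd F t : cont F t ->
  exists2 de : R, 0 < de & forall s, d s t < de -> cmod (F s) <= cmod (F t) + 1.
Proof.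
move=> /(_ 1 ltr01)[de de0 H]; exists de => // s /H h.
by rewrite -(subrK (F t) (F s)) addrC; apply: le_trans (cmodD _ _) _; lra.
Qed.

Lemma contM F G t : cont F t -> cont G t -> cont (fun x => F x * G x) t.
Proof.
move=> cF cG e e0.
have [d3 d30 H3] := cont_bnd _ _ cF.
pose K := cmod (F t) + 1 + cmod (G t) + 1.
have K0 : 0 < K by rewrite /K; have := cmod_ge0 (F t); have := cmod_ge0 (G t); lra.
have e2 : 0 < e / (2 * K) by rewrite divr_gt0 // mulr_gt0.
have [d1 d10 H1] := cF _ e2; have [d2 d20 H2] := cG _ e2.
exists (Num.min d3 (Num.min d1 d2)) => [|s]; first by rewrite !lt_min d10 d20 d30.
rewrite !lt_min => /and3P[/H3 h3 /H1 h1 /H2 h2].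
have -> : F s * G s - (F t * G t) = F s * (G s - G t) + (F s - F t) * G t by ring.
apply: le_trans (cmodD _ _) _; rewrite !cmodM.
have hF : cmod (F s) <= K by rewrite /K; have := cmod_ge0 (G t); lra.
have hG : cmod (G t) <= K by rewrite /K; have := cmod_ge0 (F t); lra.
have -> : e = K * (e / (2 * K)) + (e / (2 * K)) * K by field; rewrite gt_eqF.
by apply: lerD; apply: ler_pM => //; exact: cmod_ge0.
Qed.

Lemma contV F t : F t != 0 -> cont F t -> cont (fun x => (F x)^-1) t.
Proof.
move=> F0 cF e e0; set m := cmod (F t); have m0 : 0 < m by rewrite cmod_gt0.
have e2 : 0 < Num.min (m / 2) (e * (m * (m / 2))).
  by rewrite lt_min; apply/andP; split; rewrite ?mulr_gt0 // ?divr_gt0.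
have [de de0 H] := cF _ e2; exists de => // s /H.
rewrite le_min => /andP[h1 h2].
have hs : m / 2 <= cmod (F s).
  by have := cmodB_ge (F t) (F s); rewrite cmodBC -/m; lra.
have Fs0 : F s != 0 by rewrite -cmod_gt0; lra.
have -> : (F s)^-1 - (F t)^-1 = (F t - F s) / (F t * F s).
  by field; rewrite ?F0 ?Fs0.
rewrite cmodM cmodV cmodM cmodBC -/m ler_pdivrMr; last by rewrite mulr_gt0 //; lra.
by apply: le_trans h2 _; rewrite !ler_pM2l.
Qed.

Lemma contJ F t : cont F t -> cont (fun x => (F x)^*) t.
Proof.
move=> cF e e0; have [de de0 H] := cF e e0; exists de => // s /H.
by rewrite -conjB cmodJ.
Qed.

Lemma cont_Re F t : cont F t -> cont (fun x => (Re (F x))%:C) t.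
Proof.
move=> cF e e0; have [de de0 H] := cF e e0; exists de => // s /H h.
rewrite -RCN -RCD cmodR -ReB; exact: le_trans (normRe_cmod _) h.
Qed.

Lemma cont_cmod F t : cont F t -> cont (fun x => (cmod (F x))%:C) t.
Proof.
move=> cF e e0; have [de de0 H] := cF e e0; exists de => // s /H h.
rewrite -RCN -RCD cmodR; apply: le_trans h.
rewrite ler_norml; apply/andP; split; last exact: cmodB_ge.
by rewrite lerNl opprB cmodBC cmodB_ge.
Qed.

End Continuity.

Definition dC {R : realType} (z w : R[i]) := cmod (z - w).
Definition dR {R : realType} (x y : R) := cmod (x%:C - y%:C).
Notation ccont := (cont dC).
Notation rcont := (cont dR).

Section Comp.
Context {R : realType}.

Lemma cont_id (z : R[i]) : ccont (fun x => x) z.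
Proof. by move=> e e0; exists e => // s /ltW. Qed.

Lemma cont_comp {T : Type} (d : T -> T -> R) (F : T -> R[i]) (f : R[i] -> R[i]) t :
  cont d F t -> ccont f (F t) -> cont d (fun x => f (F x)) t.
Proof.
move=> cF cf e e0; have [d1 d10 H1] := cf e e0.
have d12 : 0 < d1 / 2 by lra.
have [d2 d20 H2] := cF _ d12; exists d2 => // s /H2 h; apply: H1.
by rewrite /dC; lra.
Qed.

End Comp.

Ltac cont_tac := repeat lazymatch goal with
  | |- cont _ (fun x => x) _ => apply: cont_id
  | |- cont _ (fun x => (@?F x - @?G x)%R) _ => apply: (contB _ F G)
  | |- cont _ (fun x => (@?F x + @?G x)%R) _ => apply: (contD _ F G)
  | |- cont _ (fun x => (@?F x * @?G x)%R) _ => apply: (contM _ F G)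
  | |- cont _ (fun x => conjc (@?F x)) _ => apply: (contJ _ F)
  | |- cont _ (fun _ => ?c) _ => apply: cont_cst
  | _ => assumption
  end.

Lemma dRE {R : realType} (x y : R) : dR x y = `|x - y|.
Proof. by rewrite /dR -RCN -RCD cmodR. Qed.

(** The same definition, with [j] the inclusion of the line or the identity of the
plane, gives the derivatives of paths and of functions of a complex variable, so
that the rules of calculus and the chain rule along paths are proved once. *)
Section Derivative.
Context {R : realType} {T : Type} (j : T -> R[i]).
Implicit Types (F G : T -> R[i]) (t : T) (a b : R[i]).
Local Notation dist := (fun s t => cmod (j s - j t)).

Definition der F t a := forall e : R, 0 < e ->
  exists2 de : R, 0 < de & forall s, cmod (j s - j t) < de ->
    cmod (F s - F t - a * (j s - j t)) <= e * cmod (j s - j t).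

Lemma der_lip F t a : der F t a -> exists2 de : R, 0 < de &
  forall s, cmod (j s - j t) < de ->
    cmod (F s - F t) <= (cmod a + 1) * cmod (j s - j t).
Proof.
move=> /(_ 1 ltr01)[de de0 H]; exists de => // s /H h.
rewrite -(subrK (a * (j s - j t)) (F s - F t)).
by apply: le_trans (cmodD _ _) _; rewrite cmodM; lra.
Qed.

Lemma der_cont F t a : der F t a -> cont dist F t.
Proof.
move=> /der_lip[de de0 H] e e0; set K := cmod a + 1.
have K0 : 0 < K by rewrite /K; have := cmod_ge0 a; lra.
exists (Num.min de (e / K)) => [|s]; first by rewrite lt_min de0 divr_gt0.
rewrite lt_min => /andP[/H h]; rewrite ltr_pdivlMr // => /ltW h2.
by apply: le_trans h _; rewrite mulrC.
Qed.

Lemma der_eq F t a b : a = b -> der F t a -> der F t b.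
Proof. by move=> ->. Qed.

Lemma der_near F G t a (r : R) : 0 < r ->
  (forall s, cmod (j s - j t) < r -> F s = G s) -> der F t a -> der G t a.
Proof.
move=> r0 FG dF e e0; have [de de0 H] := dF e e0.
exists (Num.min r de) => [|s]; first by rewrite lt_min r0.
by rewrite lt_min => /andP[hr /H]; rewrite !FG // subrr cmod0.
Qed.

Lemma der_cst a t : der (fun=> a) t 0.
Proof.
by move=> e e0; exists 1 => // s _; rewrite subrr mul0r subrr cmod0 mulr_ge0 ?cmod_ge0 // ltW.
Qed.

Lemma der_inj t : der j t 1.
Proof.
by move=> e e0; exists 1 => // s _; rewrite mul1r subrr cmod0 mulr_ge0 ?cmod_ge0 // ltW.
Qed.

Lemma derD F G t a b : der F t a -> der G t b -> der (fun x => F x + G x) t (a + b).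
Proof.
move=> dF dG e e0; have e2 : 0 < e / 2 by lra.
have [d1 d10 H1] := dF _ e2; have [d2 d20 H2] := dG _ e2.
exists (Num.min d1 d2) => [|s]; first by rewrite lt_min d10.
rewrite lt_min => /andP[/H1 h1 /H2 h2].
have -> : F s + G s - (F t + G t) - (a + b) * (j s - j t) =
  (F s - F t - a * (j s - j t)) + (G s - G t - b * (j s - j t)) by ring.
by apply: le_trans (cmodD _ _) _; lra.
Qed.

Lemma derN F t a : der F t a -> der (fun x => - F x) t (- a).
Proof.
move=> dF e e0; have [de de0 H] := dF e e0; exists de => // s /H.
by rewrite -cmodN; congr (cmod _ <= _); ring.
Qed.

Lemma derB F G t a b : der F t a -> der G t b -> der (fun x => F x - G x) t (a - b).
Proof. by move=> dF dG; apply: derD => //; exact: derN. Qed.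

Lemma derM F G t a b : der F t a -> der G t b ->
  der (fun x => F x * G x) t (a * G t + F t * b).
Proof.
move=> dF dG e e0.
have [d3 d30 H3] := der_lip _ _ _ dF.
have cG := der_cont _ _ _ dG.
pose K := cmod a + 1 + cmod (F t) + cmod (G t).
have K0 : 0 < K.
  rewrite /K; have := cmod_ge0 a; have := cmod_ge0 (F t); have := cmod_ge0 (G t); lra.
have e2 : 0 < e / (3 * K) by rewrite divr_gt0 // mulr_gt0.
have [d1 d10 H1] := dF _ e2; have [d2 d20 H2] := dG _ e2.
have [d4 d40 H4] := cG _ e2.
exists (Num.min (Num.min d3 d4) (Num.min d1 d2)) => [|s].
  by rewrite !lt_min d10 d20 d30 d40.
rewrite !lt_min => /andP[/andP[/H3 h3 /H4 h4] /andP[/H1 h1 /H2 h2]].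
set k := cmod (j s - j t) in h1 h2 h3 *.
have k0 : 0 <= k by exact: cmod_ge0.
have -> : F s * G s - F t * G t - (a * G t + F t * b) * (j s - j t) =
  (F s - F t) * (G s - G t) + (F s - F t - a * (j s - j t)) * G t
   + F t * (G s - G t - b * (j s - j t)) by ring.
have -> : e * k = (K * k) * (e / (3 * K)) + (e / (3 * K) * k) * K
    + K * (e / (3 * K) * k) by field; rewrite gt_eqF.
have := cmod_ge0 a; have := cmod_ge0 (F t); have := cmod_ge0 (G t) => G0 F0 a0.
have aK : cmod a + 1 <= K by rewrite /K; lra.
have FK : cmod (F t) <= K by rewrite /K; lra.
have GK : cmod (G t) <= K by rewrite /K; lra.
apply: le_trans (cmodD _ _) _; apply: lerD; last first.
  by rewrite cmodM; apply: ler_pM; rewrite ?cmod_ge0.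
apply: le_trans (cmodD _ _) _; apply: lerD; last first.
  by rewrite cmodM; apply: ler_pM; rewrite ?cmod_ge0.
rewrite cmodM; apply: ler_pM; rewrite ?cmod_ge0 //.
by apply: le_trans h3 _; rewrite ler_wpM2r.
Qed.

Lemma der_comp F t a (f : R[i] -> R[i]) (b : R[i]) :
  (forall e : R, 0 < e -> exists2 de : R, 0 < de & forall w, cmod (w - F t) < de ->
    cmod (f w - f (F t) - b * (w - F t)) <= e * cmod (w - F t)) ->
  der F t a -> der (fun x => f (F x)) t (b * a).
Proof.
move=> df dF e e0.
have [d3 d30 H3] := der_lip _ _ _ dF.
have cF := der_cont _ _ _ dF.
pose K := cmod a + 1 + cmod b.
have a0 := cmod_ge0 a; have b0 := cmod_ge0 b.
have K0 : 0 < K by rewrite /K; lra.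
have e2 : 0 < e / (2 * K) by rewrite divr_gt0 // mulr_gt0.
have [d1 d10 H1] := df _ e2; have [d2 d20 H2] := dF _ e2.
have d12 : 0 < d1 / 2 by lra.
have [d4 d40 H4] := cF _ d12.
exists (Num.min (Num.min d3 d4) d2) => [|s].
  by rewrite !lt_min d20 d30 d40.
rewrite !lt_min => /andP[/andP[/H3 h3 /H4 h4] /H2 h2].
have /H1 h1 : cmod (F s - F t) < d1 by lra.
set k := cmod (j s - j t) in h2 h3 *.
have k0 : 0 <= k by exact: cmod_ge0.
have -> : f (F s) - f (F t) - b * a * (j s - j t) =
  (f (F s) - f (F t) - b * (F s - F t)) + b * (F s - F t - a * (j s - j t)) by ring.
have -> : e * k = (e / (2 * K)) * (K * k) + K * (e / (2 * K) * k).
  by field; rewrite gt_eqF.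
apply: le_trans (cmodD _ _) _; apply: lerD.
  apply: le_trans h1 _; rewrite ler_pM2l //; apply: le_trans h3 _.
  by rewrite ler_wpM2r // /K; lra.
by rewrite cmodM; apply: ler_pM; rewrite ?cmod_ge0 // /K; lra.
Qed.

Lemma der_sum (I : Type) (s : seq I) (F : I -> T -> R[i]) (a : I -> R[i]) t :
  (forall i, der (F i) t (a i)) ->
  der (fun x => \sum_(i <- s) F i x) t (\sum_(i <- s) a i).
Proof.
move=> dF; elim: s => [|i s IH] e e0.
  exists 1 => // x _; rewrite !big_nil subrr mul0r subrr cmod0 mulr_ge0 ?cmod_ge0 //; lra.
have [de de0 H] := derD _ _ _ _ _ (dF i) IH e e0.
by exists de => // x /H; rewrite !big_cons.
Qed.

Lemma der_uniq F t a b : (forall e : R, 0 < e -> exists s, 0 < cmod (j s - j t) < e) ->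
  der F t a -> der F t b -> a = b.
Proof.
move=> near_t dF dF'; apply/eqP; rewrite -subr_eq0 -cmod_eq0 eq_le cmod_ge0 andbT.
apply/ler_addgt0Pr => e e0; rewrite add0r; have e2 : 0 < e / 2 by lra.
have [d1 d10 H1] := dF _ e2; have [d2 d20 H2] := dF' _ e2.
have [|s /andP[s0]] := near_t (Num.min d1 d2); first by rewrite lt_min d10.
rewrite lt_min => /andP[/H1 h1 /H2 h2].
rewrite -(ler_pM2r s0) -cmodM.
have -> : (a - b) * (j s - j t) =
  (F s - F t - b * (j s - j t)) - (F s - F t - a * (j s - j t)) by ring.
by apply: le_trans (cmodB _ _) _; lra.
Qed.

End Derivative.

Arguments derD {R T j F G t a b}.
Arguments derB {R T j F G t a b}.
Arguments derM {R T j F G t a b}.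

Notation cder := (der (fun x => x)).
Notation rder := (der (fun x => x%:C)).

Section ComplexDerivative.
Context {R : realType}.
Implicit Types (f g : R[i] -> R[i]) (z a b : R[i]).

Lemma cder_id z : cder (fun x => x) z 1.
Proof. exact: der_inj. Qed.

Lemma cder_uniq f z a b : cder f z a -> cder f z b -> a = b.
Proof.
apply: der_uniq => e e0; exists (z + (e / 2)%:C).
have -> : z + (e / 2)%:C - z = (e / 2)%:C by ring.
by rewrite cmodR gtr0_norm; lra.
Qed.

Lemma cder_inv z : z != 0 -> cder (fun x => x^-1) z (- z^-1 ^+ 2).
Proof.
move=> z0 e e0; have m0 : 0 < cmod z by rewrite cmod_gt0.
have ci := contV dC (fun x => x) z z0 (cont_id z).
have e2 : 0 < e * cmod z by rewrite mulr_gt0.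
have [de de0 H] := ci _ e2.
exists (Num.min de (cmod z)) => [|s]; first by rewrite lt_min de0.
rewrite lt_min => /andP[/H h hs].
have s0 : s != 0.
  by apply/eqP => s0; move: hs; rewrite s0 sub0r cmodN ltxx.
have -> : s^-1 - z^-1 - - z^-1 ^+ 2 * (s - z) = - z^-1 * (s^-1 - z^-1) * (s - z).
  by field; rewrite z0.
rewrite cmodM ler_wpM2r ?cmod_ge0 // cmodM cmodN cmodV.
by rewrite mulrC ler_pdivrMr.
Qed.

Lemma derV {T : Type} (j : T -> R[i]) F t a : F t != 0 -> der j F t a ->
  der j (fun x => (F x)^-1) t (- (F t)^-1 ^+ 2 * a).
Proof. by move=> F0 dF; apply: der_comp dF; exact: cder_inv. Qed.

Lemma der_Re (F : R -> R[i]) t a :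
  rder F t a -> rder (fun x => (Re (F x))%:C) t (Re a)%:C.
Proof.
move=> dF e e0; have [de de0 H] := dF e e0; exists de => // s /H h.
apply: le_trans h.
have -> : (Re (F s))%:C - (Re (F t))%:C - (Re a)%:C * (s%:C - t%:C) =
   (Re (F s - F t - a * (s%:C - t%:C)))%:C.
  by apply: eqReIm; rewrite !ReImE; ring.
by rewrite cmodR normRe_cmod.
Qed.

End ComplexDerivative.

Lemma der_chain {R : realType} {T : Type} (j : T -> R[i]) (f : R[i] -> R[i]) F t a b :
  cder f (F t) b -> der j F t a -> der j (fun x => f (F x)) t (b * a).
Proof. by move=> df dF; refine (der_comp j F t a f b _ _). Qed.

(** * Comparison with the derivative in normed modules *)

Section Bridge.

Lemma is_deriveP (K : numFieldType) (V : normedModType K) (f : K -> V) (t : K) (d : V) :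
  is_derive t 1 f d <-> forall e : K, 0 < e -> exists2 de : K, 0 < de &
    forall s, `|s - t| < de -> `|f s - f t - (s - t) *: d| <= e * `|s - t|.
Proof.
have key (h : K) : h != 0 ->
    `|d - h^-1 *: (f (h *: 1 + t) - f t)| =
    `|h|^-1 * `|f (h + t) - f t - (h + t - t) *: d|.
  move=> h0; rewrite -normfV -normrZ addrK [in RHS]scalerBr scalerA mulVf // scale1r.
  by rewrite distrC [h *: 1]mulr1.
split=> [[df dv] e e0|H].
  have cv : h^-1 *: ((f \o shift t) (h *: 1) - f t) @[h --> 0^'] --> d.
    by rewrite -dv; exact: df.
  move/cvgrPdist_le: cv => /(_ e e0) /nbhs_ballP[de /= de0 H]; exists de => // s hs.
  have [->|st] := eqVneq s t; first by rewrite !subrr scale0r subrr !normr0 mulr0.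
  have h0 : s - t != 0 by rewrite subr_eq0.
  have := H (s - t); rewrite /ball /= sub0r normrN => /(_ hs h0).
  by rewrite key // subrK ler_pdivrMl ?normr_gt0 // mulrC.
have cv : h^-1 *: ((f \o shift t) (h *: 1) - f t) @[h --> 0^'] --> d.
  apply/cvgrPdist_le => e e0; have [de de0 {}H] := H e e0.
  apply/nbhs_ballP; exists de => //= h; rewrite /ball /= sub0r normrN => hs h0.
  rewrite key // ler_pdivrMl ?normr_gt0 // mulrC.
  by have := H (h + t); rewrite addrK; exact.
split; first by apply/cvg_ex; exists d.
by apply: cvg_lim cv.
Qed.

Context {R : realType}.

Lemma complex_gt0 (e : R[i]) : 0 < e -> exists2 x : R, 0 < x & e = x%:C.
Proof. by case: e => a b; rewrite ltcE /= => /andP[/eqP -> a0]; exists a. Qed.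

Lemma ltRC (x y : R) : (x%:C < y%:C :> R[i]) = (x < y).
Proof. by rewrite ltcE /= eqxx. Qed.

Lemma leRC (x y : R) : (x%:C <= y%:C :> R[i]) = (x <= y).
Proof. by rewrite lecE /= eqxx. Qed.

Lemma cder_is_derive (f : R[i] -> R[i]) z a :
  cder f z a <-> is_derive (z : R[i]^o) 1 (f : R[i]^o -> R[i]^o) a.
Proof.
split=> [df|/is_deriveP df].
  apply/is_deriveP => e /complex_gt0[x x0 ->]; have [de de0 H] := df x x0.
  exists de%:C => [|s]; first by rewrite ltRC.
  rewrite !normc_cmod ltRC => /H; rewrite -RCM leRC /GRing.scale /=.
  by rewrite (mulrC a).
move=> e e0; have [|de] := df e%:C; first by rewrite ltRC.
move=> /complex_gt0[x x0 ->] H; exists x => // s hs.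
have := H s; rewrite !normc_cmod ltRC => /(_ hs); rewrite -RCM leRC /GRing.scale /=.
by rewrite (mulrC a).
Qed.

Lemma rder_is_derive (f : R -> R) t a :
  rder (fun x => (f x)%:C) t a%:C <-> is_derive (t : R) 1 (f : R -> R^o) a.
Proof.
have key s : (f s)%:C - (f t)%:C - a%:C * (s%:C - t%:C) =
    (f s - f t - (s - t) *: a)%:C.
  by rewrite /GRing.scale /= -!RCN -!RCD -RCM -RCN -RCD (mulrC a).
split=> [df|/is_deriveP df].
  apply/is_deriveP => e e0; have [de de0 H] := df e e0; exists de => // s.
  by move: (H s); rewrite key !cmodR -[cmod _]/(dR s t) dRE => h /h.
move=> e e0; have [de de0 H] := df e e0; exists de => // s.
by rewrite key !cmodR -[cmod _]/(dR s t) dRE; exact: H.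
Qed.

Lemma rcont_Re_continuous (F : R -> R[i]) t :
  rcont F t -> {for t, continuous (fun x => Re (F x))}.
Proof.
move=> cF; apply/cvgrPdist_le => e e0; have [de de0 H] := cF e e0.
apply/nbhs_ballP; exists de => //= s; rewrite /ball /= => hs.
rewrite distrC -ReB; apply: le_trans (normRe_cmod _) _; apply: H.
by rewrite dRE distrC.
Qed.

End Bridge.

(** * The complex exponential *)

Section ComplexExponential.
Context {R : realType}.
Implicit Types (z w : R[i]).

Lemma cexpE z : cexp z = (expR (Re z))%:C * (cos (Im z) +i* sin (Im z)).
Proof. by []. Qed.

Lemma cexp_real (x : R) : cexp x%:C = (expR x)%:C.
Proof. by rewrite cexpE ReC ImC cos0 sin0; apply: eqReIm; rewrite !ReImE; ring. Qed.

Lemma cexpD z w : cexp (z + w) = cexp z * cexp w.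
Proof.
case: z => a b; case: w => c d; rewrite /cexp /= expRD cosD sinD.
by apply: eqReIm; rewrite !ReImE; ring.
Qed.

Lemma cexp0 : cexp (0 : R[i]) = 1.
Proof. by rewrite /cexp /= expR0 cos0 sin0 mul1r. Qed.

Lemma cmod_cexp z : cmod (cexp z) = expR (Re z).
Proof.
rewrite /cexp cmodM cmodR_ge0 ?expR_ge0 //.
by rewrite cmod_mk cos2Dsin2 sqrtr1 mulr1.
Qed.

Lemma cexp_neq0 z : cexp z != 0.
Proof. by rewrite -cmod_gt0 cmod_cexp expR_gt0. Qed.

Lemma cexp_2pi : cexp ((2 * pi)%:C * 'i%C) = 1 :> R[i].
Proof.
rewrite /cexp !ReImE !(mulr0, mul0r, subr0, addr0, mulr1, expR0) mul1r.
by rewrite mulr_natl cos2pi sin2pi.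
Qed.

(** The differential at the origin is complex linear because those of [expR], [cos]
and [sin] there are [1], [0] and [1]; the addition formula carries this to every
point. *)
Lemma cder_cexp0 : cder (@cexp R) 0 1.
Proof.
have dE : rder (fun x : R => (expR x)%:C) 0 1%:C.
  by apply/rder_is_derive; apply: (is_derive_eq (is_derive_expR _)); rewrite expR0.
have dC : rder (fun x : R => (cos x)%:C) 0 0%:C.
  apply/rder_is_derive; by apply: (is_derive_eq (is_derive_cos _)); rewrite sin0 oppr0.
have dS : rder (fun x : R => (sin x)%:C) 0 1%:C.
  by apply/rder_is_derive; apply: (is_derive_eq (is_derive_sin _)); rewrite cos0.
have dT : rder (fun x : R => (cos x)%:C + 'i%C * (sin x)%:C) 0 'i%C.
  apply: der_eq (derD dC (derM (der_cst _ 'i%C _) dS)).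
  by apply: eqReIm; rewrite !ReImE; ring.
move=> e e0; have e3 : 0 < e / 6 by lra.
have [d1 d10 H1] := dE _ e3; have [d2 d20 H2] := dT _ e3.
exists (Num.min (Num.min d1 d2) (Num.min (e / 6) 1)) => [|s].
  by rewrite !lt_min d10 d20 e3 ltr01.
rewrite !lt_min subr0 => /and3P[/andP[s1 s2] s3 s4].
have R1 := normRe_cmod s; have I1 := normIm_cmod s.
have {H1} := H1 (Re s); rewrite subr0 cmodR => /(_ (le_lt_trans R1 s1)) h1.
have {H2} := H2 (Im s); rewrite subr0 cmodR => /(_ (le_lt_trans I1 s2)) h2.
have Ecs : cexp s = (expR (Re s))%:C * ((cos (Im s))%:C + 'i%C * (sin (Im s))%:C).
  by rewrite /cexp; congr (_ * _); apply: eqReIm; rewrite !ReImE /=; ring.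
set E := (expR (Re s))%:C in Ecs h1; set T := (_ + 'i%C * _) in Ecs h2.
have T1 : cmod T = 1.
  have -> : T = cos (Im s) +i* sin (Im s).
    by apply: eqReIm; rewrite /T !ReImE /=; ring.
  by rewrite cmod_mk cos2Dsin2 sqrtr1.
rewrite expR0 in h1; rewrite cos0 sin0 in h2.
have sE : s = (Re s)%:C + 'i%C * (Im s)%:C by exact: complexE.
have -> : cexp s - cexp 0 - 1 * s =
    (E - 1%:C - 1%:C * (Re s)%:C) * T
    + (1 + (Re s)%:C) * (T - (1%:C + 'i%C * 0%:C) - 'i%C * (Im s)%:C)
    + (Re s)%:C * ('i%C * (Im s)%:C).
  rewrite Ecs cexp0 [in LHS]sE.
  have -> : 1%:C = 1 :> R[i] by [].
  have -> : 0%:C = 0 :> R[i] by [].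
  by ring.
apply: le_trans (cmodD _ _) _.
apply: le_trans (lerD (cmodD _ _) (lexx _)) _.
rewrite !cmodM T1 mulr1 cmodi mul1r !cmodR.
have A : `|Re s| * `|Im s| <= e / 6 * cmod s.
  by apply: ler_pM => //; apply: le_trans R1 (ltW s3).
have Z0 := cmod_ge0 s.
have B : e / 6 * `|Re s| <= e / 6 * cmod s by rewrite ler_pM2l.
have C : e / 6 * `|Im s| <= e / 6 * cmod s by rewrite ler_pM2l.
have D : cmod (1 + (Re s)%:C) <= 2.
  by apply: le_trans (cmodD _ _) _; rewrite cmod1 cmodR; lra.
have F : cmod (1 + (Re s)%:C) * cmod (T - (1%:C + 'i%C * 0%:C) - 'i%C * (Im s)%:C)
   <= 2 * (e / 6 * `|Im s|) by apply: ler_pM; rewrite ?cmod_ge0.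
have {}h1 := le_trans h1 B.
have := mulr_ge0 (ltW e0) Z0; lra.
Qed.

Lemma cder_cexp z : cder (@cexp R) z (cexp z).
Proof.
have d0 : cder (fun w : R[i] => w - z) z 1.
  by rewrite -[X in der _ _ _ X]subr0; apply: derB; [exact: cder_id|exact: der_cst].
have d1 : cder (fun w => cexp (w - z)) z 1.
  rewrite -[X in der _ _ _ X]mulr1; apply: der_comp d0; rewrite subrr.
  exact: cder_cexp0.
apply: (der_near _ (fun w => cexp z * cexp (w - z)) _ _ _ 1) => // [s _|].
  by rewrite -cexpD addrC subrK.
apply: der_eq (derM (der_cst _ (cexp z) _) d1).
by rewrite mul0r add0r mulr1.
Qed.

Lemma der_cexp {T : Type} (j : T -> R[i]) F t a : der j F t a ->
  der j (fun x => cexp (F x)) t (cexp (F t) * a).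
Proof. by move=> dF; apply: der_comp dF; exact: cder_cexp. Qed.

Lemma ccont_cexp z : ccont (@cexp R) z.
Proof. exact: der_cont (cder_cexp z). Qed.

End ComplexExponential.

Opaque cexp.

(** * Integration of continuous complex functions over a segment *)

Section Integral.
Context {R : realType}.
Local Notation mu := (@lebesgue_measure R).
Implicit Types (F G : R -> R[i]) (a b : R) (k : R[i]).

Definition icont a b F := forall x, a <= x <= b -> rcont F x.

Definition cint a b F : R[i] :=
  (\int[mu]_(x in `[a, b]) Re (F x)) +i* (\int[mu]_(x in `[a, b]) Im (F x)).

Arguments cint : simpl never.

Lemma rcont_Im_continuous F t :
  rcont F t -> {for t, continuous (fun x => Im (F x))}.
Proof.
move=> cF; have : {for t, continuous (fun x => Re (- 'i%C * F x))}.
  by apply: rcont_Re_continuous; cont_tac.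
rewrite (_ : (fun x => Re (- 'i%C * F x)) = (fun x => Im (F x))) //.
by apply/funext => x; rewrite !ReImE; ring.
Qed.

Lemma within_icont a b (f : R -> R) :
  (forall x, a <= x <= b -> {for x, continuous f}) -> {within `[a, b], continuous f}.
Proof. 
move=> cf; apply: continuous_in_subspaceT => x; rewrite inE /= in_itv /= => /cf.
exact.
Qed.

Lemma integrable_Re a b F : icont a b F ->
  mu.-integrable `[a, b] (EFin \o (fun x => Re (F x))).
Proof.
move=> cF; apply: continuous_compact_integrable; first exact: segment_compact.
by apply: within_icont => x xab; apply: rcont_Re_continuous; exact: cF.
Qed.

Lemma integrable_Im a b F : icont a b F ->
  mu.-integrable `[a, b] (EFin \o (fun x => Im (F x))).
Proof.
move=> cF; apply: continuous_compact_integrable; first exact: segment_compact.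
by apply: within_icont => x xab; apply: rcont_Im_continuous; exact: cF.
Qed.

Lemma icontD a b F G : icont a b F -> icont a b G -> icont a b (fun x => F x + G x).
Proof. by move=> cF cG x xab; apply: contD; [exact: cF|exact: cG]. Qed.

Lemma icontZ a b k F : icont a b F -> icont a b (fun x => k * F x).
Proof. by move=> cF x xab; apply: contM; [exact: cont_cst|exact: cF]. Qed.

Lemma eq_cint a b F G : (forall x, a <= x <= b -> F x = G x) -> cint a b F = cint a b G.
Proof.
move=> FG; rewrite /cint; congr (_ +i* _); apply: eq_Rintegral => x;
  by rewrite inE /= in_itv /= => /FG ->.
Qed.

Lemma cintD a b F G : icont a b F -> icont a b G ->
  cint a b (fun x => F x + G x) = cint a b F + cint a b G.
Proof.
move=> cF cG; rewrite /cint; apply: eqReIm; rewrite !ReImE.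
  under eq_Rintegral do rewrite ReD.
  by rewrite RintegralD //; apply: integrable_Re.
under eq_Rintegral do rewrite ImD.
by rewrite RintegralD //; apply: integrable_Im.
Qed.

Lemma cintZ a b k F : icont a b F -> cint a b (fun x => k * F x) = k * cint a b F.
Proof.
move=> cF; have iR := integrable_Re _ _ _ cF; have iI := integrable_Im _ _ _ cF.
have iZR c : mu.-integrable `[a, b] (EFin \o (fun x => c * Re (F x))).
  rewrite (_ : (fun x => c * Re (F x)) = (fun x => Re (c%:C * F x))).
    by apply: integrable_Re; exact: icontZ.
  by apply/funext => x; rewrite ReCM.
have iZI c : mu.-integrable `[a, b] (EFin \o (fun x => c * Im (F x))).
  rewrite (_ : (fun x => c * Im (F x)) = (fun x => Im (c%:C * F x))).
    by apply: integrable_Im; exact: icontZ.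
  by apply/funext => x; rewrite ImCM.
rewrite /cint; apply: eqReIm; rewrite !ReImE.
  under eq_Rintegral do rewrite ReM.
  by rewrite RintegralB // ?RintegralZl //.
under eq_Rintegral do rewrite ImM.
by rewrite RintegralD // ?RintegralZl //.
Qed.

Lemma cintN a b F : icont a b F -> cint a b (fun x => - F x) = - cint a b F.
Proof.
by move=> cF; rewrite -mulN1r -cintZ //; apply: eq_cint => x _; rewrite mulN1r.
Qed.

Lemma cintB a b F G : icont a b F -> icont a b G ->
  cint a b (fun x => F x - G x) = cint a b F - cint a b G.
Proof.
move=> cF cG; rewrite cintD // ?cintN // => x xab.
by apply: contN; exact: cG.
Qed.

Lemma cint_cst a b k : a <= b -> cint a b (fun=> k) = k * (b - a)%:C.
Proof.
move=> ab.
have muE : fine (mu `[a, b]%classic) = b - a.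
  rewrite lebesgue_measure_itv /= lte_fin; case: ltP => //= ba.
  by apply/eqP; rewrite eq_sym subr_eq0 eq_le ab ba.
have key c : \int[mu]_(x in `[a, b]) c = c * (b - a).
  by rewrite Rintegral_cst //; congr (_ * _).
by rewrite /cint !key; apply: eqReIm; rewrite !ReImE; ring.
Qed.

Lemma cint_split a c b F : a <= c -> c <= b -> icont a b F ->
  cint a b F = cint a c F + cint c b F.
Proof.
move=> ac cb cF.
have key (f : R -> R) : mu.-integrable `[a, b] (EFin \o f) ->
    \int[mu]_(x in `[a, b]) f x = \int[mu]_(x in `[a, c]) f x + \int[mu]_(x in `[c, b]) f x.
  move=> fi; have := @Rintegral_itvB R f (BLeft a) (BRight b) c fi.
  rewrite !bnd_simp => /(_ ac cb) H.
  rewrite -(Rintegral_itv_obnd_cbnd (r := c)); first by rewrite -H addrC subrK.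
  apply: integrableS fi => //.
  by apply: subset_itv; rewrite bnd_simp.
rewrite /cint; apply: eqReIm; rewrite !ReImE key //.
  exact: integrable_Re.
exact: integrable_Im.
Qed.

Lemma cint_real_le a b F G : icont a b F -> icont a b G ->
  (forall x, a <= x <= b -> Re (F x) <= Re (G x)) -> Re (cint a b F) <= Re (cint a b G).
Proof.
move=> cF cG FG; rewrite /cint; by apply: le_Rintegral => //; exact: integrable_Re.
Qed.

Lemma cmod_cint a b F : icont a b F ->
  cmod (cint a b F) <= Re (cint a b (fun x => (cmod (F x))%:C)).
Proof.
move=> cF; set I := cint a b F.
have [I0|I0] := eqVneq I 0.
  rewrite I0 cmod0 /cint ReImE; apply: Rintegral_ge0 => x _; exact: cmod_ge0.
have m0 : 0 < cmod I by rewrite cmod_gt0.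
pose u := I^* / (cmod I)%:C.
have u1 : cmod u = 1.
  by rewrite /u cmodM cmodV cmodJ cmodR_ge0 ?cmod_ge0 // mulfV // gt_eqF.
have -> : cmod I = Re (cint a b (fun x => u * F x)).
  rewrite cintZ // -/I /u mulrAC (mulrC _ I) mulzJ -RCV -RCM ReC expr2 mulfK //.
  by rewrite gt_eqF.
apply: cint_real_le => [||x _]; first exact: icontZ.
  by move=> x xab; apply: cont_cmod; exact: cF.
by rewrite ReC; apply: le_trans (Re_le_cmod _) _; rewrite cmodM u1 mul1r.
Qed.

Lemma cmod_cint_le a b F (M : R) : a <= b -> icont a b F ->
  (forall x, a <= x <= b -> cmod (F x) <= M) -> cmod (cint a b F) <= M * (b - a).
Proof.
move=> ab cF FM; apply: le_trans (cmod_cint _ _ _ cF) _.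
have -> : M * (b - a) = Re (cint a b (fun=> M%:C)).
  by rewrite cint_cst // -RCM ReC.
apply: cint_real_le => [x xab|x _|x xab]; last by rewrite !ReC; exact: FM.
  by apply: cont_cmod; exact: cF.
exact: cont_cst.
Qed.

Lemma cintJ a b F : icont a b F -> cint a b (fun x => (F x)^*) = (cint a b F)^*.
Proof.
move=> cF; rewrite /cint; apply: eqReIm; rewrite !ReImE.
  by under eq_Rintegral do rewrite ReJ.
under eq_Rintegral do rewrite ImJ -mulN1r.
by rewrite RintegralZl ?mulN1r //; exact: integrable_Im.
Qed.

Lemma cint_FTC a b F G : a <= b -> (forall x, a <= x <= b -> rder G x (F x)) ->
  icont a b F -> cint a b F = G b - G a.
Proof.
rewrite le_eqVlt => /predU1P[<- _ _|ab dG cF].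
  by rewrite subrr -[RHS](mulr0 0) /cint set_itv1 !Rintegral_set1 mulr0.
have key (f g : R -> R) : (forall x, a <= x <= b -> rder (fun x => (g x)%:C) x (f x)%:C) ->
   (forall x, a <= x <= b -> {for x, continuous f}) ->
   \int[mu]_(x in `[a, b]) f x = g b - g a.
  move=> dg cf; rewrite /Rintegral (@continuous_FTC2 _ f g) //.
  - exact: within_icont.
    have dg' x : a <= x <= b -> is_derive (x : R) 1 (g : R -> R^o) (f x).
      by move=> xab; apply/rder_is_derive; exact: dg.
    have cg x : a <= x <= b -> {for x, continuous g}.
      move=> xab; apply: differentiable_continuous; apply/derivable1_diffP.
      by have [] := dg' x xab.
    split=> [x||].
    - by rewrite in_itv /= => /andP[h1 h2]; have [] := dg' x; rewrite ?(ltW h1) ?(ltW h2).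
    - by apply: cvg_at_right_filter; apply: cg; lra.
    - by apply: cvg_at_left_filter; apply: cg; lra.
  - move=> x; rewrite in_itv /= => /andP[h1 h2]; rewrite derive1E.
    by have /dg/rder_is_derive[_ ->] : a <= x <= b by rewrite ?(ltW h1) ?(ltW h2).
rewrite /cint; apply: eqReIm; rewrite !ReImE.
  apply: (key (fun x => Re (F x)) (fun x => Re (G x))) => x xab.
    by apply: der_Re; exact: dG.
  by apply: rcont_Re_continuous; exact: cF.
apply: (key (fun x => Im (F x)) (fun x => Im (G x))) => x xab.
  have -> : (fun x => (Im (G x))%:C) = (fun x => (Re (- 'i%C * G x))%:C).
    by apply/funext => y; congr (_%:C); rewrite !ReImE; ring.
  have -> : Im (F x) = Re (- 'i%C * F x) by rewrite !ReImE; ring.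
  apply: der_Re; apply: der_eq (derM (der_cst _ (- 'i%C) _) (dG _ xab)).
  by rewrite mul0r add0r.
by apply: rcont_Im_continuous; exact: cF.
Qed.

End Integral.

Arguments cint : simpl never.
Opaque cint.

(** * Goursat's theorem for rectangles *)

Section Goursat.
Context {R : realType}.
Implicit Types (g h G : R[i] -> R[i]) (a b c d x y : R).

Lemma rder_hor x y : rder (fun t => t +i* y) x (1 : R[i]).
Proof.
apply: (der_near _ (fun t => t%:C + (0 +i* y)) _ _ _ 1) => // [s _|].
  by apply: eqReIm; rewrite !ReImE; ring.
by apply: der_eq (derD (der_inj _ _) (der_cst _ _ _)); rewrite addr0.
Qed.

Lemma rder_ver x y : rder (fun t => x +i* t) y ('i%C : R[i]).
Proof.
apply: (der_near _ (fun t => 'i%C * t%:C + x%:C) _ _ _ 1) => // [s _|].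
  by apply: eqReIm; rewrite !ReImE; ring.
apply: der_eq (derD (derM (der_cst _ 'i%C _) (der_inj _ _)) (der_cst _ x%:C _)).
by rewrite mul0r mulr1 addr0 add0r.
Qed.

Definition rect a b c d : set R[i] := [set z | a <= Re z <= b /\ c <= Im z <= d].

Definition bdry g a b c d : R[i] :=
  cint a b (fun x => g (x +i* c)) - cint a b (fun x => g (x +i* d))
  + 'i%C * (cint c d (fun y => g (b +i* y)) - cint c d (fun y => g (a +i* y))).

Definition rcontin g a b c d := forall z, rect a b c d z -> ccont g z.

Lemma icont_hor g a b c d y : c <= y <= d -> rcontin g a b c d ->
  icont a b (fun x => g (x +i* y)).
Proof.
move=> ycd cg x xab; apply: cont_comp; last exact: cg.
exact: der_cont (rder_hor x y).
Qed.

Lemma icont_ver g a b c d x : a <= x <= b -> rcontin g a b c d ->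
  icont c d (fun y => g (x +i* y)).
Proof.
move=> xab cg y ycd; apply: cont_comp; last exact: cg.
exact: der_cont (rder_ver x y).
Qed.

Lemma bdry_splitx g a m b c d : a <= m <= b -> c <= d -> rcontin g a b c d ->
  bdry g a b c d = bdry g a m c d + bdry g m b c d.
Proof.
move=> /andP[am mb] cd cg; rewrite /bdry (@cint_split _ a m b) //; last first.
  by apply: (icont_hor _ _ _ c d) => //; rewrite lexx.
rewrite (@cint_split _ a m b) //; last first.
  by apply: (icont_hor _ _ _ c d) => //; rewrite lexx cd.
by ring.
Qed.

Lemma bdry_splity g a b c m d : c <= m <= d -> a <= b -> rcontin g a b c d ->
  bdry g a b c d = bdry g a b c m + bdry g a b m d.
Proof.
move=> /andP[am mb] cd cg; rewrite /bdry (@cint_split _ c m d) //; last first.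
  by apply: (icont_ver _ a b) => //; rewrite lexx cd.
rewrite (@cint_split _ c m d) //; last first.
  by apply: (icont_ver _ a b) => //; rewrite lexx.
by ring.
Qed.

Lemma bdry_exact g G a b c d : a <= b -> c <= d -> rcontin g a b c d ->
  (forall z, rect a b c d z -> cder G z (g z)) -> bdry g a b c d = 0.
Proof.
move=> ab cd cg dG.
have Eh y : c <= y <= d -> cint a b (fun x => g (x +i* y)) = G (b +i* y) - G (a +i* y).
  move=> ycd; rewrite (cint_FTC _ _ _ (fun x => G (x +i* y))) //; last exact: icont_hor cg.
  move=> x xab; apply: der_eq (der_chain _ G _ _ _ _ (dG _ _) (rder_hor x y)) => //.
  by rewrite mulr1.
have Ev x : a <= x <= b ->
    'i%C * cint c d (fun y => g (x +i* y)) = G (x +i* d) - G (x +i* c).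
  move=> xab; rewrite -cintZ; last exact: icont_ver cg.
  rewrite (cint_FTC _ _ _ (fun y => G (x +i* y))) //; last first.
    by apply: icontZ; exact: icont_ver cg.
  move=> y ycd; apply: der_eq (der_chain _ G _ _ _ _ (dG _ _) (rder_ver x y)) => //.
  by rewrite mulrC.
by rewrite /bdry mulrBr !Eh ?Ev ?lexx ?ab ?cd //; ring.
Qed.

Lemma bdryD g h a b c d : a <= b -> c <= d -> rcontin g a b c d -> rcontin h a b c d ->
  bdry (fun z => g z + h z) a b c d = bdry g a b c d + bdry h a b c d.
Proof.
move=> ab cd cg ch; rewrite /bdry.
rewrite !cintD; try (by apply: (icont_hor _ _ _ c d) => //; rewrite ?lexx ?cd);
  try (by apply: (icont_ver _ a b) => //; rewrite ?lexx ?ab).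
by ring.
Qed.

Lemma bdry_bound g a b c d (M : R) : a <= b -> c <= d -> rcontin g a b c d ->
  (forall z, rect a b c d z -> cmod (g z) <= M) ->
  cmod (bdry g a b c d) <= 2 * M * (b - a + (d - c)).
Proof.
move=> ab cd cg gM.
have Eh y : c <= y <= d -> cmod (cint a b (fun x => g (x +i* y))) <= M * (b - a).
  move=> ycd; apply: cmod_cint_le => // [|x xab]; first exact: icont_hor cg.
  exact: gM.
have Ev x : a <= x <= b -> cmod (cint c d (fun y => g (x +i* y))) <= M * (d - c).
  move=> xab; apply: cmod_cint_le => // [|y ycd]; first exact: icont_ver cg.
  exact: gM.
have h1 := Eh c; have h2 := Eh d; have v1 := Ev a; have v2 := Ev b.
rewrite !lexx ?ab ?cd /= in h1 h2 v1 v2.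
apply: le_trans (cmodD _ _) _; rewrite cmodM cmodi mul1r.
apply: le_trans (lerD (cmodB _ _) (cmodB _ _)) _.
have {}h1 := h1 isT; have {}h2 := h2 isT; have {}v1 := v1 isT; have {}v2 := v2 isT; lra.
Qed.

Lemma nested_segments (u v : nat -> R) : (forall n, u n <= u n.+1) ->
  (forall n, v n.+1 <= v n) -> (forall n, u n <= v n) ->
  exists x, forall n, u n <= x <= v n.
Proof.
move=> uS vS uv.
have mu m n : (m <= n)%N -> u m <= u n.
  by move=> /subnK <-; elim: (n - m)%N => [|k IH] //; apply: le_trans IH _; rewrite addSn.
have mv m n : (m <= n)%N -> v n <= v m.
  by move=> /subnK <-; elim: (n - m)%N => [|k IH] //; apply: le_trans _ IH; rewrite addSn.
have ub n : ubound (range u) (v n).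
  move=> _ [m _ <-]; case: (leqP m n) => mn; first exact: le_trans (mu _ _ mn) (uv n).
  by apply: le_trans (uv m) (mv _ _ (ltnW mn)).
have hs : has_sup (range u) by split; [exists (u 0); exists 0|exists (v 0); exact: ub].
exists (sup (range u)) => n; apply/andP; split.
  by apply: ub_le_sup; [case: hs|exists n].
by apply: ge_sup; [case: hs|exact: ub].
Qed.

(* A rectangle is stored as the pair of its projections. *)
Let P4 := ((R * R) * (R * R))%type.
Let ok g (P : P4) := [/\ P.1.1 <= P.1.2, P.2.1 <= P.2.2 &
  rcontin g P.1.1 P.1.2 P.2.1 P.2.2].
Let bd g (P : P4) := bdry g P.1.1 P.1.2 P.2.1 P.2.2.

Lemma half_le (x y q : R) : q <= x + y -> q <= 2 * x \/ q <= 2 * y.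
Proof. by move=> h; case: (leP y x) => ?; [left|right]; lra. Qed.

(** One of the halves of a rectangle carries at least half of the boundary integral;
halving both sides keeps a quarter. The hypothesis sits inside the existential so
that a choice function can be iterated. *)
Lemma bisect g (P : P4) : exists P' : P4, ok g P ->
  [/\ ok g P',
     P.1.1 <= P'.1.1 /\ P'.1.2 <= P.1.2, P.2.1 <= P'.2.1 /\ P'.2.2 <= P.2.2,
     P'.1.2 - P'.1.1 = (P.1.2 - P.1.1) / 2 /\ P'.2.2 - P'.2.1 = (P.2.2 - P.2.1) / 2 &
     cmod (bd g P) <= 4 * cmod (bd g P')].
Proof.
case: P => [[a b] [c d]]; rewrite /ok /bd /=.
have [[ab cd cg]|nok] := pselect [/\ a <= b, c <= d & rcontin g a b c d]; last first.
  by exists ((a, b), (c, d)).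
have sub a' b' c' d' : a <= a' -> b' <= b -> c <= c' -> d' <= d -> rcontin g a' b' c' d'.
  by move=> *; move=> z [/andP[? ?] /andP[? ?]]; apply: cg; split; lra.
pose m := (a + b) / 2; pose k := (c + d) / 2.
have am : a <= m by rewrite /m; lra.
have mb : m <= b by rewrite /m; lra.
have ck : c <= k by rewrite /k; lra.
have kd : k <= d by rewrite /k; lra.
have [x1 [x2 [x12 ax xb xw xbd]]] : exists x1 x2, [/\ x1 <= x2, a <= x1, x2 <= b,
    x2 - x1 = (b - a) / 2 & cmod (bdry g a b c d) <= 2 * cmod (bdry g x1 x2 c d)].
  have E := bdry_splitx g a m b c d; rewrite am mb in E.
  have := cmodD (bdry g a m c d) (bdry g m b c d); rewrite -E //.
  move=> /half_le[] h; [exists a, m|exists m, b]; split=> //; rewrite /m; clear -ab; lra.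
have cx : rcontin g x1 x2 c d by apply: sub.
have [y1 [y2 [y12 cy yd yw ybd]]] : exists y1 y2, [/\ y1 <= y2, c <= y1, y2 <= d,
    y2 - y1 = (d - c) / 2 & cmod (bdry g x1 x2 c d) <= 2 * cmod (bdry g x1 x2 y1 y2)].
  have E := bdry_splity g x1 x2 c k d; rewrite ck kd in E.
  have := cmodD (bdry g x1 x2 c k) (bdry g x1 x2 k d); rewrite -E //.
  move=> /half_le[] h; [exists c, k|exists k, d]; split=> //; rewrite /k; clear -cd; lra.
exists ((x1, x2), (y1, y2)) => _; split; [|by []|by []|by []|].
  by split; [exact: x12|exact: y12|exact: sub].
by apply: le_trans xbd _; rewrite -[4]/((2 * 2)%:R) natrM -mulrA ler_pM2l.
Qed.

(** Bisection produces a point at which a nonzero boundary integral would have to be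
of the order of the square of the diameter, whereas differentiability there makes
it smaller: the affine part of [g] has a primitive and contributes nothing. *)
Lemma goursat g a b c d : a <= b -> c <= d ->
  (forall z, rect a b c d z -> exists k, cder g z k) -> bdry g a b c d = 0.
Proof.
move=> ab cd dg.
have cg : rcontin g a b c d by move=> z zr; have [k kd] := dg z zr; exact: der_cont kd.
have [step Hstep] := choice (bisect g).
pose P n := iter n step ((a, b), (c, d)).
have okP n : ok g (P n) by elim: n => [|n IH] //=; have [] := Hstep _ IH.
have PS n := Hstep _ (okP n).
have [p0 Hp] : exists x, forall n, (P n).1.1 <= x <= (P n).1.2.
  apply: nested_segments => n; first by have [_ []] := PS n.
    by have [_ []] := PS n.
  by have [] := okP n.
have [q0 Hq] : exists x, forall n, (P n).2.1 <= x <= (P n).2.2.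
  apply: nested_segments => n; first by have [_ _ []] := PS n.
    by have [_ _ []] := PS n.
  by have [] := okP n.
pose L := (b - a) + (d - c); have L0 : 0 <= L by rewrite /L; lra.
have wP n : (P n).1.2 - (P n).1.1 + ((P n).2.2 - (P n).2.1) = L / 2 ^+ n.
  elim: n => [|n IH]; first by rewrite expr0 divr1.
  have [_ _ _ [/= E1 E2] _] := PS n; rewrite -/(P n) in E1 E2.
  rewrite E1 E2 -mulrDl IH exprS; field.
  by rewrite expf_neq0.
have bP n : cmod (bdry g a b c d) <= 4 ^+ n * cmod (bd g (P n)).
  elim: n => [|n IH]; first by rewrite expr0 mul1r.
  apply: le_trans IH _; rewrite exprSr -mulrA ler_wpM2l ?exprn_ge0 //.
  by have [_ _ _ _] := PS n.
have [D dD] : exists k, cder g (p0 +i* q0) k by apply: dg; split; [exact: (Hp 0)|exact: (Hq 0)].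
apply/eqP; rewrite -cmod_eq0 eq_le cmod_ge0 andbT.
suff H e : 0 < e -> cmod (bdry g a b c d) <= e * (2 * L ^+ 2).
  apply/ler_addgt0Pr => e e0; rewrite add0r.
  have K0 : 0 < 2 * L ^+ 2 + 1 by have := sqr_ge0 L; lra.
  apply: le_trans (H (e / (2 * L ^+ 2 + 1)) _) _; first by rewrite divr_gt0.
  by rewrite mulrAC ler_pdivrMr // ler_pM2l //; lra.
move=> e0; have [de de0 Hde] := dD e e0.
have [n Hn] : exists n, L / 2 ^+ n < de.
  have [N HN] : exists N : nat, L / de < N%:R.
    by exists (Num.bound (L / de)); apply: archi_boundP; rewrite divr_ge0 // ltW.
  exists N; rewrite ltr_pdivrMr ?exprn_gt0 // mulrC -ltr_pdivrMr //.
  apply: lt_trans HN _; rewrite -natrX ltr_nat; exact: ltn_expl.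
apply: le_trans (bP n) _.
have [] := okP n; have := Hp n; have := Hq n; have := wP n; rewrite /bd.
set a' := (P n).1.1; set b' := (P n).1.2; set c' := (P n).2.1; set d' := (P n).2.2.
move=> W Hq' Hp' ab' cd' cg'.
set p := p0 +i* q0 in dD Hde.
pose l z := g p + D * (z - p).
have cl : rcontin l a' b' c' d'.
  by move=> z _; rewrite /l; cont_tac.
have -> : g = (fun z => l z + (g z - l z)).
  by apply/funext => z; rewrite addrC subrK.
rewrite bdryD //; last first.
  move=> z Hz; apply: contB; [exact: cg'|exact: cl].
rewrite (bdry_exact l (fun z => g p * z + D / 2%:R * ((z - p) * (z - p)))) // ?add0r; last first.
  move=> z _.
  have d1 : cder (fun z => z - p) z (1 - 0) by apply: derB; [exact: cder_id|exact: der_cst].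
  apply: der_eq (derD (derM (der_cst _ _ _) (cder_id z))
    (derM (der_cst _ _ _) (derM d1 d1))).
  by rewrite /l; field.
have LZ z : rect a' b' c' d' z -> cmod (z - p) <= L / 2 ^+ n.
  move=> [/andP[z1 z2] /andP[z3 z4]]; rewrite -W.
  apply: le_trans (cmod_le_ReIm _) _; rewrite ReB ImB /p !ReImE.
  move/andP: Hp' => [p1 p2]; move/andP: Hq' => [q1 q2].
  clear -z1 z2 z3 z4 p1 p2 q1 q2.
  by apply: lerD; rewrite ler_norml; apply/andP; split; lra.
have -> : e * (2 * L ^+ 2) = 4 ^+ n * (2 * (e * (L / 2 ^+ n)) * (L / 2 ^+ n)).
  rewrite (_ : 4 = 2 * 2 :> R); last by ring.
  rewrite exprMn; field.
  by rewrite expf_neq0.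
rewrite ler_wpM2l ?exprn_ge0 // -{2}W; apply: bdry_bound => // [|z Hz].
  move=> z Hz; apply: contB; [exact: cg'|exact: cl].
have zp := LZ z Hz.
have := Hde z (le_lt_trans zp Hn).
have -> : g z - l z = g z - g p - D * (z - p) by rewrite /l; ring.
by move=> h; apply: le_trans h _; rewrite ler_pM2l.
Qed.

End Goursat.

(** * Means over circles *)

Section CircleMean.
Context {R : realType}.
Implicit Types (f F G : R[i] -> R[i]) (r s : R) (k w z : R[i]).

Definition circ r (t : R) : R[i] := r%:C * cexp (t%:C * 'i%C).

Definition ccircle r F := forall z, cmod z = r -> ccont F z.

Definition mean r F : R[i] := (2 * pi)^-1%:C * cint 0 (2 * pi) (fun t => F (circ r t)).

Lemma pi2_gt0 : 0 < 2 * pi :> R.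
Proof. by rewrite mulr_gt0 // pi_gt0. Qed.

Lemma cmod_circ r t : 0 <= r -> cmod (circ r t) = r.
Proof.
move=> r0; rewrite /circ cmodM cmodR_ge0 // cmod_cexp ReCM ReImE mulr0 expR0.
by rewrite mulr1.
Qed.

Lemma rcont_circ r t : rcont (circ r) t.
Proof.
apply: contM; first exact: cont_cst.
apply: (cont_comp _ (fun t => t%:C * 'i%C)); last exact: ccont_cexp.
apply: contM; last exact: cont_cst.
exact: der_cont (der_inj _ _).
Qed.

Lemma icont_circ r F : 0 <= r -> ccircle r F ->
  icont 0 (2 * pi) (fun t => F (circ r t)).
Proof.
move=> r0 cF t _; apply: cont_comp; first exact: rcont_circ.
by apply: cF; exact: cmod_circ.
Qed.

Lemma eq_mean r F G : 0 <= r -> (forall z, cmod z = r -> F z = G z) ->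
  mean r F = mean r G.
Proof.
move=> r0 FG; congr (_ * _); apply: eq_cint => t _; apply: FG.
exact: cmod_circ.
Qed.

Lemma meanD r F G : 0 <= r -> ccircle r F -> ccircle r G ->
  mean r (fun z => F z + G z) = mean r F + mean r G.
Proof.
move=> r0 cF cG.
by rewrite /mean cintD; [rewrite mulrDr|exact: icont_circ|exact: icont_circ].
Qed.

Lemma meanB r F G : 0 <= r -> ccircle r F -> ccircle r G ->
  mean r (fun z => F z - G z) = mean r F - mean r G.
Proof.
move=> r0 cF cG.
by rewrite /mean cintB; [rewrite mulrBr|exact: icont_circ|exact: icont_circ].
Qed.

Lemma meanZ r k F : 0 <= r -> ccircle r F -> mean r (fun z => k * F z) = k * mean r F.
Proof. by move=> r0 cF; rewrite /mean cintZ; [rewrite mulrCA|exact: icont_circ]. Qed.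

Lemma meanJ r F : 0 <= r -> ccircle r F -> mean r (fun z => (F z)^*) = (mean r F)^*.
Proof. by move=> r0 cF; rewrite /mean cintJ; [rewrite conjM conjRC|exact: icont_circ]. Qed.

Lemma mean_cst r k : mean r (fun=> k) = k.
Proof.
rewrite /mean cint_cst; last exact: ltW pi2_gt0.
by rewrite subr0 mulrCA -RCM mulVf ?mulr1 // gt_eqF // pi2_gt0.
Qed.

Lemma mean_le r F G : 0 <= r -> ccircle r F -> ccircle r G ->
  (forall z, cmod z = r -> Re (F z) <= Re (G z)) -> Re (mean r F) <= Re (mean r G).
Proof.
move=> r0 cF cG FG; rewrite /mean !ReCM ler_pM2l ?invr_gt0 ?pi2_gt0 //.
apply: cint_real_le => [||t _]; try exact: icont_circ.
by apply: FG; exact: cmod_circ.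
Qed.

Lemma mean_ge0 r F : 0 <= r -> ccircle r F ->
  (forall z, cmod z = r -> 0 <= Re (F z)) -> 0 <= Re (mean r F).
Proof.
move=> r0 cF F0; have := mean_le r (fun=> 0) F r0 _ cF F0.
by rewrite mean_cst; apply=> z _; exact: cont_cst.
Qed.

Definition rmean r F : R := Re (mean r (fun z => (cmod (F z))%:C)).

Lemma cmod_mean r F : 0 <= r -> ccircle r F -> cmod (mean r F) <= rmean r F.
Proof.
move=> r0 cF; rewrite /rmean /mean cmodM ReCM cmodR gtr0_norm ?invr_gt0 ?pi2_gt0 //.
rewrite ler_pM2l ?invr_gt0 ?pi2_gt0 //; apply: cmod_cint; exact: icont_circ.
Qed.

Lemma rmean_ge0 r F : 0 <= r -> ccircle r F -> 0 <= rmean r F.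
Proof. by move=> r0 cF; apply: le_trans (cmod_mean _ _ r0 cF); exact: cmod_ge0. Qed.

Lemma cmod_meanM r F G (M : R) : 0 <= r -> ccircle r F -> ccircle r G ->
  (forall z, cmod z = r -> cmod (G z) <= M) ->
  cmod (mean r (fun z => F z * G z)) <= rmean r F * M.
Proof.
move=> r0 cF cG GM.
have cFG : ccircle r (fun z => F z * G z).
  by move=> z zr; apply: contM; [exact: cF|exact: cG].
apply: le_trans (cmod_mean _ _ r0 cFG) _.
have -> : rmean r F * M = Re (mean r (fun z => M%:C * (cmod (F z))%:C)).
  rewrite /rmean mulrC -ReCM -meanZ // => z zr; apply: cont_cmod; exact: cF.
apply: mean_le => // [z zr|z zr|z zr]; first by apply: cont_cmod; exact: cFG.
  by apply: contM; [exact: cont_cst|apply: cont_cmod; exact: cF].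
by rewrite -RCM !ReC cmodM mulrC ler_wpM2r ?cmod_ge0 // GM.
Qed.

Lemma cmod_mean_le r F (M : R) : 0 <= r -> ccircle r F ->
  (forall z, cmod z = r -> cmod (F z) <= M) -> cmod (mean r F) <= M.
Proof.
move=> r0 cF FM; apply: le_trans (cmod_mean _ _ r0 cF) _.
have -> : M = Re (mean r (fun=> M%:C)) by rewrite mean_cst.
apply: mean_le => // z zr; first by apply: cont_cmod; exact: cF.
  exact: cont_cst.
Qed.

(** The mean is independent of the radius: in the logarithmic coordinate the
annulus becomes a rectangle whose two horizontal sides cancel by periodicity. *)
Lemma mean_annulus r s f : 0 < r -> r <= s ->
  (forall z, r <= cmod z <= s -> exists k, cder f z k) -> mean r f = mean s f.
Proof.
move=> r0 rs df; have s0 : 0 < s by lra.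
pose g z := f (cexp z).
have lnrs : ln r <= ln s by rewrite ler_ln ?posrE.
have gh (z : R[i]) : rect (ln r) (ln s) 0 (2 * pi) z -> exists k, cder g z k.
  move=> [/andP[z1 z2] _]; have [|k dk] := df (cexp z).
    rewrite cmod_cexp -(lnK r0) -(lnK s0) !ler_expR; exact/andP.
  by exists (k * cexp z); apply: der_chain => //; exact: cder_cexp.
have := goursat g _ _ _ _ lnrs (ltW pi2_gt0) gh.
rewrite /bdry (_ : cint _ _ (fun x => g (x +i* (2 * pi))) =
    cint (ln r) (ln s) (fun x => g (x +i* 0))); last first.
  apply: eq_cint => x _; rewrite /g; congr f.
  have -> : x +i* (2 * pi) = (x +i* 0) + (2 * pi)%:C * 'i%C :> R[i].
    by apply: eqReIm; rewrite !ReImE; ring.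
  by rewrite cexpD cexp_2pi mulr1.
rewrite subrr add0r => /eqP; rewrite mulf_eq0 -cmod_eq0 cmodi oner_eq0 /=.
rewrite subr_eq0 => /eqP E.
have key q : 0 < q -> cint 0 (2 * pi) (fun y => g (ln q +i* y)) =
    cint 0 (2 * pi) (fun t => f (circ q t)).
  move=> q0; apply: eq_cint => t _; rewrite /g /circ; congr f.
  have -> : ln q +i* t = (ln q)%:C + t%:C * 'i%C :> R[i].
    by apply: eqReIm; rewrite !ReImE; ring.
  by rewrite (cexpD (ln q)%:C) cexp_real lnK.
rewrite /mean; congr (_ * _).
exact: etrans (esym (key r r0)) (etrans (esym E) (key s s0)).
Qed.

Lemma circB r s t : cmod (circ r t - circ s t) = `|r - s|.
Proof.
rewrite /circ -mulrBl cmodM -RCN -RCD cmodR cmod_cexp ReCM ReImE mulr0 expR0.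
by rewrite mulr1.
Qed.

(** Compactness of the circle makes continuity uniform along it. *)
Lemma mean_radius_cont s f : 0 < s -> ccircle s f ->
  forall e : R, 0 < e -> exists2 de : R, 0 < de & forall r, 0 <= r -> `|r - s| < de ->
    ccircle r f -> cmod (mean r f - mean s f) <= e.
Proof.
move=> s0 cf e e0.
have e2 : 0 < e / 2 by lra.
pose P (r t : R) := cmod (f (circ r t) - f (circ s t)) <= e.
have K : compact `[0, 2 * pi : R]%classic by exact: segment_compact.
have /compact_near_coveringP := K => /(_ R (nbhs s) P _) [].
  move=> t _; have [de de0 H] := cf _ (cmod_circ s t (ltW s0)) _ e2.
  have de2 : 0 < de / 2 by lra.
  have [d2 d20 H2] := rcont_circ s t _ de2.
  exists (ball t (Num.min d2 de), ball s (de / 2)).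
    split => /=; first by apply: nbhsx_ballx; rewrite lt_min d20.
    exact: nbhsx_ballx.
  move=> [t' r] [] /=; rewrite /ball /= lt_min => /andP[t1 t2] r1.
  have h2 : cmod (circ s t' - circ s t) <= de / 2.
    by apply: H2; rewrite dRE distrC.
  have a1 : cmod (f (circ s t') - f (circ s t)) <= e / 2.
    by apply: H; rewrite /dC; lra.
  have a2 : cmod (f (circ r t') - f (circ s t)) <= e / 2.
    apply: H; rewrite /dC.
    have -> : circ r t' - circ s t = (circ r t' - circ s t') + (circ s t' - circ s t) by ring.
    by apply: le_lt_trans (cmodD _ _) _; rewrite circB distrC; lra.
  rewrite /P.
  have -> : f (circ r t') - f (circ s t') =
    (f (circ r t') - f (circ s t)) - (f (circ s t') - f (circ s t)) by ring.
  by apply: le_trans (cmodB _ _) _; lra.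
move=> de /= de0 Hde; exists de => // r r0 rs cr.
have H t : 0 <= t <= 2 * pi -> P r t.
  move=> t2; apply: (Hde r); first by rewrite /ball /= distrC.
  by rewrite /= in_itv.
rewrite /mean -mulrBr -cintB; [|exact: icont_circ|by apply: icont_circ => //; exact: ltW].
rewrite cmodM cmodR gtr0_norm ?invr_gt0 ?pi2_gt0 // ler_pdivrMl ?pi2_gt0 //.
rewrite [leRHS]mulrC -[X in _ <= _ * X]subr0; apply: cmod_cint_le => //; first exact: ltW pi2_gt0.
move=> x xab; apply: contB; [exact: icont_circ|apply: icont_circ => //; exact: ltW].
Qed.

Lemma mean_center r f : 0 < r -> ccont f 0 ->
  (forall z, 0 < cmod z <= r -> exists k, cder f z k) -> mean r f = f 0.
Proof.
move=> r0 cf df; apply/eqP; rewrite -subr_eq0 -cmod_eq0 eq_le cmod_ge0 andbT.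
apply/ler_addgt0Pr => e e0; rewrite add0r; have [de de0 H] := cf e e0.
pose s := Num.min r (de / 2).
have s0 : 0 < s by rewrite lt_min r0; lra.
have sr : s <= r by rewrite ge_min lexx.
have sd : s < de by rewrite gt_min; apply/orP; right; lra.
rewrite -(mean_annulus s r) // => [|z zsr]; last by apply: df; lra.
have cs : ccircle s f.
  by move=> z zs; have [|k dk] := df z; [rewrite zs s0|exact: der_cont dk].
rewrite -(mean_cst s (f 0)) -meanB //; [|exact: ltW|by move=> z _; exact: cont_cst].
apply: cmod_mean_le => // [|z zs|z zs]; first exact: ltW.
  by apply: contB; [exact: cs|exact: cont_cst].
by apply: H; rewrite /dC subr0 zs.
Qed.

(** A point at which the function is merely continuous does no harm: the mean is
constant on either side of its modulus and continuous in the radius. *)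
Lemma mean_center_but1 r f w : 0 < cmod w < r -> (forall z, cmod z <= r -> ccont f z) ->
  (forall z, 0 < cmod z <= r -> z != w -> exists k, cder f z k) -> mean r f = f 0.
Proof.
move=> /andP[w0 wr] cf df; have r0 : 0 < r by lra.
have cc s : s <= r -> ccircle s f by move=> sr z zs; apply: cf; rewrite zs.
have neqw z : cmod z != cmod w -> z != w by apply: contra_neq => ->.
apply/eqP; rewrite -subr_eq0 -cmod_eq0 eq_le cmod_ge0 andbT.
apply/ler_addgt0Pr => e e0; rewrite add0r; have e2 : 0 < e / 2 by lra.
have [de de0 H] := mean_radius_cont _ _ w0 (cc _ (ltW wr)) _ e2.
pose s1 := Num.max (cmod w / 2) (cmod w - de / 2).
pose s2 := Num.min r (cmod w + de / 2).
have [A1 A2 A3] : [/\ 0 < s1, s1 < cmod w & cmod w - de < s1].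
  by split; rewrite /s1 ?lt_max ?gt_max; lra.
have [B1 B2 B3] : [/\ s2 <= r, cmod w < s2 & s2 < cmod w + de].
  by split; rewrite /s2 ?lt_min ?gt_min ?ge_min; lra.
have h1 : mean s1 f = f 0.
  apply: mean_center => // [|z /andP[z0 zs]]; first by apply: cf; rewrite cmod0 ltW.
  by apply: df; [lra|apply: neqw; rewrite lt_eqF //; lra].
have h2 : mean s2 f = mean r f.
  apply: mean_annulus => //; first by lra.
  move=> z /andP[zs zr]; apply: df; first by lra.
  by apply: neqw; rewrite gt_eqF //; lra.
rewrite -h1 -h2.
have d1 : cmod (mean s1 f - mean (cmod w) f) <= e / 2.
  by apply: H; [lra|rewrite ltr_norml; lra|apply: cc; lra].
have d2 : cmod (mean s2 f - mean (cmod w) f) <= e / 2.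
  by apply: H; [lra|rewrite ltr_norml; lra|apply: cc; lra].
move: (mean s1 f) (mean s2 f) (mean (cmod w) f) d1 d2 => x1 x2 x d1 d2.
have -> : x2 - x1 = (x2 - x) - (x1 - x) by ring.
by apply: le_trans (cmodB _ _) _; clear -d1 d2; lra.
Qed.

End CircleMean.

Opaque mean.

(** * Cauchy's formula and its consequences *)

Section Cauchy.
Context {R : realType}.
Implicit Types (f F G P : R[i] -> R[i]) (r : R) (k w z : R[i]).

Definition holo f := forall z, cmod z < 1 -> exists k, cder f z k.

Definition holo_le r f := forall z, cmod z <= r -> exists k, cder f z k.

Lemma holo_holo_le r f : r < 1 -> holo f -> holo_le r f.
Proof. by move=> r1 hf z zr; apply: hf; lra. Qed.

Lemma holo_le_cont r f z : holo_le r f -> cmod z <= r -> ccont f z.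
Proof. by move=> hf /hf[k dk]; exact: der_cont dk. Qed.

Lemma holo_cont f z : holo f -> cmod z < 1 -> ccont f z.
Proof. by move=> hf /hf[k dk]; exact: der_cont dk. Qed.

Lemma holo_circle r f : r < 1 -> holo f -> forall z, cmod z = r -> ccont f z.
Proof. by move=> r1 hf z zr; apply: holo_cont => //; rewrite zr. Qed.

Lemma mean_holo_le r f : 0 < r -> holo_le r f -> mean r f = f 0.
Proof.
move=> r0 hf; apply: mean_center => //; first by apply: (holo_le_cont r); rewrite ?cmod0 // ltW.
by move=> z /andP[_ zr]; exact: hf.
Qed.

Lemma cmod_lt_neq z w : cmod w < cmod z -> z - w != 0.
Proof.
by rewrite subr_eq0 => wz; apply/eqP => E; rewrite E ltxx in wz.
Qed.

Lemma mulzJ_circle r z : cmod z = r -> z * z^* = (r ^+ 2)%:C.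
Proof. by move=> <-; exact: mulzJ. Qed.

Lemma ccircle_ker r w : cmod w < r ->
  forall z, cmod z = r -> ccont (fun z => (z - w)^-1) z.
Proof.
move=> wr z zr; apply: contV; last by cont_tac.
by apply: cmod_lt_neq; rewrite zr.
Qed.

Lemma reflected_denom_neq0 r w z : cmod w < r -> cmod z <= r -> (r ^+ 2)%:C - w^* * z != 0.
Proof.
move=> wr zr; apply: cmod_lt_neq.
have r0 : 0 < r by have := cmod_ge0 w; lra.
have w0 := cmod_ge0 w; have z0 := cmod_ge0 z.
by rewrite cmodM cmodJ cmodR_ge0 ?sqr_ge0 //; nra.
Qed.

Lemma holo_le_reflected r w : cmod w < r -> holo_le r (fun z => ((r ^+ 2)%:C - w^* * z)^-1).
Proof.
move=> wr z zr; eexists; apply: derV; first exact: reflected_denom_neq0.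
apply: derB; first exact: der_cst.
by apply: derM; [exact: der_cst|exact: cder_id].
Qed.

(** Conjugation turns the kernel into a function holomorphic inside the circle. *)
Lemma conj_kernel r w z : 0 < r -> cmod w < r -> cmod z = r ->
  (z / (z - w))^* = (r ^+ 2)%:C * ((r ^+ 2)%:C - w^* * z)^-1.
Proof.
move=> r0 wr zr; have zJ := mulzJ_circle _ _ zr.
have z0 : z != 0 by rewrite -cmod_gt0 zr.
have zw : z - w != 0 by apply: cmod_lt_neq; rewrite zr.
have d0 : (r ^+ 2)%:C - w^* * z != 0 by apply: reflected_denom_neq0; rewrite ?zr.
have zJ0 : z^* - w^* != 0 by rewrite -conjB conjc_eq0.
rewrite conjM conjV conjB -zJ; rewrite -zJ in d0.
by field; rewrite zJ0 andbT.
Qed.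

Lemma mean_kernel r w : cmod w < r -> mean r (fun z => z / (z - w)) = 1.
Proof.
move=> wr; have r0 : 0 < r by have := cmod_ge0 w; lra.
have ck := ccircle_ker _ _ wr.
apply: (can_inj conjK); rewrite -meanJ ?ltW //; last first.
  by move=> z zr; apply: contM; [exact: cont_id|exact: ck].
rewrite (eq_mean _ _ (fun z => (r ^+ 2)%:C * ((r ^+ 2)%:C - w^* * z)^-1)) ?ltW //; last first.
  by move=> z; exact: conj_kernel.
have hk := holo_le_reflected _ _ wr.
rewrite meanZ ?ltW //; last by move=> z zr; apply: (holo_le_cont r) => //; rewrite zr.
rewrite mean_holo_le // mulr0 subr0 mulfV ?conj1 //.
by rewrite RC_eq0 expf_neq0 // gt_eqF.
Qed.

(** The difference quotient of [f] at [w] is continuous, and differentiable except at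
[w]; hence its product with the variable has mean zero. *)
Lemma cauchy_le r f w : holo_le r f -> cmod w < r ->
  mean r (fun z => f z * (z / (z - w))) = f w.
Proof.
move=> hf wr; have r0 : 0 < r by have := cmod_ge0 w; lra.
have r0' := ltW r0.
have cf : ccircle r f by move=> z zr; apply: (holo_le_cont r) => //; rewrite zr.
have ck := ccircle_ker _ _ wr.
have cker : ccircle r (fun z => z / (z - w)).
  by move=> z zr; apply: contM; [exact: cont_id|exact: ck].
have [w0|w0] := eqVneq w 0.
  rewrite (eq_mean _ _ f) // ?mean_holo_le ?w0 // => z zr; rewrite subr0 mulfV ?mulr1 //.
  by rewrite -cmod_gt0 zr.
have [k dk] := hf w (ltW wr).
pose h z := if z == w then k else (f z - f w) / (z - w).
pose F z := z * h z.
have hE z : z != w -> h z = (f z - f w) / (z - w) by move=> /negPf zw; rewrite /h zw.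
have near_neq z s : z != w -> cmod (s - z) < cmod (z - w) -> s != w.
  by move=> zw; apply: contraTneq => ->; rewrite cmodBC ltxx.
have dh z : cmod z <= r -> z != w -> exists k, cder h z k.
  move=> zr zw; have [a da] := hf z zr.
  eexists; apply: (der_near _ (fun z => (f z - f w) / (z - w)) _ _ _ (cmod (z - w))).
  - by rewrite cmod_gt0 subr_eq0.
  - by move=> s hs; rewrite hE // (near_neq z).
  - apply: derM; first by apply: derB; [exact: da|exact: der_cst].
    apply: derV; first by rewrite subr_eq0.
    by apply: derB; [exact: cder_id|exact: der_cst].
have ch z : cmod z <= r -> ccont h z.
  move=> zr; have [zw|zw] := eqVneq z w; last by have [a da] := dh z zr zw; exact: der_cont da.
  rewrite zw => e e0; have [de de0 H] := dk e e0; exists de => // s hs.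
  have [sw|sw] := eqVneq s w; first by rewrite sw subrr cmod0 ltW.
  have sw0 : 0 < cmod (s - w) by rewrite cmod_gt0 subr_eq0.
  rewrite hE // /h eqxx -(ler_pM2r sw0) -cmodM mulrBl mulfVK ?subr_eq0 //.
  exact: H.
have cF z : cmod z <= r -> ccont F z by move=> zr; apply: contM; [exact: cont_id|exact: ch].
have dF z : 0 < cmod z <= r -> z != w -> exists k, cder F z k.
  move=> /andP[_ zr] zw; have [a da] := dh z zr zw.
  by eexists; apply: derM; [exact: cder_id|exact: da].
have := mean_center_but1 r F w _ cF dF; rewrite cmod_gt0 w0 wr => /(_ isT).
rewrite {2}/F mul0r.
rewrite (eq_mean _ _ (fun z => f z * (z / (z - w)) - f w * (z / (z - w)))) //; last first.
  move=> z zr; rewrite /F hE; last by rewrite -subr_eq0; apply: cmod_lt_neq; rewrite zr.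
  by ring.
rewrite meanB //; last 2 first.
- by move=> z zr; apply: contM; [exact: cf|exact: cker].
- by move=> z zr; apply: contM; [exact: cont_cst|exact: cker].
by rewrite meanZ // mean_kernel // mulr1 => /eqP; rewrite subr_eq0 => /eqP.
Qed.

Lemma cauchy r f w : holo f -> r < 1 -> cmod w < r ->
  mean r (fun z => f z * (z / (z - w))) = f w.
Proof. by move=> hf r1; apply: cauchy_le; exact: holo_holo_le. Qed.

(** Cauchy integrals of a merely continuous density are twice differentiable; this
is applied to the density given by Cauchy's formula. *)
Definition cauchy_int r P (m : nat) w := mean r (fun z => P z * (z - w)^-1 ^+ m).

Lemma ccircle_kerX r w m : cmod w < r ->
  forall z, cmod z = r -> ccont (fun z => (z - w)^-1 ^+ m) z.
Proof.
move=> wr z zr; elim: m => [|m IH]; first exact: cont_cst.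
rewrite (_ : (fun z => _) = (fun z => (z - w)^-1 * (z - w)^-1 ^+ m)).
  by apply: contM => //; exact: (ccircle_ker r w wr z zr).
by apply/funext => s; rewrite exprS.
Qed.

Lemma cmod_kerX r w z m (q : R) : cmod w <= q -> q < r -> cmod z = r ->
  cmod ((z - w)^-1 ^+ m) <= (r - q)^-1 ^+ m.
Proof.
move=> wq qr zr; have qr0 : 0 < r - q by lra. have qr0' := ltW qr0.
rewrite cmodX; apply: lerXn2r; rewrite ?nnegrE ?cmod_ge0 ?invr_ge0 //.
rewrite cmodV lef_pV2 ?posrE //; first by have := cmodB_ge z w; lra.
by have := cmodB_ge z w; lra.
Qed.

Lemma cmod_cauchy_int r P m w (q : R) : 0 < r -> ccircle r P -> cmod w <= q -> q < r ->
  cmod (cauchy_int r P m w) <= rmean r P * (r - q)^-1 ^+ m.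
Proof.
move=> r0 cP wq qr; apply: cmod_meanM => //; first exact: ltW.
  by apply: (ccircle_kerX r); lra.
by move=> z zr; exact: cmod_kerX.
Qed.

Lemma cauchy_int_taylor1 r P w v (q : R) : 0 < r -> ccircle r P ->
  cmod w <= q -> cmod v <= q -> q < r ->
  cmod (cauchy_int r P 1 v - cauchy_int r P 1 w - (v - w) * cauchy_int r P 2 w)
    <= rmean r P * (r - q)^-1 ^+ 3 * cmod (v - w) ^+ 2.
Proof.
move=> r0 cP wq vq qr; have wr : cmod w < r by lra.
have vr : cmod v < r by lra.
have r0' := ltW r0.
have cK x m : cmod x < r -> forall z, cmod z = r -> ccont (fun z => P z * (z - x)^-1 ^+ m) z.
  by move=> xr z zr; apply: contM; [exact: cP|exact: (ccircle_kerX r)].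
have cK2 : ccircle r (fun z => (v - w) * (P z * (z - w)^-1 ^+ 2)).
  by move=> z zr; apply: contM; [exact: cont_cst|exact: cK].
rewrite /cauchy_int -meanZ; [|exact: r0'|exact: cK].
rewrite -meanB; [|exact: r0'|exact: cK|exact: cK].
rewrite -meanB; [|exact: r0'| |exact: cK2]; last first.
  by move=> z zr; apply: contB; exact: cK.
rewrite (eq_mean _ _ (fun z =>
  P z * ((v - w) ^+ 2 * ((z - v)^-1 ^+ 1 * (z - w)^-1 ^+ 2)))) //; last first.
  move=> z zr.
  have zw : z - w != 0 by apply: cmod_lt_neq; rewrite zr.
  have zv : z - v != 0 by apply: cmod_lt_neq; rewrite zr.
  by field; rewrite zv zw.
rewrite -mulrA; apply: cmod_meanM => // [z zr|z zr].
  by apply: contM; [exact: cont_cst|apply: contM; exact: (ccircle_kerX r)].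
rewrite cmodM cmodX [leRHS]mulrC ler_wpM2l ?exprn_ge0 ?cmod_ge0 //.
rewrite cmodM (exprD _ 1 2); apply: ler_pM; rewrite ?cmod_ge0 //; exact: cmod_kerX.
Qed.

Lemma cauchy_int_taylor2 r P w v (q : R) : 0 < r -> ccircle r P ->
  cmod w <= q -> cmod v <= q -> q < r ->
  cmod (cauchy_int r P 2 v - cauchy_int r P 2 w - (v - w) * (2%:R * cauchy_int r P 3 w))
    <= rmean r P * (10 * r * (r - q)^-1 ^+ 5) * cmod (v - w) ^+ 2.
Proof.
move=> r0 cP wq vq qr; have wr : cmod w < r by lra.
have vr : cmod v < r by lra.
have r0' := ltW r0.
have cK x m : cmod x < r -> forall z, cmod z = r -> ccont (fun z => P z * (z - x)^-1 ^+ m) z.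
  by move=> xr z zr; apply: contM; [exact: cP|exact: (ccircle_kerX r)].
have cK2 : ccircle r (fun z => ((v - w) * 2%:R) * (P z * (z - w)^-1 ^+ 3)).
  by move=> z zr; apply: contM; [exact: cont_cst|exact: cK].
rewrite /cauchy_int mulrA -meanZ; [|exact: r0'|exact: cK].
rewrite -meanB; [|exact: r0'|exact: cK|exact: cK].
rewrite -meanB; [|exact: r0'| |exact: cK2]; last first.
  by move=> z zr; apply: contB; exact: cK.
rewrite (eq_mean _ _ (fun z => P z * ((v - w) ^+ 2 *
   ((3%:R * (z - w) - 2%:R * (v - w)) * ((z - v)^-1 ^+ 2 * (z - w)^-1 ^+ 3))))) //; last first.
  move=> z zr.
  have zw : z - w != 0 by apply: cmod_lt_neq; rewrite zr.
  have zv : z - v != 0 by apply: cmod_lt_neq; rewrite zr.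
  by field; rewrite zv zw.
rewrite -mulrA; apply: cmod_meanM => // [z zr|z zr].
  apply: contM; first exact: cont_cst.
  apply: contM; first by cont_tac.
  by apply: contM; exact: (ccircle_kerX r).
rewrite cmodM cmodX [leRHS]mulrC ler_wpM2l ?exprn_ge0 ?cmod_ge0 //.
rewrite cmodM (exprD _ 2 3); apply: ler_pM; rewrite ?cmod_ge0 //.
  apply: le_trans (cmodB _ _) _; rewrite !cmodM !cmod_nat.
  by have := cmodB z w; have := cmodB v w; lra.
rewrite cmodM; apply: ler_pM; rewrite ?cmod_ge0 //; exact: cmod_kerX.
Qed.

Lemma cder_taylor F w k (C q : R) : 0 < q ->
  (forall v, cmod (v - w) < q -> cmod (F v - F w - (v - w) * k) <= C * cmod (v - w) ^+ 2) ->
  cder F w k.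
Proof.
move=> q0 H e e0; pose C' := `|C| + 1.
have C0 : 0 < C' by rewrite /C'; have := normr_ge0 C; lra.
exists (Num.min q (e / C')) => [|v]; first by rewrite lt_min q0 divr_gt0.
rewrite lt_min => /andP[/H h]; rewrite ltr_pdivlMr // => h2.
rewrite (mulrC k); apply: le_trans h _; rewrite expr2 mulrA ler_wpM2r ?cmod_ge0 //.
apply: le_trans (ltW h2); rewrite mulrC ler_wpM2l ?cmod_ge0 // /C'.
by have := ler_norm C; lra.
Qed.

Lemma near_disk w (q : R) v : cmod (v - w) < q - cmod w -> cmod v <= q.
Proof.
by move=> h; have := cmodD (v - w) w; rewrite subrK; lra.
Qed.

Lemma cder_cauchy_int1 r P w : ccircle r P -> cmod w < r ->
  cder (cauchy_int r P 1) w (cauchy_int r P 2 w).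
Proof.
move=> cP wr; have r0 : 0 < r by have := cmod_ge0 w; lra.
pose q := (cmod w + r) / 2; have wq : cmod w < q by rewrite /q; lra.
have qr : q < r by rewrite /q; lra.
apply: (cder_taylor _ _ _ (rmean r P * (r - q)^-1 ^+ 3) (q - cmod w)); first lra.
by move=> v hv; apply: cauchy_int_taylor1 => //; [exact: ltW|exact: near_disk hv].
Qed.

Lemma cder_cauchy_int2 r P w : ccircle r P -> cmod w < r ->
  cder (cauchy_int r P 2) w (2%:R * cauchy_int r P 3 w).
Proof.
move=> cP wr; have r0 : 0 < r by have := cmod_ge0 w; lra.
pose q := (cmod w + r) / 2; have wq : cmod w < q by rewrite /q; lra.
have qr : q < r by rewrite /q; lra.
apply: (cder_taylor _ _ _ (rmean r P * (10 * r * (r - q)^-1 ^+ 5)) (q - cmod w)); first lra.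
by move=> v hv; apply: cauchy_int_taylor2 => //; [exact: ltW|exact: near_disk hv].
Qed.

Lemma cauchyE r f w : holo f -> r < 1 -> cmod w < r ->
  f w = cauchy_int r (fun z => f z * z) 1 w.
Proof.
move=> hf r1 wr; rewrite -[LHS](cauchy r) // /cauchy_int; congr (mean _ _).
by apply/funext => z; rewrite expr1 mulrA.
Qed.

Lemma ccircle_fz r f : r < 1 -> holo f -> forall z, cmod z = r -> ccont (fun z => f z * z) z.
Proof.
by move=> r1 hf z zr; apply: contM; [exact: (holo_circle r)|exact: cont_id].
Qed.

Lemma cauchyE1 r f w k : holo f -> r < 1 -> cmod w < r -> cder f w k ->
  k = cauchy_int r (fun z => f z * z) 2 w.
Proof.
move=> hf r1 wr dk; apply: (cder_uniq f w) => //.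
apply: (der_near _ (cauchy_int r (fun z => f z * z) 1) _ _ _ (r - cmod w)); first lra.
  by move=> s hs; rewrite -cauchyE //; have := cmodD (s - w) w; rewrite subrK; lra.
by apply: cder_cauchy_int1 => //; exact: (ccircle_fz r).
Qed.

Lemma holo_deriv f : holo f -> exists f', (forall z, cmod z < 1 -> cder f z (f' z)) /\ holo f'.
Proof.
move=> hf.
have H z : exists k, cmod z < 1 -> cder f z k.
  have [z1|z1] := ltP (cmod z) 1; last by exists 0.
  by have [k dk] := hf z z1; exists k.
have [f' Hf'] := choice H.
exists f'; split => // w w1; pose r := (1 + cmod w) / 2.
have r1 : r < 1 by rewrite /r; lra.
have wr : cmod w < r by rewrite /r; lra.
eexists; apply: (der_near _ (cauchy_int r (fun z => f z * z) 2) _ _ _ (r - cmod w)); first lra.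
  move=> s hs; have sr : cmod s < r by have := cmodD (s - w) w; rewrite subrK; lra.
  by rewrite -(cauchyE1 r f s (f' s)) //; apply: Hf'; lra.
by apply: cder_cauchy_int2 => //; exact: (ccircle_fz r).
Qed.

(** The quotient by a factor vanishing at [a] is, near [a], the Cauchy integral with
density divided by that factor, hence differentiable at [a] itself. *)
Lemma holo_divide f a : holo f -> cmod a < 1 -> f a = 0 ->
  exists2 g, holo g & forall z, cmod z < 1 -> f z = (z - a) * g z.
Proof.
move=> hf a1 fa; have [k dk] := hf a a1.
pose g z := if z == a then k else f z / (z - a).
have gE z : z != a -> g z = f z / (z - a) by move=> /negPf za; rewrite /g za.
exists g; last first.
  move=> z _; have [->|za] := eqVneq z a; first by rewrite fa subrr mul0r.
  by rewrite gE // mulrC mulfVK // subr_eq0.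
move=> z z1; have [->|za] := eqVneq z a; last first.
  have [b db] := hf z z1.
  eexists; apply: (der_near _ (fun z => f z / (z - a)) _ _ _ (cmod (z - a))).
  - by rewrite cmod_gt0 subr_eq0.
  - move=> s hs; rewrite gE //; apply: contraTneq hs => ->.
    by rewrite cmodBC ltxx.
  - apply: derM; first exact: db.
    apply: derV; first by rewrite subr_eq0.
    by apply: derB; [exact: cder_id|exact: der_cst].
pose r := (1 + cmod a) / 2.
have r1 : r < 1 by rewrite /r; lra.
have ar : cmod a < r by rewrite /r; lra.
have r0 : 0 < r by have := cmod_ge0 a; lra.
pose P z := f z * z * (z - a)^-1.
have cP : ccircle r P.
  move=> s sr; apply: contM; last exact: (ccircle_ker r).
  exact: (ccircle_fz r).
eexists; apply: (der_near _ (cauchy_int r P 1) _ _ _ (r - cmod a)); first lra.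
  move=> s hs; have sr : cmod s < r by have := cmodD (s - a) a; rewrite subrK; lra.
  have [->|sa] := eqVneq s a.
    rewrite /g eqxx (cauchyE1 r f a k) //; apply: eq_mean; first exact: ltW.
    by move=> u ur; rewrite /P expr1 expr2 mulrA.
  have sa0 : s - a != 0 by rewrite subr_eq0.
  rewrite gE //; apply: (mulfI sa0); rewrite [RHS]mulrC mulfVK //.
  rewrite -[f s]subr0 -fa (cauchyE r f s) // (cauchyE r f a) //.
  rewrite /cauchy_int -meanZ ?ltW //; last first.
    by move=> u ur; apply: contM; [exact: cP|exact: (ccircle_kerX r)].
  rewrite -meanB ?ltW //; try (by move=> u ur; apply: contM;
    [exact: (ccircle_fz r)|exact: (ccircle_kerX r)]).
  apply: eq_mean => [|u ur]; first exact: ltW.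
  have ua : u - a != 0 by apply: cmod_lt_neq; rewrite ur.
  have us : u - s != 0 by apply: cmod_lt_neq; rewrite ur.
  by rewrite /P; field; rewrite ua us.
exact: cder_cauchy_int1.
Qed.

End Cauchy.

(** * Holomorphic functions on the disk *)

Section HoloTheory.
Context {R : realType}.
Implicit Types (f F G P : R[i] -> R[i]) (r : R) (a b k w z : R[i]).

Lemma holo_cst k : holo (fun=> k).
Proof. by move=> z _; exists 0; exact: der_cst. Qed.

Lemma holo_id : holo (fun z : R[i] => z).
Proof. by move=> z _; exists 1; exact: cder_id. Qed.

Lemma holoD F G : holo F -> holo G -> holo (fun z => F z + G z).
Proof.
move=> hF hG z z1; have [a da] := hF z z1; have [b db] := hG z z1.
by exists (a + b); exact: derD.
Qed.

Lemma holoB F G : holo F -> holo G -> holo (fun z => F z - G z).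
Proof.
move=> hF hG z z1; have [a da] := hF z z1; have [b db] := hG z z1.
by exists (a - b); exact: derB.
Qed.

Lemma holoM F G : holo F -> holo G -> holo (fun z => F z * G z).
Proof.
move=> hF hG z z1; have [a da] := hF z z1; have [b db] := hG z z1.
by eexists; apply: derM; [exact: da|exact: db].
Qed.

Lemma holo_affine a b : holo (fun z => a + b * z).
Proof.
apply: holoD; first exact: holo_cst.
by apply: holoM; [exact: holo_cst|exact: holo_id].
Qed.

Lemma holo_denom a : holo (fun z => 1 - a * z).
Proof.
apply: holoB; first exact: holo_cst.
by apply: holoM; [exact: holo_cst|exact: holo_id].
Qed.

Lemma holoX F n : holo F -> holo (fun z => F z ^+ n).
Proof.
move=> hF; elim: n => [|n IH]; first exact: holo_cst.
rewrite (_ : (fun z => _) = (fun z => F z * F z ^+ n)); first exact: holoM.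
by apply/funext => z; rewrite exprS.
Qed.

Lemma holoV F : (forall z, cmod z < 1 -> F z != 0) -> holo F -> holo (fun z => (F z)^-1).
Proof.
move=> F0 hF z z1; have [a da] := hF z z1.
by eexists; apply: derV; [exact: F0|exact: da].
Qed.

Lemma holo_cexp F : holo F -> holo (fun z => cexp (F z)).
Proof. by move=> hF z z1; have [a da] := hF z z1; eexists; apply: der_cexp da. Qed.

Lemma holo_sum (I : Type) (s : seq I) (F : I -> R[i] -> R[i]) :
  (forall i, holo (F i)) -> holo (fun z => \sum_(i <- s) F i z).
Proof.
move=> hF z z1; have H i : exists k, cder (F i) z k by exact: hF.
by have [a da] := choice H; eexists; apply: der_sum.
Qed.

Lemma holo_sub_neq0 k : cmod k <= 1 -> forall z, cmod z < 1 -> 1 - k * z != 0.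
Proof.
move=> k1 z z1; apply: cmod_lt_neq; rewrite cmod1 cmodM.
have := cmod_ge0 k; have := cmod_ge0 z; nra.
Qed.

Lemma rder_ray w (t : R) : rder (fun t => t%:C * w) t w.
Proof.
apply: der_eq (derM (der_inj _ t) (der_cst _ w _)).
by rewrite mul1r mulr0 addr0.
Qed.

Lemma cmod_ray w (t : R) : 0 <= t <= 1 -> cmod (t%:C * w) <= cmod w.
Proof.
move=> /andP[t0 t1]; rewrite cmodM cmodR_ge0 //.
by have := cmod_ge0 w; nra.
Qed.

Lemma icont_ray F w : holo F -> cmod w < 1 -> icont 0 1 (fun t => F (t%:C * w)).
Proof.
move=> hF w1 t t01; apply: (cont_comp _ (fun t => t%:C * w)).
  exact: der_cont (rder_ray w t).
by apply: holo_cont => //; apply: le_lt_trans w1; exact: cmod_ray.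
Qed.

Lemma holo_const F : (forall z, cmod z < 1 -> cder F z 0) ->
  forall w, cmod w < 1 -> F w = F 0.
Proof.
move=> dF w w1.
have E : cint 0 1 (fun=> (0 : R[i])) = F (1%:C * w) - F (0%:C * w).
  apply: (cint_FTC _ _ _ (fun t => F (t%:C * w))) => // [t t01|t _]; last exact: cont_cst.
  apply: der_eq (der_chain _ F _ _ _ _ (dF _ _) (rder_ray w t)); first by rewrite mul0r.
  by apply: le_lt_trans w1; exact: cmod_ray.
move: E; rewrite cint_cst // mul0r mul1r mul0r => /esym/eqP.
by rewrite subr_eq0 => /eqP.
Qed.

(** The integral over the ray from the origin. Its increments are compared with
[f w], itself the integral over the ray of the derivative of [t |-> t f(t w)];
the two Taylor bounds that are needed come from Cauchy's formula. *)
Lemma holo_primitive f : holo f -> exists F, forall z, cmod z < 1 -> cder F z (f z).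
Proof.
move=> hf; have [f' [df' hf']] := holo_deriv f hf.
exists (fun w => cint 0 1 (fun t => w * f (t%:C * w))) => w w1.
pose r := (1 + cmod w) / 2; pose q := (cmod w + r) / 2.
have r1 : r < 1 by rewrite /r; lra.
have wq : cmod w < q by rewrite /q /r; lra.
have qr : q < r by rewrite /q /r; lra.
have r0 : 0 < r by have := cmod_ge0 w; lra.
pose P z := f z * z.
have cP : ccircle r P by move=> z zr; exact: (ccircle_fz r).
pose C1 := rmean r P * (r - q)^-1 ^+ 3.
pose C2 := rmean r P * (r - q)^-1 ^+ 2.
have m0 : 0 <= rmean r P by apply: rmean_ge0 => //; exact: ltW.
have rq0 : 0 <= (r - q)^-1 by rewrite invr_ge0; lra.
have C10 : 0 <= C1 by rewrite mulr_ge0 // exprn_ge0.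
have C20 : 0 <= C2 by rewrite mulr_ge0 // exprn_ge0.
have T1 x y : cmod x <= q -> cmod y <= q ->
    cmod (f y - f x - (y - x) * f' x) <= C1 * cmod (y - x) ^+ 2.
  move=> xq yq; rewrite (cauchyE r f y) // ?(cauchyE r f x) //; try lra.
  rewrite (cauchyE1 r f x (f' x)) //; try lra; last by apply: df'; lra.
  exact: cauchy_int_taylor1.
have T2 x : cmod x <= q -> cmod (f' x) <= C2.
  move=> xq; rewrite (cauchyE1 r f x (f' x)) //; try lra; last by apply: df'; lra.
  exact: cmod_cauchy_int.
have E0 : f w = cint 0 1 (fun t => f (t%:C * w) + t%:C * w * f' (t%:C * w)).
  rewrite (cint_FTC _ _ _ (fun t => t%:C * f (t%:C * w))) //; first by rewrite mul0r subr0 !mul1r.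
    move=> t t01; have tw1 : cmod (t%:C * w) < 1 by apply: le_lt_trans w1; exact: cmod_ray.
    apply: der_eq (derM (der_inj _ t)
      (der_chain _ f (fun t => t%:C * w) t _ _ (df' _ tw1) (rder_ray w t))).
    by ring.
  apply: icontD; first exact: icont_ray.
  move=> t t01; apply: contM; last exact: icont_ray.
  exact: der_cont (rder_ray w t).
apply: (cder_taylor _ _ _ (C2 + C1) (q - cmod w)); first lra.
move=> v hv; have vq := near_disk _ _ _ hv.
have v1 : cmod v < 1 by lra.
have c0 u : cmod u < 1 -> icont 0 1 (fun t => u * f (t%:C * u)).
  by move=> u1; apply: icontZ; exact: icont_ray.
have c1 : icont 0 1 (fun t => (v - w) * (f (t%:C * w) + t%:C * w * f' (t%:C * w))).
  apply: icontZ; apply: icontD; first exact: icont_ray.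
  move=> t t01; apply: contM; last exact: icont_ray.
  exact: der_cont (rder_ray w t).
rewrite E0 -cintZ; last first.
  apply: icontD; first exact: icont_ray.
  move=> t t01; apply: contM; last exact: icont_ray.
  exact: der_cont (rder_ray w t).
rewrite -cintB; [|exact: c0|exact: c0].
rewrite -cintB; [| |exact: c1]; last first.
  by move=> t t01; apply: contB; apply: c0.
rewrite -[leRHS]mulr1 -[X in _ * X](subr0 1); apply: cmod_cint_le => //.
  by move=> t t01; apply: contB; [apply: contB; apply: c0|exact: c1].
move=> t t01; have /andP[t0 t1] := t01.
have twq : cmod (t%:C * w) <= q by apply: le_trans (cmod_ray _ _ t01) _; exact: ltW.
have tvq : cmod (t%:C * v) <= q by apply: le_trans (cmod_ray _ _ t01) _.
have := T1 _ _ twq tvq; have := T2 _ twq.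
set a := f (t%:C * w); set b := f (t%:C * v); set k := f' (t%:C * w) => kC dC.
have -> : v * b - w * a - (v - w) * (a + t%:C * w * k) =
  t%:C * ((v - w) ^+ 2 * k) + v * (b - a - (t%:C * v - t%:C * w) * k) by ring.
apply: le_trans (cmodD _ _) _; rewrite [leRHS]mulrDl; apply: lerD.
  rewrite cmodM [cmod (_ * k)]cmodM cmodX cmodR_ge0 // mulrCA [leRHS]mulrC.
  have h2 : 0 <= cmod (v - w) ^+ 2 by rewrite exprn_ge0 ?cmod_ge0.
  rewrite ler_wpM2l //.
  by have := cmod_ge0 k; nra.
rewrite cmodM -[leRHS]mul1r; apply: ler_pM; rewrite ?cmod_ge0 //; first lra.
apply: le_trans dC _; rewrite ler_wpM2l // -mulrBr cmodM exprMn cmodR_ge0 //.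
have h2 : 0 <= cmod (v - w) ^+ 2 by rewrite exprn_ge0 ?cmod_ge0.
have : t ^+ 2 <= 1 by rewrite expr2; nra.
by nra.
Qed.

Lemma cexp_surj z : z != 0 -> exists k, cexp k = z.
Proof.
rewrite -cmod_gt0 => z0; pose a := Re z / cmod z; pose b := Im z / cmod z.
have ab : a ^+ 2 + b ^+ 2 = 1.
  rewrite /a /b !expr_div_n -mulrDl -sqr_cmod mulfV //.
  by rewrite expf_neq0 // gt_eqF.
have a1 : -1 <= a <= 1.
  by have := sqr_ge0 b; have := sqr_ge0 (a + 1); have := sqr_ge0 (a - 1); nra.
have [t [ct st]] : exists t, cos t = a /\ sin t = b.
  have sE : sin (acos a) = `|b|.
    by rewrite sin_acos // (_ : 1 - a ^+ 2 = b ^+ 2) ?sqrtr_sqr //; lra.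
  have [b0|b0] := leP 0 b.
    by exists (acos a); rewrite acosK ?sE ?ger0_norm // in_itv.
  exists (- acos a); rewrite cosN sinN acosK ?in_itv // sE ltr0_norm //.
  by rewrite opprK.
exists (ln (cmod z) +i* t); rewrite cexpE !ReImE lnK // ct st /a /b.
by apply: eqReIm; rewrite !ReImE; field; rewrite gt_eqF.
Qed.

(** The primitive of the logarithmic derivative, corrected by a constant. *)
Lemma holo_log f : holo f -> (forall z, cmod z < 1 -> f z != 0) ->
  exists2 F, holo F & forall z, cmod z < 1 -> f z = cexp (F z).
Proof.
move=> hf f0; have [f' [df' hf']] := holo_deriv f hf.
have [F dF] : exists F, forall z, cmod z < 1 -> cder F z (f' z / f z).
  by apply: holo_primitive; apply: holoM => //; exact: holoV.
pose g z := f z * cexp (- F z).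
have g0 z : cmod z < 1 -> g z = g 0.
  move: z; apply: holo_const => z z1.
  apply: der_eq (derM (df' z z1) (der_cexp _ _ _ _ (derN _ _ _ _ (dF z z1)))).
  by field; exact: f0.
have [k kE] : exists k, cexp k = g 0.
  by apply: cexp_surj; rewrite mulf_neq0 ?cexp_neq0 // f0 // cmod0.
exists (fun z => k + F z).
  by apply: holoD; [exact: holo_cst|move=> z z1; exists (f' z / f z); exact: dF].
move=> z z1; rewrite cexpD kE -(g0 z z1) /g -mulrA -cexpD addNr cexp0 mulr1 //.
Qed.

Lemma geo_dominate (x y C : R) : 0 <= y -> y < x -> exists n : nat, C * y ^+ n < x ^+ n.
Proof.
move=> y0 yx; have x0 : 0 < x by lra.
pose h := x / y - 1.
have [->|yn0] := eqVneq y 0; first by exists 1; rewrite !expr1 mulr0.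
have yp : 0 < y by rewrite lt_def yn0.
have h0 : 0 < h by rewrite /h subr_gt0 ltr_pdivlMr // mul1r.
have bern n : 1 + n%:R * h <= (1 + h) ^+ n.
  elim: n => [|n IH]; first by rewrite mul0r addr0 expr0.
  rewrite exprS -natr1; have := sqr_ge0 h; have : 0 <= n%:R :> R by [].
  by move=> n0 hh; nra.
pose n := Num.bound (`|C| / h).
have hn : `|C| / h < n%:R by apply: archi_boundP; rewrite divr_ge0 // ltW.
exists n; have -> : x = y * (1 + h) by rewrite /h; field.
rewrite exprMn mulrC ltr_pM2l ?exprn_gt0 //; apply: lt_le_trans (bern n).
move: hn; rewrite ltr_pdivrMr // => hn; have := ler_norm C; lra.
Qed.

Lemma cmod_kernel r w z : cmod w < r -> cmod z = r ->
  cmod (z / (z - w)) <= r / (r - cmod w).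
Proof.
move=> wr zr; have r0 := cmod_ge0 w.
rewrite cmodM cmodV zr ler_wpM2l //; first lra.
have := cmodB_ge z w; rewrite zr => h.
by rewrite lef_pV2 ?posrE //; lra.
Qed.

(** The constant in the crude estimate given by Cauchy's formula disappears when the
estimate is applied to the powers of the function. *)
Lemma max_circle r f w (M : R) : r < 1 -> holo f -> cmod w < r -> 0 <= M ->
  (forall z, cmod z = r -> cmod (f z) <= M) -> cmod (f w) <= M.
Proof.
move=> r1 hf wr M0 fM; have r0 : 0 < r by have := cmod_ge0 w; lra.
rewrite leNgt; apply/negP => lt.
have [n] := geo_dominate _ _ (r / (r - cmod w)) M0 lt; apply/negP; rewrite -leNgt.
have hfn := holoX f n hf.
rewrite -cmodX -(cauchy r (fun z => f z ^+ n) w) // mulrC.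
have cfn : ccircle r (fun z => f z ^+ n) by move=> z; exact: holo_circle.
have cK : ccircle r (fun z => z / (z - w)).
  by move=> z zr; apply: contM; [exact: cont_id|exact: (ccircle_ker r)].
apply: cmod_mean_le; first exact: ltW.
  by move=> z zr; apply: contM; [exact: cfn|exact: cK].
move=> z zr; rewrite cmodM; apply: ler_pM; rewrite ?cmod_ge0 //.
  by rewrite cmodX; apply: lerXn2r; rewrite ?nnegrE ?cmod_ge0 // fM.
exact: cmod_kernel.
Qed.

Lemma cmod_sq_le_rmean r f w : r < 1 -> holo f -> cmod w < r ->
  cmod (f w) ^+ 2 <= Re (mean r (fun z => (cmod (f z) ^+ 2)%:C)) * (r / (r - cmod w)).
Proof.
move=> r1 hf wr; have r0 : 0 < r by have := cmod_ge0 w; lra.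
have hf2 := holoX f 2 hf.
have cf2 : ccircle r (fun z => f z ^+ 2) by move=> z; exact: holo_circle.
rewrite -cmodX -(cauchy r (fun z => f z ^+ 2) w) //.
have -> : Re (mean r (fun z => (cmod (f z) ^+ 2)%:C)) = rmean r (fun z => f z ^+ 2).
  by congr (Re (mean _ _)); apply/funext => z; rewrite cmodX.
apply: cmod_meanM => //; first exact: ltW.
  by move=> z zr; apply: contM; [exact: cont_id|exact: (ccircle_ker r)].
by move=> z; exact: cmod_kernel.
Qed.

(** The Borel--Caratheodory inequality: the kernel integrates the conjugate of [G]
to a constant, so that [G] is recovered from its real part, and the mean of the
nonnegative function [e - Re G] is known. *)
Lemma borel_caratheodory r G w (e : R) : holo_le r G -> cmod w < r ->
  (forall z, cmod z = r -> Re (G z) <= e) -> Re (G 0) = 0 ->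
  cmod (G w - G 0) <= 2 * e * (1 + r / (r - cmod w)).
Proof.
move=> hG wr Ge G0; have r0 : 0 < r by have := cmod_ge0 w; lra.
have r0' := ltW r0.
have cG z : cmod z = r -> ccont G z by move=> zr; apply: (holo_le_cont r) => //; rewrite zr.
have cK z : cmod z = r -> ccont (fun z => z / (z - w)) z.
  by move=> zr; apply: contM; [exact: cont_id|exact: (ccircle_ker r)].
have E1 := cauchy_le r G w hG wr.
have E2 : mean r (fun z => (G z)^* * (z / (z - w))) = (G 0)^*.
  rewrite (eq_mean _ _ (fun z => (G z * (z / (z - w))^*)^*)) //; last first.
    by move=> z _; rewrite conjM conjK.
  rewrite meanJ //; last by move=> z zr; apply: contM; [exact: cG|apply: contJ; exact: cK].
  congr (_^*).
  rewrite (eq_mean _ _ (fun z => G z * ((r ^+ 2)%:C * ((r ^+ 2)%:C - w^* * z)^-1))) //; last first.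
    by move=> z zr; rewrite (conj_kernel r).
  rewrite mean_holo_le //.
    rewrite mulr0 subr0 mulfV ?mulr1 //.
    by rewrite RC_eq0 expf_neq0 // gt_eqF.
  move=> z zr; have [a da] := hG z zr; have [b db] := holo_le_reflected _ _ wr z zr.
  by eexists; apply: derM da (derM (der_cst _ _ _) db).
pose P z : R[i] := (2 * (e - Re (G z)))%:C.
have PE z : P z = (2 * e)%:C - (G z + (G z)^*).
  by rewrite addzJ -RCN -RCD /P; congr (_%:C); ring.
have cP z : cmod z = r -> ccont P z.
  rewrite (_ : P = fun z => (2 * e)%:C - (G z + (G z)^*)); last exact/funext.
  by move=> zr; have := cG z zr => ?; cont_tac.
have P0 z : cmod z = r -> cmod (P z) = Re (P z).
  by move=> zr; rewrite ReC cmodR_ge0 // mulr_ge0 // subr_ge0 Ge.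
have mP : rmean r P = 2 * e.
  rewrite /rmean (eq_mean _ _ P) //; last by move=> z zr; rewrite P0.
  rewrite (eq_mean _ _ (fun z => (2 * e)%:C - (G z + (G z)^*))) //.
  have cGJ : ccircle r (fun z => (G z)^*) by move=> z zr; apply: contJ; exact: cG.
  rewrite meanB //; last 2 first.
  - by move=> z _; exact: cont_cst.
  - by move=> z zr; apply: contD; [exact: cG|exact: cGJ].
  rewrite mean_cst meanD // meanJ // mean_holo_le //.
  by rewrite ReB ReD ReJ G0 ReC; ring.
have E3 : mean r (fun z => P z * (z / (z - w))) = (2 * e)%:C - (G w + (G 0)^*).
  rewrite (eq_mean _ _ (fun z => (2 * e)%:C * (z / (z - w)) -
     (G z * (z / (z - w)) + (G z)^* * (z / (z - w))))) //; last first.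
    by move=> z _; rewrite PE; ring.
  have c1 : ccircle r (fun z => G z * (z / (z - w))).
    by move=> z zr; apply: contM; [exact: cG|exact: cK].
  have c2 : ccircle r (fun z => (G z)^* * (z / (z - w))).
    by move=> z zr; apply: contM; [apply: contJ; exact: cG|exact: cK].
  rewrite meanB //; last 2 first.
  - by move=> z zr; apply: contM; [exact: cont_cst|exact: cK].
  - by move=> z zr; apply: contD; [exact: c1|exact: c2].
  by rewrite meanZ // mean_kernel // meanD // E1 E2 mulr1.
have G0J : (G 0)^* = - G 0 by apply: eqReIm; rewrite !ReImE ?G0 ?oppr0.
have -> : G w - G 0 = (2 * e)%:C - mean r (fun z => P z * (z / (z - w))).
  by rewrite E3 G0J; ring.
have e0 : 0 <= 2 * e by rewrite -mP; exact: rmean_ge0.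
apply: le_trans (cmodB _ _) _; rewrite cmodR_ge0 // mulrDr mulr1 lerD2l -mP.
by apply: cmod_meanM => // z; exact: cmod_kernel.
Qed.

End HoloTheory.

(** * Disks in the domain that are not extremal *)

Section Enlarge.
Context {R : realType} {n : nat}.
Implicit Types (a b p s w l : R[i]) (u v : 'I_n -> R[i]) (z : 'I_n -> R[i] -> R[i]).

Definition nrm2 v : R := \sum_i cmod (v i) ^+ 2.

Definition herm u v : R[i] := \sum_i u i * (v i)^*.

Lemma nrm2_ge0 v : 0 <= nrm2 v.
Proof. by apply: sumr_ge0 => i _; rewrite sqr_ge0. Qed.

Lemma nrm2_eq0 v : nrm2 v = 0 -> forall i, v i = 0.
Proof.
move=> /eqP; rewrite psumr_eq0 => [|i _]; last exact: sqr_ge0.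
move=> /allP H i; apply/eqP; have := H i; rewrite mem_index_enum => /(_ isT) /=.
by rewrite sqrf_eq0 cmod_eq0.
Qed.

Lemma herm_self v : herm v v = (nrm2 v)%:C.
Proof.
rewrite /herm /nrm2 (raddf_sum (real_complex R)) /=.
by apply: eq_bigr => i _; rewrite mulzJ.
Qed.

Lemma hermC u v : herm u v = (herm v u)^*.
Proof.
rewrite /herm (raddf_sum (@conjc R)) /=; apply: eq_bigr => i _.
by rewrite conjM conjK mulrC.
Qed.

Lemma hermDl u u' v : herm (fun i => u i + u' i) v = herm u v + herm u' v.
Proof. by rewrite /herm -big_split; apply: eq_bigr => i _; rewrite mulrDl. Qed.

Lemma hermZl a u v : herm (fun i => a * u i) v = a * herm u v.
Proof. by rewrite /herm mulr_sumr; apply: eq_bigr => i _; rewrite mulrA. Qed.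

Lemma hermBl u u' v : herm (fun i => u i - u' i) v = herm u v - herm u' v.
Proof. by rewrite /herm -sumrB; apply: eq_bigr => i _; rewrite mulrBl. Qed.

Lemma hermDr u v v' : herm u (fun i => v i + v' i) = herm u v + herm u v'.
Proof. by rewrite hermC hermDl conjD -!hermC. Qed.

Lemma hermZr a u v : herm u (fun i => a * v i) = a^* * herm u v.
Proof. by rewrite hermC hermZl conjM -hermC. Qed.

Lemma nrm2D u v : nrm2 (fun i => u i + v i) = nrm2 u + nrm2 v + 2 * Re (herm u v).
Proof.
apply: (fmorph_inj (real_complex R)) => /=.
rewrite -herm_self hermDl !hermDr !herm_self (hermC v u).
by rewrite !RCD -addzJ; ring.
Qed.

Lemma nrm2Z a u : nrm2 (fun i => a * u i) = cmod a ^+ 2 * nrm2 u.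
Proof. by rewrite /nrm2 mulr_sumr; apply: eq_bigr => i _; rewrite cmodM exprMn. Qed.

Lemma herm_le u v : 2 * Re (herm u v) <= nrm2 u + nrm2 v.
Proof.
have := nrm2_ge0 (fun i => u i + (-1) * v i).
rewrite nrm2D nrm2Z hermZr cmodN cmod1 conjN conj1 mulN1r ReN; lra.
Qed.

(** Limits [r -> 1] are taken in this form, with [e = 1 - r]. *)
Lemma small_le (x K d : R) : 0 < d -> (forall e, 0 < e < d -> x <= K * e) -> x <= 0.
Proof.
move=> d0 H; rewrite leNgt; apply/negP => x0.
pose K' := `|K| + 1; have K0 : 0 < K' by rewrite /K'; have := normr_ge0 K; lra.
pose e := Num.min (d / 2) (x / (2 * K')).
have e0 : 0 < e by rewrite lt_min; apply/andP; split; rewrite divr_gt0 // mulr_gt0.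
have ed : e < d by rewrite gt_min; apply/orP; left; lra.
have eK : K' * e <= x / 2.
  have : e <= x / (2 * K') by rewrite ge_min lexx orbT.
  rewrite ler_pdivlMr ?mulr_gt0 //; lra.
have := H e; rewrite e0 ed => /(_ isT).
have := ler_norm K; rewrite /K' in eK; nra.
Qed.

Lemma ratio_le (c e : R) : 0 <= c -> 0 < e -> e < (1 - c) / 2 ->
  (1 - e) / (1 - e - c) <= 2 / (1 - c).
Proof.
move=> c0 e0 ec; rewrite ler_pdivrMr; last lra.
by rewrite mulrAC ler_pdivlMr; nra.
Qed.

Lemma sqr_radius (r : R) : 0 < r < 1 -> 0 < 1 - r ^+ 2 <= 2 * (1 - r).
Proof. by move=> /andP[? ?]; rewrite expr2; apply/andP; split; nra. Qed.

Lemma mobiusE a l : mobius a l = (l - a) / (1 - a^* * l).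
Proof. by []. Qed.

Lemma mobius_denom a l : cmod a <= 1 -> cmod l < 1 -> 1 - a^* * l != 0.
Proof. by move=> a1; apply: holo_sub_neq0; rewrite cmodJ. Qed.

Lemma cmod2_mobius a l : cmod (1 - a^* * l) ^+ 2 - cmod (l - a) ^+ 2
  = (1 - cmod a ^+ 2) * (1 - cmod l ^+ 2).
Proof. by rewrite !sqr_cmod !ReImE; ring. Qed.

Lemma cmod_mobius_sum p s : cmod p <= 1 -> cmod s <= 1 ->
  cmod (p + s) <= cmod (1 + p^* * s).
Proof.
move=> p1 s1; have := cmod2_mobius (- p) s; rewrite !cmodN conjN mulNr !opprK => E.
rewrite -(ler_pXn2r (n := 2)) ?nnegrE ?cmod_ge0 // addrC -subr_ge0 E.
by rewrite mulr_ge0 // subr_ge0 expr_le1 ?cmod_ge0.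
Qed.

Lemma holo_mobius a : cmod a < 1 -> holo (mobius a).
Proof.
move=> a1; apply: holoM; first by apply: holoB; [exact: holo_id|exact: holo_cst].
apply: holoV => [z z1|]; first by apply: mobius_denom => //; exact: ltW.
exact: holo_denom.
Qed.

Lemma mobius0 a : mobius a 0 = - a.
Proof. by rewrite mobiusE mulr0 subr0 invr1 mulr1 sub0r. Qed.

Lemma cder_mobius0 a : cder (mobius a) 0 (1 - (cmod a ^+ 2)%:C).
Proof.
have d1 : cder (fun l => l - a) 0 (1 - 0) by apply: derB; [exact: cder_id|exact: der_cst].
have d2 : cder (fun l => 1 - a^* * l) 0 (0 - (0 * 0 + a^* * 1)).
  apply: derB; first exact: der_cst.
  by apply: derM; [exact: der_cst|exact: cder_id].
have n0 : 1 - a^* * 0 != 0 by rewrite mulr0 subr0 oner_eq0.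
have -> : mobius a = (fun l => (l - a) * (1 - a^* * l)^-1) by [].
apply: der_eq (derM d1 (derV _ (fun l => 1 - a^* * l) 0 _ n0 d2)).
by rewrite -mulzJ mulr0 !subr0 invr1; ring.
Qed.

Lemma cmod2_mobius_ge a l : cmod a < 1 -> cmod l < 1 ->
  1 - 4 / (1 - cmod a) * (1 - cmod l) <= cmod (mobius a l) ^+ 2.
Proof.
move=> a1 l1; have a0 := cmod_ge0 a; have l0 := cmod_ge0 l.
have d0 : 0 < 1 - cmod a by lra.
have D0 : 1 - cmod a <= cmod (1 - a^* * l).
  have := cmodB_ge 1 (a^* * l); rewrite cmod1 cmodM cmodJ; nra.
rewrite mobiusE cmodM cmodV exprMn exprVn.
set D := cmod (1 - _) in D0 *.
have E := cmod2_mobius a l; rewrite -/D in E.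
have Dp : 0 < D ^+ 2 by rewrite exprn_gt0 //; lra.
rewrite ler_pdivlMr //.
have -> : cmod (l - a) ^+ 2 = D ^+ 2 - (1 - cmod a ^+ 2) * (1 - cmod l ^+ 2) by lra.
rewrite mulrBl mul1r lerB //.
have h1 : (1 - cmod a) ^+ 2 <= D ^+ 2 by apply: lerXn2r; rewrite ?nnegrE //; lra.
have h2 : (1 - cmod a ^+ 2) * (1 - cmod l ^+ 2) <= 4 * (1 - cmod a) * (1 - cmod l).
  have P0 : 0 <= (1 - cmod a) * (1 - cmod l) by apply: mulr_ge0; lra.
  have Q4 : (1 + cmod a) * (1 + cmod l) <= 4 by nra.
  have := ler_wpM2l P0 Q4; lra.
apply: le_trans h2 _.
have -> : 4 * (1 - cmod a) * (1 - cmod l) = 4 / (1 - cmod a) * (1 - cmod l) * (1 - cmod a) ^+ 2.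
  by field; rewrite gt_eqF.
apply: ler_wpM2l => //.
by rewrite mulr_ge0 ?divr_ge0 //; lra.
Qed.

Definition inside z (g : R[i] -> R[i]) := forall l, cmod l < 1 ->
  cmod (g l) ^+ 2 * expR (nrm2 (z ^~ l)) <= 1.

(** The maximum principle for the logarithmically subharmonic function
[|g|^2 exp |z|^2], reduced to the classical one: this function dominates the squared
modulus of the holomorphic function [F] below and agrees with it at [l0]. *)
Lemma inside_divide_mobius z g a : (forall i, holo (z i)) -> holo g -> cmod a < 1 ->
  inside z (fun l => mobius a l * g l) -> inside z g.
Proof.
move=> hz hg a1 H l0 l01.
pose F l := g l * cexp (herm (z ^~ l) (z ^~ l0) - (nrm2 (z ^~ l0) / 2)%:C).
have hF : holo F.
  apply: holoM => //; apply: holo_cexp; apply: holoB; last exact: holo_cst.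
  by apply: holo_sum => i; apply: holoM => //; exact: holo_cst.
have FE l : cmod (F l) ^+ 2 =
    cmod (g l) ^+ 2 * expR (2 * Re (herm (z ^~ l) (z ^~ l0)) - nrm2 (z ^~ l0)).
  rewrite /F cmodM exprMn cmod_cexp -expRM_natl ReB ReC; congr (_ * expR _).
  by field.
suff : cmod (F l0) ^+ 2 <= 1.
  by rewrite FE herm_self ReC; congr (_ * expR _ <= 1); ring.
have Fle l : cmod l < 1 -> cmod (F l) ^+ 2 * cmod (mobius a l) ^+ 2 <= 1.
  move=> l1; apply: le_trans (H l l1); rewrite FE cmodM exprMn mulrAC.
  rewrite (mulrC (cmod (g l) ^+ 2)); apply: ler_wpM2l.
    by rewrite mulr_ge0 ?sqr_ge0.
  rewrite ler_expR.
  by have := herm_le (z ^~ l) (z ^~ l0); lra.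
pose K := 4 / (1 - cmod a).
have K0 : 0 < K by rewrite divr_gt0 //; lra.
rewrite -subr_le0; apply: (small_le _ (K * cmod (F l0) ^+ 2) (Num.min (1 - cmod l0) K^-1)).
  by rewrite lt_min invr_gt0 K0 andbT; lra.
move=> e; rewrite lt_min => /and3P[e0 el eK].
have eK1 : K * e < 1 by rewrite mulrC -ltr_pdivlMr // div1r.
have q0 : 0 < 1 - K * e by lra.
have r1 : 1 - e < 1 by lra.
have lr : cmod l0 < 1 - e by lra.
have M0 : 0 <= (1 - K * e)^-1 by rewrite invr_ge0 ltW.
have Mc s : cmod s = 1 - e -> cmod (F s ^+ 2) <= (1 - K * e)^-1.
  move=> sr; have s1 : cmod s < 1 by rewrite sr; lra.
  rewrite cmodX -div1r ler_pdivlMr //; apply: le_trans (Fle s s1).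
  rewrite ler_wpM2l ?sqr_ge0 //; apply: le_trans (cmod2_mobius_ge a s a1 s1).
  by rewrite sr /K; lra.
have := max_circle _ _ _ _ r1 (holoX F 2 hF) lr M0 Mc.
rewrite cmodX -div1r ler_pdivlMr //; lra.
Qed.

(** The negation of extremality for the Kobayashi pseudometric, expressed through the
1-jet [(z0, w0; X, w1)] at the origin. *)
Definition improvable (z0 : 'I_n -> R[i]) (w0 : R[i]) (X : 'I_n -> R[i]) (w1 : R[i]) :=
  exists (t : R) (z : 'I_n -> R[i] -> R[i]) (w : R[i] -> R[i]),
  [/\ 1 < t,
      (forall i, holo (z i)) /\ holo w,
      (forall l, cmod l < 1 -> cmod (w l) ^+ 2 < expR (- nrm2 (z ^~ l))),
      (forall i, z i 0 = z0 i) /\ w 0 = w0 &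
      (forall i, cder (z i) 0 (t%:C * X i)) /\ cder w 0 (t%:C * w1)].

Lemma nrm2_convex (k : R) u v : 0 <= k <= 1 ->
  nrm2 (fun i => (1 - k)%:C * u i + k%:C * v i) <= (1 - k) * nrm2 u + k * nrm2 v.
Proof.
move=> /andP[k0 k1]; rewrite nrm2D !nrm2Z !hermZl !hermZr conjRC !ReCM.
rewrite !cmodR_ge0 //; last lra.
have := herm_le u v => h.
have : (k * (1 - k)) * (2 * Re (herm u v)) <= (k * (1 - k)) * (nrm2 u + nrm2 v).
  by rewrite ler_wpM2l // mulr_ge0 //; lra.
lra.
Qed.

(** A factor [h] that is not extremal for the Schwarz-Pick lemma can be replaced by
one of supremum less than one, which leaves room to move the other data. The
coordinate [z], possibly unbounded, is moved by a convex combination with an affine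
map rather than by a translation, so that its squared norm grows by a bounded amount. *)
Lemma improvable_factor z g (X : 'I_n -> R[i]) g1 h0 h1 d : (forall i, holo (z i)) -> holo g ->
  inside z g -> (forall i, cder (z i) 0 (X i)) -> cder g 0 g1 ->
  cmod h0 < 1 -> cmod h1 < 1 - cmod h0 ^+ 2 -> g 0 * h1 + g1 * h0 = g 0 * d ->
  improvable (z ^~ 0) (g 0 * h0) X (g 0 * h1 + g1 * h0).
Proof.
move=> hz hg zg dz dg h01 h11 dE.
have H0 := cmod_ge0 h0; have H1 := cmod_ge0 h1.
(* The new factor is [c] times a map of the disk into itself; giving up a quarter of
   the margin [m] leaves room for [h0] and [h1]. *)
pose m := 1 - cmod h0 ^+ 2 - cmod h1; have m0 : 0 < m by rewrite /m; lra.
have m1 : m <= 1 by rewrite /m; have := sqr_ge0 (cmod h0); lra.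
pose c := 1 - m / 4; have c0 : 0 < c by rewrite /c; lra.
have c1 : c < 1 by rewrite /c; lra.
have cm : cmod h1 * c + cmod h0 ^+ 2 < c ^+ 2.
  have -> : cmod h0 ^+ 2 = 1 - cmod h1 - m by rewrite /m; ring.
  by rewrite /c; nra.
have ch0 : cmod h0 < c.
  rewrite -(ltr_pXn2r (n := 2)) ?nnegrE //; last exact: ltW.
  by have := mulr_ge0 H1 (ltW c0); lra.
pose p := h0 / c%:C.
have cC0 : c%:C != 0 :> R[i] by rewrite RC_eq0 gt_eqF.
have cp : cmod p = cmod h0 / c by rewrite cmodM cmodV cmodR_ge0 // ltW.
have p1 : cmod p < 1 by rewrite cp ltr_pdivrMr // mul1r.
(* The largest modulus allowed at the origin by Schwarz-Pick for the derivative of a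
   function bounded by [c] with value [h0]. *)
pose L := c - cmod h0 ^+ 2 / c.
have L1 : cmod h1 < L.
  rewrite -(ltr_pM2r c0); have -> : L * c = c ^+ 2 - cmod h0 ^+ 2.
    by rewrite /L; field; rewrite gt_eqF.
  lra.
have L0 : 0 < L by lra.
(* A bound for the squared norm of the affine map that [z] is moved towards. *)
pose C2 := \sum_i (cmod (z i 0) + 2 * cmod (X i)) ^+ 2.
have C20 : 0 <= C2 by apply: sumr_ge0 => i _; rewrite sqr_ge0.
have lc : 0 < - ln c by rewrite oppr_gt0 ln_lt0 // c0.
pose k := Num.min 1 (Num.min ((L - cmod h1) / (cmod d + 1)) (- ln c / (C2 + 1))).
have d0 := cmod_ge0 d.
have k0 : 0 < k.
  rewrite !lt_min ltr01 /=; apply/andP; split; apply: divr_gt0 => //; lra.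
have [k1 kd kC] : [/\ k <= 1, k * cmod d <= L - cmod h1 & k * C2 <= - ln c].
  have A : k <= (L - cmod h1) / (cmod d + 1) by rewrite !ge_min lexx orbT.
  have B : k <= - ln c / (C2 + 1) by rewrite !ge_min lexx !orbT.
  rewrite ler_pdivlMr in A; last lra.
  rewrite ler_pdivlMr in B; last lra.
  split; [by rewrite ge_min lexx|lra|lra].
(* Stretching the derivative of [g h] by [1 + k] amounts to adding [k d] to [h1]. *)
pose eta := (h1 + k%:C * d) / L%:C.
have LC0 : L%:C != 0 :> R[i] by rewrite RC_eq0 gt_eqF.
have eta1 : cmod eta <= 1.
  rewrite cmodM cmodV (cmodR_ge0 _ (ltW L0)) ler_pdivrMr // mul1r.
  by apply: le_trans (cmodD _ _) _; rewrite cmodM (cmodR_ge0 _ (ltW k0)); lra.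
pose h l := c%:C * ((p + eta * l) / (1 + p^* * (eta * l))).
have pd l : cmod l < 1 -> 1 + p^* * (eta * l) != 0.
  move=> l1; rewrite mulrA -[_ * l]opprK -mulNr.
  apply: holo_sub_neq0 => //; rewrite cmodN cmodM cmodJ.
  have := cmod_ge0 p; have := cmod_ge0 eta; nra.
have hh : holo h.
  apply: holoM; first exact: holo_cst.
  have he : holo (fun l => eta * l) by apply: holoM; [exact: holo_cst|exact: holo_id].
  apply: holoM; first by apply: holoD => //; exact: holo_cst.
  apply: holoV => //; apply: holoD; first exact: holo_cst.
  by apply: holoM => //; exact: holo_cst.
have hc l : cmod l < 1 -> cmod (h l) <= c.
  move=> l1; rewrite /h cmodM (cmodR_ge0 _ (ltW c0)) -[leRHS]mulr1 ler_pM2l //.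
  rewrite cmodM cmodV ler_pdivrMr ?cmod_gt0 ?pd // mul1r.
  apply: cmod_mobius_sum; first exact: ltW.
  by rewrite cmodM; have := cmod_ge0 l; have := cmod_ge0 eta; nra.
have h00 : h 0 = h0 by rewrite /h !mulr0 !addr0 invr1 mulr1 /p mulrC mulfVK.
have dh : cder h 0 (h1 + k%:C * d).
  have de : cder (fun l => eta * l) 0 (0 * 0 + eta * 1).
    by apply: derM; [exact: der_cst|exact: cder_id].
  have dn : cder (fun l => p + eta * l) 0 (0 + (0 * 0 + eta * 1)).
    by apply: derD => //; exact: der_cst.
  have dd : cder (fun l => 1 + p^* * (eta * l)) 0 (0 + (0 * (eta * 0) + p^* * (0 * 0 + eta * 1))).
    by apply: derD; [exact: der_cst|apply: derM => //; exact: der_cst].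
  have n0 := pd 0; rewrite cmod0 in n0.
  apply: der_eq (derM (der_cst _ c%:C _)
    (derM dn (derV _ (fun l => 1 + p^* * (eta * l)) 0 _ (n0 ltr01) dd))).
  rewrite !(mulr0, mul0r, addr0, add0r, mulr1, invr1, expr1n, mulN1r, mul1r).
  have -> : c%:C * (eta + p * - (p^* * eta)) = eta * (c%:C * (1 - p * p^*)) by ring.
  have -> : c%:C * (1 - p * p^*) = L%:C.
    rewrite mulzJ cp /L expr_div_n -[1]/(1%:C) -RCN -RCD -RCM; congr (_%:C).
    by field; rewrite gt_eqF.
  by rewrite /eta mulfVK.
exists (1 + k), (fun i l => (1 - k)%:C * z i l + k%:C * (z i 0 + 2%:R * X i * l)),
  (fun l => g l * h l).
split.
- lra.
- split; last exact: holoM.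
  move=> i; apply: holoD; apply: holoM => //; try exact: holo_cst.
  exact: holo_affine.
- move=> l l1; rewrite cmodM exprMn.
  have := zg l l1; set N := nrm2 (z ^~ l) => gN.
  have gN' : cmod (g l) ^+ 2 <= expR (- N).
    by rewrite expRN -div1r ler_pdivlMr ?expR_gt0.
  have convN : nrm2 (fun i => (1 - k)%:C * z i l + k%:C * (z i 0 + 2%:R * X i * l)) <= N + k * C2.
    have kk : 0 <= k <= 1 by rewrite k1 ltW.
    apply: le_trans (nrm2_convex k (z ^~ l) (fun i => z i 0 + 2%:R * X i * l) kk) _.
    have N0 : 0 <= N by exact: nrm2_ge0.
    have MC : nrm2 (fun i => z i 0 + 2%:R * X i * l) <= C2.
      apply: ler_sum => i _; apply: lerXn2r; rewrite ?nnegrE ?cmod_ge0 //.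
        by rewrite addr_ge0 ?mulr_ge0 ?cmod_ge0.
      apply: le_trans (cmodD _ _) _; rewrite lerD2l !cmodM cmod_nat.
      have := cmod_ge0 (X i); have := cmod_ge0 l; nra.
    rewrite -/N; have := ler_wpM2l (ltW k0) MC; have := mulr_ge0 (ltW k0) N0; lra.
  have hl2 : cmod (h l) ^+ 2 <= c ^+ 2.
    by apply: lerXn2r; rewrite ?nnegrE ?cmod_ge0 ?hc // ltW.
  apply: (@le_lt_trans _ _ (expR (- N) * c ^+ 2)).
    by apply: ler_pM; rewrite ?sqr_ge0.
  apply: (@lt_le_trans _ _ (expR (- (N + k * C2)))); last by rewrite ler_expR lerN2.
  rewrite opprD expRD ltr_pM2l ?expR_gt0 //.
  have -> : c ^+ 2 = expR (2 * ln c) by rewrite expRM_natl lnK.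
  by rewrite ltr_expR; lra.
- split; last by rewrite h00.
  move=> i; rewrite mulr0 addr0 -mulrDl -RCD subrK.
  by rewrite mul1r.
- split.
    move=> i.
    have dl : cder (fun l => z i 0 + 2%:R * X i * l) 0 (0 + (0 * 0 + 2%:R * X i * 1)).
      apply: derD; first exact: der_cst.
      by apply: derM; [exact: der_cst|exact: cder_id].
    apply: der_eq (derD (derM (der_cst _ _ _) (dz i))
       (derM (der_cst _ _ _) dl)).
    by rewrite RCD RCD RCN; ring.
  apply: der_eq (derM dg dh).
  have E : k%:C * (g 0 * h1 + g1 * h0) = k%:C * (g 0 * d) by rewrite dE.
  by rewrite h00 RCD mulrDl mul1r E; ring.
Qed.

(** Schwarz-Pick is strict for a product of two disk automorphisms. *)
Lemma improvable_two_zeros z g a b (X : 'I_n -> R[i]) w1 : (forall i, holo (z i)) -> holo g ->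
  cmod a < 1 -> cmod b < 1 ->
  inside z (fun l => mobius a l * (mobius b l * g l)) ->
  (forall i, cder (z i) 0 (X i)) -> cder (fun l => mobius a l * (mobius b l * g l)) 0 w1 ->
  g 0 != 0 \/ (a = 0 /\ b = 0) ->
  improvable (z ^~ 0) (mobius a 0 * (mobius b 0 * g 0)) X w1.
Proof.
move=> hz hg a1 b1 H dz dw cases.
have zg : inside z g.
  apply: (inside_divide_mobius _ _ b) => //; apply: (inside_divide_mobius _ _ a) => //.
  by apply: holoM => //; exact: holo_mobius.
have [g1 dg] : exists k, cder g 0 k by apply: hg; rewrite cmod0.
pose A := 1 - (cmod a ^+ 2)%:C : R[i]; pose B := 1 - (cmod b ^+ 2)%:C : R[i].
pose h0 := a * b; pose h1 := - (A * b + a * B).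
have w1E : w1 = g 0 * h1 + g1 * h0.
  apply: (cder_uniq _ _ _ _ dw).
  apply: der_eq (derM (cder_mobius0 a) (derM (cder_mobius0 b) dg)).
  by rewrite !mobius0 /h0 /h1 -/A -/B; ring.
have [d dE] : exists d, g 0 * h1 + g1 * h0 = g 0 * d.
  case: cases => [g0|[a0 b0]].
    by exists ((g 0 * h1 + g1 * h0) / g 0); rewrite [RHS]mulrC mulfVK.
  by exists 0; rewrite /h1 /h0 a0 b0; ring.
have a0 := cmod_ge0 a; have b0 := cmod_ge0 b.
rewrite w1E !mobius0.
have -> : - a * (- b * g 0) = g 0 * h0 by rewrite /h0; ring.
apply: (improvable_factor z g X g1 h0 h1 d) => //; rewrite /h0 /h1 ?cmodM; first nra.
rewrite cmodN; apply: le_lt_trans (cmodD _ _) _; rewrite !cmodM.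
have AE : cmod A = 1 - cmod a ^+ 2.
  rewrite /A -[1]/(1%:C) -RCN -RCD cmodR_ge0 // subr_ge0 expr_le1 // ltW //.
have BE : cmod B = 1 - cmod b ^+ 2.
  rewrite /B -[1]/(1%:C) -RCN -RCD cmodR_ge0 // subr_ge0 expr_le1 // ltW //.
rewrite AE BE.
have -> : 1 - (cmod a * cmod b) ^+ 2 = (1 - cmod a * cmod b) * (1 + cmod a * cmod b) by ring.
have -> : (1 - cmod a ^+ 2) * cmod b + cmod a * (1 - cmod b ^+ 2) =
  (1 - cmod a * cmod b) * (cmod a + cmod b) by ring.
by rewrite ltr_pM2l; nra.
Qed.

End Enlarge.

(** * The weighted mean value inequality *)

Section KeyInequality.
Context {R : realType}.
Implicit Types (r : R) (a b s w l : R[i]) (f : R[i] -> R[i]) (phi psi : R[i] -> R).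

Definition ravg r phi : R := Re (mean r (fun l => (phi l)%:C)).

Definition rccircle r phi := forall l, cmod l = r -> ccont (fun l => (phi l)%:C) l.

Lemma eq_ravg r phi psi : 0 <= r -> (forall l, cmod l = r -> phi l = psi l) ->
  ravg r phi = ravg r psi.
Proof. by move=> r0 H; congr (Re _); apply: eq_mean => // l lr; rewrite H. Qed.

Lemma ravg_Re r f : 0 <= r -> (forall l, cmod l = r -> ccont f l) ->
  ravg r (fun l => Re (f l)) = Re (mean r f).
Proof.
move=> r0 cf; have cJ : ccircle r (fun l => (f l)^*).
  by move=> l lr; apply: contJ; exact: cf.
rewrite /ravg (eq_mean _ _ (fun l => (2^-1)%:C * (f l + (f l)^*))) //; last first.
  by move=> l _; rewrite addzJ -RCM; congr (_%:C); field.
rewrite meanZ //; last by move=> l lr; apply: contD; [exact: cf|exact: cJ].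
by rewrite meanD // meanJ // ReCM ReD ReJ; field.
Qed.

Lemma ravgD r phi psi : 0 <= r -> rccircle r phi -> rccircle r psi ->
  ravg r (fun l => phi l + psi l) = ravg r phi + ravg r psi.
Proof.
move=> r0 c1 c2; rewrite /ravg -ReD -meanD //; congr (Re _).
by apply: eq_mean => // l _; rewrite RCD.
Qed.

Lemma ravgZ r (k : R) phi : 0 <= r -> rccircle r phi ->
  ravg r (fun l => k * phi l) = k * ravg r phi.
Proof.
move=> r0 c1; rewrite /ravg -ReCM -meanZ //; congr (Re _).
by apply: eq_mean => // l _; rewrite RCM.
Qed.

Lemma ravg_cst r (k : R) : ravg r (fun=> k) = k.
Proof. by rewrite /ravg mean_cst ReC. Qed.

Lemma ravg_le r phi psi : 0 <= r -> rccircle r phi -> rccircle r psi ->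
  (forall l, cmod l = r -> phi l <= psi l) -> ravg r phi <= ravg r psi.
Proof. by move=> r0 c1 c2 H; apply: mean_le. Qed.

Lemma ravg_ge0 r phi : 0 <= r -> rccircle r phi ->
  (forall l, cmod l = r -> 0 <= phi l) -> 0 <= ravg r phi.
Proof. by move=> r0 c1 H; apply: mean_ge0. Qed.

Lemma rccircleD r phi psi : rccircle r phi -> rccircle r psi ->
  rccircle r (fun l => phi l + psi l).
Proof.
move=> c1 c2 l lr; rewrite (_ : (fun l => _) = (fun l => (phi l)%:C + (psi l)%:C)).
  by apply: contD; [exact: c1|exact: c2].
by apply/funext => x; rewrite RCD.
Qed.

Lemma rccircleM r phi psi : rccircle r phi -> rccircle r psi ->
  rccircle r (fun l => phi l * psi l).
Proof.
move=> c1 c2 l lr; rewrite (_ : (fun l => _) = (fun l => (phi l)%:C * (psi l)%:C)).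
  by apply: contM; [exact: c1|exact: c2].
by apply/funext => x; rewrite RCM.
Qed.

Lemma rccircle_cst r k : rccircle r (fun=> k).
Proof. by move=> l _; exact: cont_cst. Qed.

Lemma rccircle_Re r f : (forall l, cmod l = r -> ccont f l) -> rccircle r (fun l => Re (f l)).
Proof. by move=> cf l lr; apply: cont_Re; exact: cf. Qed.

Lemma rccircle_cmod2 r f : (forall l, cmod l = r -> ccont f l) ->
  rccircle r (fun l => cmod (f l) ^+ 2).
Proof.
move=> cf l lr; rewrite (_ : (fun l => _) = (fun l => f l * (f l)^*)).
  by apply: contM; [exact: cf|apply: contJ; exact: cf].
by apply/funext => x; rewrite mulzJ.
Qed.

Lemma rccircle_sum (I : Type) (q : seq I) r (phi : I -> R[i] -> R) :
  (forall i, rccircle r (phi i)) -> rccircle r (fun l => \sum_(i <- q) phi i l).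
Proof.
move=> c1; elim: q => [|i q IH].
  rewrite (_ : (fun l => _) = (fun=> 0)); first exact: rccircle_cst.
  by apply/funext => x; rewrite big_nil.
rewrite (_ : (fun l => _) = (fun l => phi i l + \sum_(j <- q) phi j l)).
  exact: rccircleD.
by apply/funext => x; rewrite big_cons.
Qed.

Lemma ravg_sum (I : Type) (q : seq I) r (phi : I -> R[i] -> R) : 0 <= r ->
  (forall i, rccircle r (phi i)) ->
  ravg r (fun l => \sum_(i <- q) phi i l) = \sum_(i <- q) ravg r (phi i).
Proof.
move=> r0 c1; elim: q => [|i q IH].
  rewrite big_nil -[RHS](ravg_cst r); apply: eq_ravg => // l _; by rewrite big_nil.
rewrite big_cons -IH -ravgD //; last exact: rccircle_sum.
by apply: eq_ravg => // l _; rewrite big_cons.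
Qed.

Lemma cmod2_jet a b l w : cmod (a + b * l + w) ^+ 2 =
  cmod a ^+ 2 + cmod l ^+ 2 * cmod b ^+ 2 + (cmod w ^+ 2
   + (Re (2%:R * (a^* * b * l + a^* * w)) + Re (2%:R * (b^* * (w * l^*))))).
Proof.
rewrite natRC !sqr_cmod !ReImE; case: a => a1 a2; case: b => b1 b2; case: l => l1 l2.
by case: w => w1 w2; rewrite !ReImE; ring.
Qed.

Section OneRadius.
Context (r : R) (r0 : 0 < r) (r1 : r < 1).
Let r0' : 0 <= r := ltW r0.

Lemma circle_neq0 l : cmod l = r -> l != 0.
Proof. by move=> lr; rewrite -cmod_gt0 lr. Qed.

Lemma cont_inv_circle l : cmod l = r -> ccont (fun l => l^-1) l.
Proof. by move=> lr; apply: contV; [exact: circle_neq0|exact: cont_id]. Qed.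

Lemma conj_circle l : cmod l = r -> l^* = (r ^+ 2)%:C * l^-1.
Proof.
move=> lr; rewrite -(mulzJ_circle _ _ lr) mulrC mulKf //.
exact: circle_neq0.
Qed.

Lemma mean_holo f : holo f -> mean r f = f 0.
Proof. by move=> hf; apply: mean_holo_le => //; exact: holo_holo_le. Qed.

Lemma mean_div f k : holo f -> cder f 0 k -> mean r (fun l => f l * l^-1) = k.
Proof.
move=> hf df; rewrite (cauchyE1 r f 0 k) ?cmod0 //.
apply: eq_mean => // l lr; rewrite subr0; field; exact: circle_neq0.
Qed.

Lemma mean_mulJ f k : holo f -> cder f 0 k -> mean r (fun l => f l * l^*) = (r ^+ 2)%:C * k.
Proof.
move=> hf df; rewrite -(mean_div _ _ hf df) -meanZ //.
  by apply: eq_mean => // l lr; rewrite conj_circle // mulrCA.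
by move=> l lr; apply: contM; [exact: (holo_circle r)|exact: cont_inv_circle].
Qed.

(** Parseval for the first two Taylor coefficients: on a circle the remainder of order
two is orthogonal to the functions [1] and [l]. *)
Lemma parseval_jet f (f1 : R[i]) : holo f -> cder f 0 f1 ->
  ravg r (fun l => cmod (f l) ^+ 2) = cmod (f 0) ^+ 2 + r ^+ 2 * cmod f1 ^+ 2
   + ravg r (fun l => cmod (f l - f 0 - f1 * l) ^+ 2).
Proof.
move=> hf df; pose F l := f l - f 0 - f1 * l.
have hF : holo F.
  apply: holoB; first by apply: holoB => //; exact: holo_cst.
  by apply: holoM; [exact: holo_cst|exact: holo_id].
have F0 : F 0 = 0 by rewrite /F mulr0 subr0 subrr.
have dF : cder F 0 0.
  apply: der_eq (derB (derB df (der_cst _ _ _))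
    (derM (der_cst _ f1 _) (cder_id 0))).
  by ring.
pose G l := 2%:R * ((f 0)^* * f1 * l + (f 0)^* * F l).
pose H l := 2%:R * (f1^* * (F l * l^*)).
have hG : holo G.
  apply: holoM; first exact: holo_cst.
  apply: holoD; first by apply: holoM; [exact: holo_cst|exact: holo_id].
  by apply: holoM; [exact: holo_cst|].
have cFl l : cmod l = r -> ccont F l by exact: holo_circle.
have cFJ : ccircle r (fun l => F l * l^*).
  by move=> l lr; apply: contM; [exact: cFl|apply: contJ; exact: cont_id].
have cH l : cmod l = r -> ccont H l.
  move=> lr; apply: contM; first exact: cont_cst.
  by apply: contM; [exact: cont_cst|exact: cFJ].
have E : ravg r (fun l => Re (H l)) = 0.
  rewrite ravg_Re // /H meanZ //.
    by rewrite meanZ // (mean_mulJ _ _ hF dF) !mulr0.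
  by move=> l lr; apply: contM; [exact: cont_cst|exact: cFJ].
have E2 : ravg r (fun l => Re (G l)) = 0.
  rewrite ravg_Re //; last by move=> l; exact: holo_circle.
  by rewrite mean_holo // /G F0 !mulr0 addr0 mulr0.
have -> : ravg r (fun l => cmod (f l) ^+ 2) = ravg r (fun l =>
    (cmod (f 0) ^+ 2 + r ^+ 2 * cmod f1 ^+ 2) + (cmod (F l) ^+ 2 + (Re (G l) + Re (H l)))).
  apply: eq_ravg => // l lr.
  have -> : f l = f 0 + f1 * l + F l by rewrite /F; ring.
  by rewrite cmod2_jet lr.
rewrite ravgD //; first last.
- apply: rccircleD; first exact: rccircle_cmod2.
  by apply: rccircleD; apply: rccircle_Re => // l; exact: holo_circle.
- exact: rccircle_cst.
rewrite ravg_cst; congr (_ + _).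
rewrite ravgD //; first last.
- by apply: rccircleD; apply: rccircle_Re => // l; exact: holo_circle.
- exact: rccircle_cmod2.
rewrite ravgD // ?E ?E2 ?addr0 //; apply: rccircle_Re => // l; exact: holo_circle.
Qed.

(** On the circle the product of the weight with [u] has the same real part as a
function that involves [u], [l u] and [u conj l] only, whose means are read off
the jet. *)
Lemma ravg_weight_Re (u : R[i] -> R[i]) (u1 s : R[i]) : holo u -> cder u 0 u1 ->
  ravg r (fun l => cmod (1 - s^* * l) ^+ 2 * (2 * Re (u l))) =
  (1 + r ^+ 2 * cmod s ^+ 2) * (2 * Re (u 0)) - r ^+ 2 * (2 * Re (s * u1)).
Proof.
move=> hu du.
pose k := (1 + r ^+ 2 * cmod s ^+ 2)%:C : R[i].
pose H l := 2%:R * (k * u l - s^* * l * u l - s * (u l * l^*)).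
have n2 := natRC 2.
have cu l : cmod l = r -> ccont u l by exact: holo_circle.
have cuJ : ccircle r (fun l => u l * l^*).
  by move=> l lr; apply: contM; [exact: cu|apply: contJ; exact: cont_id].
have -> : ravg r (fun l => cmod (1 - s^* * l) ^+ 2 * (2 * Re (u l))) = ravg r (fun l => Re (H l)).
  apply: eq_ravg => // l lr; rewrite /H /k n2 -lr.
  by rewrite !sqr_cmod !ReImE -!sqr_cmod !sqr_cmod; ring.
have h1 : holo (fun l => k * u l - s^* * l * u l).
  apply: holoB; apply: holoM => //; first exact: holo_cst.
  by apply: holoM; [exact: holo_cst|exact: holo_id].
have c1 : ccircle r (fun l => k * u l - s^* * l * u l) by move=> l; exact: holo_circle.
have c2 : ccircle r (fun l => s * (u l * l^*)).
  by move=> l lr; apply: contM; [exact: cont_cst|exact: cuJ].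
have c3 : ccircle r (fun l => k * u l - s^* * l * u l - s * (u l * l^*)).
  by move=> l lr; apply: contB; [exact: c1|exact: c2].
rewrite ravg_Re //; last by move=> l lr; apply: contM; [exact: cont_cst|exact: c3].
rewrite /H meanZ // meanB // mean_holo // meanZ // (mean_mulJ _ _ hu du).
by rewrite n2 /k !ReImE; ring.
Qed.

End OneRadius.
End KeyInequality.

Section Defect.
Context {R : realType} {n : nat}.
Implicit Types (r : R) (a b s w l : R[i]) (u : R[i] -> R[i]) (X Y : 'I_n -> R[i])
  (z : 'I_n -> R[i] -> R[i]).

(** The limit, as the radius tends to one, of the mean over the circle of
[|1 - conj s l|^2 (2 Re u + |z|^2)] when [(1 - conj s l) z] is affine; it depends
only on the 1-jet [(z0, u0; X, u1)]. *)
Definition defect s (z0 : 'I_n -> R[i]) (u0 : R[i]) X (u1 : R[i]) : R :=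
  (1 + cmod s ^+ 2) * (2 * Re u0) - 2 * Re (s * u1)
  + (nrm2 z0 + nrm2 (fun i => X i - s^* * z0 i)).

Section Fixed.
Context (z : 'I_n -> R[i] -> R[i]) (u : R[i] -> R[i]) (X : 'I_n -> R[i]) (u1 : R[i]).
Context (hz : forall i, holo (z i)) (hu : holo u)
  (dz : forall i, cder (z i) 0 (X i)) (du : cder u 0 u1)
  (neg : forall l, cmod l < 1 -> 2 * Re (u l) + nrm2 (z ^~ l) <= 0).

Definition remainder s (i : 'I_n) l := (1 - s^* * l) * z i l - z i 0 - (X i - s^* * z i 0) * l.

Lemma holo_weighted s i : holo (fun l => (1 - s^* * l) * z i l).
Proof. by apply: holoM => //; exact: holo_denom. Qed.

Lemma holo_remainder s i : holo (remainder s i).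
Proof.
apply: holoB; first by apply: holoB; [exact: holo_weighted|exact: holo_cst].
by apply: holoM; [exact: holo_cst|exact: holo_id].
Qed.

(** Multiplying [2 Re u + |z|^2 <= 0] by [|1 - conj s l|^2] turns the second term into
the squared norm of the holomorphic map [(1 - conj s l) z], to which Parseval
applies. *)
Lemma weighted_mean_le0 r s : 0 < r -> r < 1 ->
  (1 + r ^+ 2 * cmod s ^+ 2) * (2 * Re (u 0)) - r ^+ 2 * (2 * Re (s * u1))
  + (nrm2 (z ^~ 0) + r ^+ 2 * nrm2 (fun i => X i - s^* * z i 0))
  + \sum_i ravg r (fun l => cmod (remainder s i l) ^+ 2) <= 0.
Proof.
move=> r0 r1; have r0' := ltW r0.
have dw i : cder (fun l => (1 - s^* * l) * z i l) 0 (X i - s^* * z i 0).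
  apply: der_eq (derM (derB (der_cst _ 1 _)
    (derM (der_cst _ s^* _) (cder_id 0))) (dz i)).
  by ring.
have cw i : rccircle r (fun l => cmod ((1 - s^* * l) * z i l) ^+ 2).
  by apply: rccircle_cmod2 => l; apply: holo_circle => //; exact: holo_weighted.
have cS : rccircle r (fun l => \sum_i cmod ((1 - s^* * l) * z i l) ^+ 2).
  exact: (rccircle_sum _ _ _ (fun i l => cmod ((1 - s^* * l) * z i l) ^+ 2) cw).
have c0 : rccircle r (fun l => cmod (1 - s^* * l) ^+ 2 * (2 * Re (u l))).
  apply: rccircleM.
    apply: rccircle_cmod2 => l; apply: holo_circle => //; exact: holo_denom.
  apply: rccircleM; first exact: rccircle_cst.
  by apply: rccircle_Re => l; exact: holo_circle.
have E : ravg r (fun l => cmod (1 - s^* * l) ^+ 2 * (2 * Re (u l))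
           + \sum_i cmod ((1 - s^* * l) * z i l) ^+ 2) <= 0.
  have := ravg_le r _ (fun=> 0) r0' (rccircleD r _ _ c0 cS) (rccircle_cst r 0).
  rewrite ravg_cst; apply.
    move=> l lr.
    have -> : \sum_i cmod ((1 - s^* * l) * z i l) ^+ 2 = cmod (1 - s^* * l) ^+ 2 * nrm2 (z ^~ l).
      by rewrite -nrm2Z.
    rewrite -mulrDr; apply: mulr_ge0_le0; first exact: sqr_ge0.
    by apply: neg; rewrite lr.
apply: le_trans E; rewrite ravgD //.
rewrite (ravg_weight_Re r r0 r1 u u1 s) //.
rewrite (ravg_sum _ _ _ (fun i l => cmod ((1 - s^* * l) * z i l) ^+ 2)) //.
suff -> : \sum_i ravg r (fun l => cmod ((1 - s^* * l) * z i l) ^+ 2) =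
    nrm2 (z ^~ 0) + r ^+ 2 * nrm2 (fun i => X i - s^* * z i 0)
    + \sum_i ravg r (fun l => cmod (remainder s i l) ^+ 2) by lra.
rewrite /nrm2 mulr_sumr -!big_split /=; apply: eq_bigr => i _.
by rewrite (parseval_jet r r0 r1 _ _ (holo_weighted s i) (dw i)) mulr0 subr0 mul1r.
Qed.

Lemma sum_ravg_ge0 r s : 0 < r -> r < 1 ->
  forall i, 0 <= ravg r (fun l => cmod (remainder s i l) ^+ 2).
Proof.
move=> r0 r1 i; apply: ravg_ge0 => [||l _]; first exact: ltW; last exact: sqr_ge0.
by apply: rccircle_cmod2 => l; apply: holo_circle => //; exact: holo_remainder.
Qed.

Lemma defect_le0 s : defect s (z ^~ 0) (u 0) X u1 <= 0.
Proof.
pose A := 2 * Re (u 0) + nrm2 (z ^~ 0).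
pose B := cmod s ^+ 2 * (2 * Re (u 0)) - 2 * Re (s * u1) + nrm2 (fun i => X i - s^* * z i 0).
have -> : defect s (z ^~ 0) (u 0) X u1 = A + B by rewrite /defect /A /B; ring.
apply: (small_le _ (2 * `|B|) 1) => // e /andP[e0 e1].
have r0 : 0 < 1 - e by lra.
have r1 : 1 - e < 1 by lra.
have := weighted_mean_le0 _ s r0 r1.
have : 0 <= \sum_i ravg (1 - e) (fun l => cmod (remainder s i l) ^+ 2).
  by apply: sumr_ge0 => i _; exact: sum_ravg_ge0.
set S := \sum_i _ => S0 H.
have H2 : A + (1 - e) ^+ 2 * B <= 0 by rewrite /A /B; lra.
have -> : A + B = (A + (1 - e) ^+ 2 * B) + (2 * e - e ^+ 2) * B by ring.
have B1 : B <= `|B| by exact: ler_norm.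
have e2 : 0 <= 2 * e - e ^+ 2 by rewrite expr2; nra.
have := ler_wpM2l e2 B1; have := mulr_ge0 (sqr_ge0 e) (normr_ge0 B); lra.
Qed.

(** In the equality case the remainders have mean square tending to zero, hence
vanish by Cauchy's formula. *)
Lemma defect0_affine s : defect s (z ^~ 0) (u 0) X u1 = 0 ->
  forall i l, cmod l < 1 -> (1 - s^* * l) * z i l = z i 0 + (X i - s^* * z i 0) * l.
Proof.
move=> D0 i w w1; apply/eqP; rewrite -subr_eq0 opprD addrA -/(remainder s i w).
rewrite -cmod_eq0 -sqrf_eq0 eq_le sqr_ge0 andbT.
pose A := 2 * Re (u 0) + nrm2 (z ^~ 0).
pose B := cmod s ^+ 2 * (2 * Re (u 0)) - 2 * Re (s * u1) + nrm2 (fun i => X i - s^* * z i 0).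
have AB : A + B = 0 by rewrite -D0 /defect /A /B; ring.
pose K := 2 / (1 - cmod w); have K0 : 0 < K by rewrite divr_gt0 //; lra.
apply: (small_le _ (2 * `|B| * K) ((1 - cmod w) / 2)); first lra.
move=> e /andP[e0 ew]; have w0 := cmod_ge0 w.
have r0 : 0 < 1 - e by lra.
have r1 : 1 - e < 1 by lra.
have wr : cmod w < 1 - e by lra.
have := weighted_mean_le0 _ s r0 r1.
rewrite (bigD1 i) //=; set S := \sum_(j | _) _ => H.
have S0 : 0 <= S by apply: sumr_ge0 => j _; exact: sum_ravg_ge0.
have := cmod_sq_le_rmean _ _ _ r1 (holo_remainder s i) wr.
rewrite -/(ravg _ _); set Q := ravg _ _ in H * => hQ.
have Q0 : 0 <= Q by exact: sum_ravg_ge0.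
have QB : Q <= 2 * `|B| * e.
  have : Q <= (2 * e - e ^+ 2) * B.
    have -> : (2 * e - e ^+ 2) * B = - (A + (1 - e) ^+ 2 * B) + (A + B) by ring.
    by rewrite AB addr0 /A /B; lra.
  have B1 : B <= `|B| by exact: ler_norm.
  have e2 : 0 <= 2 * e - e ^+ 2 by rewrite expr2; nra.
  have := ler_wpM2l e2 B1; have := mulr_ge0 (sqr_ge0 e) (normr_ge0 B); lra.
apply: le_trans hQ _.
have -> : 2 * `|B| * K * e = (2 * `|B| * e) * K by ring.
apply: ler_pM => //; first by rewrite divr_ge0 //; lra.
exact: ratio_le.
Qed.

End Fixed.

(** The candidates for extremal disks. When [balanced] holds, [2 Re u + |z|^2] is a
multiple of the Poisson kernel with pole at the boundary or of its analogue for a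
pole outside ([disk_rho]), so that it vanishes on the circle away from the pole. *)
Definition disk_z s (y0 y1 : 'I_n -> R[i]) (i : 'I_n) l := (y0 i + y1 i * l) / (1 - s^* * l).

Definition disk_u s (y0 y1 : 'I_n -> R[i]) (c0 : R[i]) l :=
  (c0 + (s^* * c0^* - herm y1 y0) * l) / (1 - s^* * l).

Definition balanced s (y0 y1 : 'I_n -> R[i]) (c0 : R[i]) :=
  (1 - cmod s ^+ 2) * (2 * Re c0 + nrm2 y0) = - nrm2 (fun i => y1 i + s^* * y0 i).

Section Candidate.
Context (s : R[i]) (y0 y1 : 'I_n -> R[i]) (c0 : R[i]).
Context (s1 : cmod s <= 1) (bal : balanced s y0 y1 c0).

Lemma disk_rho l : cmod l < 1 ->
  2 * Re (disk_u s y0 y1 c0 l) + nrm2 ((disk_z s y0 y1) ^~ l) =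
  (2 * Re c0 + nrm2 y0) * (1 - cmod l ^+ 2) / cmod (1 - s^* * l) ^+ 2.
Proof.
move=> l1; have d0 := mobius_denom s l s1 l1.
set d := 1 - s^* * l in d0 *; have D0 : cmod d ^+ 2 != 0 by rewrite sqrf_eq0 cmod_eq0.
apply: (mulIf D0); rewrite mulfVK // mulrDl.
have E1 : Re (disk_u s y0 y1 c0 l) * cmod d ^+ 2 =
    Re ((c0 + (s^* * c0^* - herm y1 y0) * l) * d^*).
  rewrite /disk_u -/d mulrC -ReCM -mulzJ; congr (Re _); field; exact: d0.
have E2 : nrm2 ((disk_z s y0 y1) ^~ l) * cmod d ^+ 2 = nrm2 (fun i => y0 i + l * y1 i).
  rewrite mulrC -nrm2Z; congr nrm2; apply/funext => i.
  by rewrite /disk_z -/d mulrC mulfVK // [l * _]mulrC.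
rewrite -mulrA E1 E2 nrm2D nrm2Z hermZr (hermC y0 y1).
have := bal; rewrite /balanced nrm2D nrm2Z hermZr cmodJ conjK => B.
have -> : 1 - cmod l ^+ 2 = 1 - (Re l ^+ 2 + Im l ^+ 2) by rewrite sqr_cmod.
rewrite [cmod l ^+ 2]sqr_cmod.
move: B; rewrite (sqr_cmod s); move: (herm y1 y0) (nrm2 y0) (nrm2 y1) => P N0 N1.
rewrite /d !ReImE => B.
have -> : N1 = - ((1 - (Re s ^+ 2 + Im s ^+ 2)) * (2 * Re c0 + N0)) -
   ((Re s ^+ 2 + Im s ^+ 2) * N0 + 2 * (Re s * Re P - Im s * Im P)) by lra.
by ring.
Qed.

Lemma holo_linfrac a b : holo (fun l => (a + b * l) / (1 - s^* * l)).
Proof.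
apply: holoM; first exact: holo_affine.
by apply: holoV; [move=> l; exact: mobius_denom|exact: holo_denom].
Qed.

Lemma cder_linfrac a b : cder (fun l => (a + b * l) / (1 - s^* * l)) 0 (b + s^* * a).
Proof.
have d1 : cder (fun l => a + b * l) 0 (0 + (0 * 0 + b * 1)).
  apply: derD; first exact: der_cst.
  by apply: derM; [exact: der_cst|exact: cder_id].
have d2 : cder (fun l => 1 - s^* * l) 0 (0 - (0 * 0 + s^* * 1)).
  apply: derB; first exact: der_cst.
  by apply: derM; [exact: der_cst|exact: cder_id].
have n0 : 1 - s^* * 0 != 0 by rewrite mulr0 subr0 oner_eq0.
apply: der_eq (derM d1 (derV _ (fun l => 1 - s^* * l) 0 _ n0 d2)).
by rewrite !(mulr0, subr0, addr0, invr1); ring.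
Qed.

Lemma disk_z0 i : disk_z s y0 y1 i 0 = y0 i.
Proof. by rewrite /disk_z !mulr0 subr0 addr0 divr1. Qed.

Lemma disk_u0 : disk_u s y0 y1 c0 0 = c0.
Proof. by rewrite /disk_u !mulr0 subr0 addr0 divr1. Qed.

Lemma cder_disk_z i : cder (disk_z s y0 y1 i) 0 (y1 i + s^* * y0 i).
Proof. exact: cder_linfrac. Qed.

Lemma cder_disk_u : cder (disk_u s y0 y1 c0) 0 (s^* * (2 * Re c0)%:C - herm y1 y0).
Proof. by rewrite -addzJ; apply: der_eq (cder_linfrac _ _); ring. Qed.

Lemma defect_disk : defect s y0 c0 (fun i => y1 i + s^* * y0 i)
  (s^* * (2 * Re c0)%:C - herm y1 y0) = 0.
Proof.
rewrite /defect (_ : (fun i => y1 i + s^* * y0 i - s^* * y0 i) = y1); last first.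
  by apply/funext => i; rewrite addrK.
have := bal; rewrite /balanced nrm2D nrm2Z hermZr cmodJ conjK => B.
have -> : Re (s * (s^* * (2 * Re c0)%:C - herm y1 y0)) =
    cmod s ^+ 2 * (2 * Re c0) - Re (s * herm y1 y0).
  by rewrite mulrBr [s * (s^* * _)]mulrA mulzJ -RCM ReB ReC.
lra.
Qed.

Lemma weighted_diff_le (z : 'I_n -> R[i]) (u : R[i]) l : cmod l < 1 ->
  (forall i, z i = disk_z s y0 y1 i l) -> 2 * Re u + nrm2 z <= 0 ->
  cmod (1 - s^* * l) ^+ 2 * (2 * Re (u - disk_u s y0 y1 c0 l)) <=
  - (2 * Re c0 + nrm2 y0) * (1 - cmod l ^+ 2).
Proof.
move=> l1 zE E2; have E1 := disk_rho l l1.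
rewrite -(_ : nrm2 z = nrm2 ((disk_z s y0 y1) ^~ l)) in E1; last first.
  by congr nrm2; exact/funext.
rewrite mulrC -ler_pdivlMr ?exprn_gt0 ?cmod_gt0 ?mobius_denom //.
by rewrite ReB !mulNr; lra.
Qed.

End Candidate.
End Defect.

(** * Extremal disks are linear fractional *)

Section Extremal.
Context {R : realType} {n : nat}.
Implicit Types (r : R) (a b s w l : R[i]) (X Y : 'I_n -> R[i]).

(** The alternative excludes the disks with [s] on the circle that lie entirely in
[2 Re u + |z|^2 = 0]. *)
Definition standard s (z : 'I_n -> R[i] -> R[i]) (u : R[i] -> R[i]) :=
  exists y0 y1 c0, [/\ cmod s <= 1, balanced s y0 y1 c0, 2 * Re c0 + nrm2 y0 <= 0,
    cmod s < 1 \/ 2 * Re c0 + nrm2 y0 < 0 &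
    forall l, cmod l < 1 ->
      (forall i, z i l = disk_z s y0 y1 i l) /\ u l = disk_u s y0 y1 c0 l].

Section Fixed.
Context (z : 'I_n -> R[i] -> R[i]) (u : R[i] -> R[i]) (X : 'I_n -> R[i]) (u1 : R[i]).
Context (hz : forall i, holo (z i)) (hu : holo u)
  (dz : forall i, cder (z i) 0 (X i)) (du : cder u 0 u1)
  (neg : forall l, cmod l < 1 -> 2 * Re (u l) + nrm2 (z ^~ l) <= 0).

Let rho0 : R := 2 * Re (u 0) + nrm2 (z ^~ 0).
Let kappa : R[i] := u1 + herm X (z ^~ 0).

Lemma defect_rho s : defect s (z ^~ 0) (u 0) X u1 =
  rho0 * (1 + cmod s ^+ 2) + nrm2 X - 2 * Re (s * kappa).
Proof.
rewrite /defect /rho0 /kappa.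
have -> : nrm2 (fun i => X i - s^* * z i 0) =
    nrm2 X + cmod s ^+ 2 * nrm2 (z ^~ 0) - 2 * Re (s * herm X (z ^~ 0)).
  rewrite (_ : (fun i => X i - s^* * z i 0) = (fun i => X i + (- s^*) * z i 0)); last first.
    by apply/funext => i; rewrite mulNr.
  by rewrite nrm2D nrm2Z hermZr cmodN cmodJ conjN conjK mulNr ReN; ring.
by rewrite [s * (_ + _)]mulrDr ReD; ring.
Qed.

(** The defect is nonpositive at the point of the unit circle where it is largest. *)
Lemma cmod_kappa : cmod kappa <= - rho0.
Proof.
have [k0|k0] := eqVneq kappa 0.
  by rewrite k0 cmod0 oppr_ge0; apply: neg; rewrite cmod0.
have kp : 0 < cmod kappa by rewrite cmod_gt0.
pose s := - kappa^* / (cmod kappa)%:C.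
have s1 : cmod s = 1.
  by rewrite /s cmodM cmodV cmodN cmodJ cmodR_ge0 ?cmod_ge0 // mulfV // gt_eqF.
have sk : s * kappa = (- cmod kappa)%:C.
  have kC : (cmod kappa)%:C != 0 :> R[i] by rewrite RC_eq0 gt_eqF.
  apply: (mulfI kC); rewrite /s mulrA [_ * (_ / _)]mulrC mulfVK // -RCM.
  by rewrite mulNr mulrC mulzJ -RCN; congr (_%:C); ring.
have := defect_le0 z u X u1 hz hu dz du neg s.
rewrite defect_rho s1 sk ReC expr1n; have := nrm2_ge0 X; lra.
Qed.

(** If the disk with the jet of [(z, u)] stretched by [t > 1] exists among the
candidates, the jet is improvable; [t] is fixed by the balance condition. *)
Lemma improvable_short : rho0 < 0 -> (exists i, X i != 0) \/ u1 != 0 ->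
  nrm2 X * - rho0 + cmod kappa ^+ 2 < rho0 ^+ 2 ->
  improvable (z ^~ 0) (cexp (u 0)) X (cexp (u 0) * u1).
Proof.
move=> rho_lt0 jet short; set q := - rho0 in short.
have q0 : 0 < q by rewrite /q oppr_gt0.
pose D := nrm2 X * q + cmod kappa ^+ 2.
have X0 := nrm2_ge0 X.
have q0' := ltW q0.
have Xq : 0 <= nrm2 X * q by exact: mulr_ge0.
have k2 : 0 <= cmod kappa ^+ 2 by exact: sqr_ge0.
have D0 : 0 < D.
  rewrite lt_def (addr_ge0 Xq k2) andbT /D paddr_eq0 // mulf_eq0 (gt_eqF q0) orbF.
  rewrite sqrf_eq0 cmod_eq0; apply/negP => /andP[/eqP /nrm2_eq0 XE /eqP kE].
  case: jet => [[i Xi]|]; first by rewrite XE eqxx in Xi.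
  have -> : u1 = kappa - herm X (z ^~ 0) by rewrite /kappa addrK.
  by rewrite kE /herm big1 ?subrr ?eqxx // => i _; rewrite XE mul0r.
have q20 : 0 < q ^+ 2 / D by rewrite divr_gt0 // exprn_gt0.
pose t := Num.sqrt (q ^+ 2 / D).
have t2 : t ^+ 2 * D = q ^+ 2.
  by rewrite sqr_sqrtr; [rewrite mulfVK // gt_eqF|exact: ltW].
have t0 : 0 <= t by exact: sqrtr_ge0.
have t1 : 1 < t.
  rewrite -sqrtr1 ltr_sqrt // ltr_pdivlMr // mul1r /D.
  by have -> : q ^+ 2 = rho0 ^+ 2 by rewrite /q sqrrN.
pose s := - (t%:C * kappa^*) / q%:C.
have qC : q%:C != 0 :> R[i] by rewrite RC_eq0 gt_eqF.
have sJ : s^* = - (t%:C * kappa) / q%:C by rewrite /s !conjE.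
have cs : cmod s = t * cmod kappa / q.
  by rewrite /s cmodM cmodV cmodN cmodM cmodJ !cmodR_ge0 //.
have s2 : cmod s ^+ 2 * q ^+ 2 = t ^+ 2 * cmod kappa ^+ 2.
  by rewrite cs; field; rewrite gt_eqF.
have s1 : cmod s <= 1.
  rewrite -(@expr_le1 _ 2) ?cmod_ge0 // -(ler_pM2r (exprn_gt0 2 q0)) s2 mul1r -t2.
  by apply: ler_wpM2l; [exact: sqr_ge0|rewrite /D lerDr].
pose y1 i := t%:C * X i - s^* * z i 0.
have yX : (fun i => y1 i + s^* * z i 0) = (fun i => t%:C * X i).
  by apply/funext => i; rewrite /y1 subrK.
have bal : balanced s (z ^~ 0) y1 (u 0).
  rewrite /balanced yX nrm2Z cmodR_ge0 // -/rho0.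
  have rE : rho0 = - q by rewrite /q opprK.
  have qn0 : q != 0 by rewrite gt_eqF.
  apply: (mulIf qn0); rewrite rE.
  have -> : (1 - cmod s ^+ 2) * - q * q = cmod s ^+ 2 * q ^+ 2 - q ^+ 2 by ring.
  by rewrite s2 -t2 /D; ring.
have A0 : 2 * Re (u 0) + nrm2 (z ^~ 0) < 0 by [].
exists t, (disk_z s (z ^~ 0) y1), (fun l => cexp (disk_u s (z ^~ 0) y1 (u 0) l)); split => //.
- split; first by move=> i; exact: holo_linfrac.
  by apply: holo_cexp; exact: holo_linfrac.
- move=> l l1; rewrite cmod_cexp -expRM_natl ltr_expR.
  have := disk_rho s (z ^~ 0) y1 (u 0) s1 bal l l1.
  set E := (X in _ = X -> _) => H.
  have : E < 0.
    rewrite /E -mulrA pmulr_llt0 //.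
    have l2 : cmod l ^+ 2 < 1 by rewrite expr_lt1 ?cmod_ge0.
    rewrite divr_gt0 ?subr_gt0 // exprn_gt0 // cmod_gt0; exact: mobius_denom.
  by rewrite -H; lra.
- by split=> [i|]; [exact: disk_z0|rewrite disk_u0].
split=> [i|].
  apply: der_eq (cder_disk_z s (z ^~ 0) y1 i).
  by have := congr1 (@^~ i) yX.
apply: der_eq (der_cexp _ _ _ _ (cder_disk_u s (z ^~ 0) y1 (u 0))).
rewrite disk_u0 mulrCA; congr (_ * _).
rewrite /y1 hermBl !hermZl herm_self.
have -> : s^* * (2 * Re (u 0))%:C - (t%:C * herm X (z ^~ 0) - s^* * (nrm2 (z ^~ 0))%:C) =
  s^* * rho0%:C - t%:C * herm X (z ^~ 0) by rewrite /rho0 RCD; ring.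
have -> : rho0%:C = - q%:C by rewrite -RCN /q opprK.
have -> : s^* * - q%:C = t%:C * kappa by rewrite sJ mulrN mulfVK // opprK.
by rewrite /kappa; ring.
Qed.

(** If no candidate stretches the jet, the defect vanishes at the parameter [s] that
maximizes it, so that [z] is the [z]-part of a candidate with the same jet. The
difference [v] of the two exponents then vanishes to second order at the origin,
while [|1 - conj s l|^2 Re v] is at most a multiple of [1 - |l|^2]. *)
Lemma standard_zero_free : rho0 < 0 -> (exists i, X i != 0) \/ u1 != 0 ->
  ~ improvable (z ^~ 0) (cexp (u 0)) X (cexp (u 0) * u1) -> exists s, standard s z u.
Proof.
move=> rho_lt0 jet nimp; set q := - rho0.
have q0 : 0 < q by rewrite /q oppr_gt0.
have long : rho0 ^+ 2 <= nrm2 X * q + cmod kappa ^+ 2.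
  by rewrite leNgt; apply/negP => short; apply: nimp; exact: improvable_short.
have kq := cmod_kappa; rewrite -/q in kq.
have qC : q%:C != 0 :> R[i] by rewrite RC_eq0 gt_eqF.
pose s := - kappa^* / q%:C.
have sJ : s^* = - kappa / q%:C by rewrite /s !conjE.
have cs : cmod s = cmod kappa / q.
  by rewrite /s cmodM cmodV cmodN cmodJ (cmodR_ge0 _ (ltW q0)).
have s1 : cmod s <= 1 by rewrite cs ler_pdivrMr // mul1r.
have s2 : cmod s ^+ 2 * q ^+ 2 = cmod kappa ^+ 2.
  by rewrite cs; field; rewrite gt_eqF.
have rE : rho0 = - q by rewrite /q opprK.
have sk : s * kappa = (- (cmod s ^+ 2 * q))%:C.
  have -> : s * kappa = (- cmod kappa ^+ 2 / q)%:C.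
    by rewrite /s RCM RCV RCN -mulzJ; ring.
  by rewrite -s2; congr (_%:C); field; rewrite gt_eqF.
have D0 : defect s (z ^~ 0) (u 0) X u1 = 0.
  apply/eqP; rewrite eq_le (defect_le0 z u X u1 hz hu dz du neg s) /=.
  rewrite defect_rho sk ReC rE -(pmulr_rge0 _ q0).
  have -> : q * (- q * (1 + cmod s ^+ 2) + nrm2 X - 2 * - (cmod s ^+ 2 * q)) =
    nrm2 X * q + cmod s ^+ 2 * q ^+ 2 - q ^+ 2 by ring.
  by rewrite s2 subr_ge0 (_ : q ^+ 2 = rho0 ^+ 2) // /q sqrrN.
pose y1 i := X i - s^* * z i 0.
have yX : (fun i => y1 i + s^* * z i 0) = X by apply/funext => i; rewrite /y1 subrK.
have bal : balanced s (z ^~ 0) y1 (u 0).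
  rewrite /balanced yX -/rho0 rE; move: D0; rewrite defect_rho sk ReC rE; lra.
have du' : cder (disk_u s (z ^~ 0) y1 (u 0)) 0 u1.
  apply: der_eq (cder_disk_u s (z ^~ 0) y1 (u 0)).
  rewrite /y1 hermBl hermZl herm_self.
  have -> : s^* * (2 * Re (u 0))%:C - (herm X (z ^~ 0) - s^* * (nrm2 (z ^~ 0))%:C) =
    s^* * rho0%:C - herm X (z ^~ 0) by rewrite /rho0 RCD; ring.
  have -> : rho0%:C = - q%:C by rewrite -RCN /q opprK.
  have -> : s^* * - q%:C = kappa by rewrite sJ mulrN mulfVK // opprK.
  by rewrite /kappa addrK.
have zE i l : cmod l < 1 -> z i l = disk_z s (z ^~ 0) y1 i l.
  move=> l1; have d0 := mobius_denom s l s1 l1.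
  by rewrite /disk_z -(defect0_affine z u X u1 hz hu dz du neg s D0 i l l1) mulrC mulKf.
pose us := disk_u s (z ^~ 0) y1 (u 0).
have hus : holo us by exact: holo_linfrac.
pose v l := u l - us l.
have hv : holo v by exact: holoB.
have v0 : v 0 = 0 by rewrite /v /us disk_u0 subrr.
have dv : cder v 0 0 by apply: der_eq (derB du du'); rewrite subrr.
have c01 : cmod (0 : R[i]) < 1 by rewrite cmod0.
have [V1 hV1 V1E] := holo_divide v 0 hv c01 v0.
have V10 : V1 0 = 0.
  have [k dk] := hV1 0 c01.
  have := derM (derB (cder_id 0) (der_cst _ 0 _)) dk.
  move=> /(der_near _ _ v _ _ 1 ltr01) H; apply: (cder_uniq v 0) dv.
  apply: der_eq (H _); first by ring.
  by move=> x; rewrite subr0 => x1; rewrite V1E // subr0.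
have [V hV VE] := holo_divide V1 0 hV1 c01 V10.
have vE l : cmod l < 1 -> v l = l ^+ 2 * V l.
  by move=> l1; rewrite V1E // VE // subr0 mulrA.
have vle l : cmod l < 1 -> cmod (1 - s^* * l) ^+ 2 * (2 * Re (v l)) <= q * (1 - cmod l ^+ 2).
  by move=> l1; apply: (weighted_diff_le _ _ _ _ _ _ (z ^~ l)) => // [i|]; [exact: zE|exact: neg].
(* On the circle of radius [r] the function [G] below equals [|1 - conj s l|^2 v];
it is holomorphic inside because [v] has a double zero at the origin. *)
have vanish w : cmod w < 1 -> (1 - s^* * w) * (w - s) * (w * V w) = 0.
  move=> w1; apply/eqP; rewrite -cmod_eq0 eq_le cmod_ge0 andbT.
  have w0 := cmod_ge0 w.
  pose T := cmod ((1 - s^* * w) * (w * V w)); have T0 : 0 <= T by exact: cmod_ge0.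
  pose K := 2 / (1 - cmod w); have K0 : 0 < K by rewrite divr_gt0 //; lra.
  apply: (small_le _ (2 * T + 2 * q * (1 + K)) ((1 - cmod w) / 2)); first lra.
  move=> e /andP[e0 ew]; pose r := 1 - e.
  have r0 : 0 < r by rewrite /r; lra.
  have r1 : r < 1 by rewrite /r; lra.
  have wr : cmod w < r by rewrite /r; lra.
  pose G l := (1 - s^* * l) * (l - s * (r ^+ 2)%:C) * (l * V l).
  have hG : holo G.
    apply: holoM; last by apply: holoM => //; exact: holo_id.
    apply: holoM; first exact: holo_denom.
    by apply: holoB; [exact: holo_id|exact: holo_cst].
  have G0 : G 0 = 0 by rewrite /G mul0r mulr0.
  have Gle l : cmod l = r -> Re (G l) <= q * (1 - r ^+ 2) / 2.
    move=> lr; have l1 : cmod l < 1 by rewrite lr.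
    have -> : G l = (cmod (1 - s^* * l) ^+ 2)%:C * v l.
      rewrite -mulzJ vE // /G -lr -mulzJ (_ : (1 - s^* * l)^* = 1 - s * l^*); first by ring.
      by rewrite conjB conjM conjK conj1.
    by rewrite ReCM; have := vle l l1; rewrite lr; lra.
  have := borel_caratheodory r G w _ (holo_holo_le _ _ r1 hG) wr Gle.
  rewrite G0 Re0 subr0 => /(_ erefl) BC.
  have [e1 e2] : 0 <= 1 - r ^+ 2 /\ 1 - r ^+ 2 <= 2 * e.
    have /andP[/ltW] : 0 < 1 - r ^+ 2 <= 2 * (1 - r) by apply: sqr_radius; rewrite r0.
    by rewrite [in 1 - r]/r subKr.
  have rK : r / (r - cmod w) <= K by exact: ratio_le.
  have -> : (1 - s^* * w) * (w - s) * (w * V w) =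
     G w - (s * (1 - r ^+ 2)%:C) * ((1 - s^* * w) * (w * V w)).
    by rewrite /G RCD RCN; ring.
  have ET : cmod (s * (1 - r ^+ 2)%:C * ((1 - s^* * w) * (w * V w))) = cmod s * (1 - r ^+ 2) * T.
    by rewrite cmodM [cmod (s * _)]cmodM cmodR_ge0 //; exact: e1.
  apply: le_trans (cmodB _ _) _; rewrite ET.
  have h1 : cmod s * (1 - r ^+ 2) <= 2 * e by apply: le_trans e2; exact: ler_piMl.
  have h2 : 2 * (q * (1 - r ^+ 2) / 2) * (1 + r / (r - cmod w)) <= 2 * q * (1 + K) * e.
    have -> : 2 * q * (1 + K) * e = (q * (2 * e)) * (1 + K) by ring.
    have -> : 2 * (q * (1 - r ^+ 2) / 2) = q * (1 - r ^+ 2) by field.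
    have rw0 : 0 <= r / (r - cmod w).
      by apply: divr_ge0; [exact: ltW|rewrite subr_ge0 ltW].
    apply: ler_pM; rewrite ?lerD2l //.
    - by apply: mulr_ge0; [exact: ltW|exact: e1].
    - exact: addr_ge0.
    - by rewrite ler_pM2l.
  have := ler_wpM2r T0 h1; lra.
have v_ne w : cmod w < 1 -> w != s -> v w = 0.
  move=> w1 ws; rewrite vE // expr2 -mulrA; apply/eqP; rewrite mulf_eq0; apply/orP; right.
  have /eqP := vanish w w1; rewrite mulf_eq0 => /orP[|//].
  by rewrite mulf_eq0 (negPf (mobius_denom s w s1 w1)) /= subr_eq0 (negPf ws).
have v_all w : cmod w < 1 -> v w = 0.
  move=> w1; have [ws|ws] := eqVneq w s; last exact: v_ne.
  apply/eqP; rewrite -cmod_eq0 eq_le cmod_ge0 andbT.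
  apply: (max_circle ((1 + cmod w) / 2)) => //; try lra.
  move=> l lr; rewrite v_ne ?cmod0 //; first lra.
  by apply: contra_eq_neq lr => ->; rewrite -ws; apply/eqP => E; lra.
exists s, (z ^~ 0), y1, (u 0); split => //.
- exact: ltW.
- by right.
- move=> l l1; split; first by move=> i; exact: zE.
  by apply/eqP; rewrite -subr_eq0 -/us -/(v l) v_all.
Qed.

End Fixed.
End Extremal.

Section OneZero.
Context {R : realType} {n : nat}.
Implicit Types (r : R) (s w l : R[i]).

(** First order expansion of the Schwarz-Pick inequality along a path of jets that
starts at an extremal one: [q] is the derivative of the automorphism at the origin
and [g2] the square of its value there. With [t = exp (-e a)] the claim is the
positivity of a quadratic polynomial in [t], increasing beyond [1 - e a]. *)
Lemma schwarz_pick_small (a b q B g2 : R) : 0 < q -> 0 <= g2 -> q + g2 = 1 -> 0 <= B ->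
  (1 + g2) * a < b -> exists2 e : R, 0 < e < 1 &
  expR (e * a) * (q - e * b + e ^+ 2 * B) < 1 - g2 * expR (e * a) ^+ 2.
Proof.
move=> q0 g20 qg B0 ab; pose de := b - (1 + g2) * a.
have de0 : 0 < de by rewrite subr_gt0.
pose K := `|a| + `|b| + B + 1.
have a0 := normr_ge0 a; have b0 := normr_ge0 b.
have [K1 aK bK BK] : [/\ 1 <= K, `|a| <= K, `|b| <= K & B <= K].
  by rewrite /K; split; lra.
move: a0 b0 aK bK BK; clearbody K => a0 b0 aK bK BK.
have K0 : 0 < K by exact: lt_le_trans ltr01 K1.
have KK : K <= K ^+ 2 by rewrite expr2 ler_peMl // ltW.
have K2 : 0 < 8 * K ^+ 2 by rewrite mulr_gt0 // exprn_gt0.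
(* The error terms below are at most [4 e K] and [3 e K ^+ 2]. *)
pose e := Num.min (1 / (8 * K ^+ 2)) (de / (8 * K ^+ 2)).
have e0 : 0 < e by rewrite lt_min !divr_gt0.
have eM : e * (8 * K ^+ 2) <= 1 by rewrite -ler_pdivlMr // ge_min lexx.
have eD : e * (8 * K ^+ 2) <= de by rewrite -ler_pdivlMr // ge_min lexx orbT.
move: e0 eM eD; clearbody e => e0 eM eD.
have eK : e * K <= e * K ^+ 2 by rewrite ler_pM2l.
have e1 : e < 1.
  have : e <= e * K by rewrite ler_peMr // ltW.
  clear -eK eM e0; lra.
have ee : e ^+ 2 <= e by rewrite expr2 ger_pMl // ltW.
exists e; first by rewrite e0.
set L := q - e * b + e ^+ 2 * B.
pose t := expR (- (e * a)); have t0 : 0 < t by exact: expR_gt0.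
have -> : expR (e * a) = t^-1 by rewrite /t expRN invrK.
pose t1 := 1 - e * a.
have tt1 : t1 <= t by exact: expR_ge1Dx.
have absM x y : `|x| <= K -> `|y| <= K -> - K ^+ 2 <= x * y <= K ^+ 2.
  by move=> xK yK; rewrite -ler_norml normrM expr2; apply: ler_pM.
have BK' : `|B| <= K by rewrite ger0_norm.
have tL : 0 <= t + t1 - L.
  have ea : e * a <= e * K by rewrite ler_pM2l //; exact: le_trans (ler_norm a) aK.
  have eb : - (e * K) <= e * b.
    by rewrite -mulrN ler_pM2l // lerNl; apply: le_trans bK; rewrite -normrN ler_norm.
  have eB : e ^+ 2 * B <= e * K by apply: ler_pM => //; exact: sqr_ge0.
  rewrite /L; rewrite /t1 in tt1 *; clear -ea eb eB tt1 qg g20 eK eM; lra.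
have poly : 0 < t1 ^+ 2 - L * t1 - g2.
  have -> : t1 ^+ 2 - L * t1 - g2 = e * (de + e * (a ^+ 2 - B - a * b) + e ^+ 2 * (B * a)).
    rewrite /t1 /L /de -[g2](addKr q) (addrC _ g2); move: qg; rewrite addrC => ->.
    ring.
  apply: mulr_gt0 => //.
  have /andP[_ ab2] := absM a b aK bK; have /andP[Ba2 _] := absM B a BK' aK.
  have h1 : e * (- (2 * K ^+ 2)) <= e * (a ^+ 2 - B - a * b).
    by rewrite ler_pM2l //; have := sqr_ge0 a; clear -ab2 BK KK; lra.
  have h2 : - (e * K ^+ 2) <= e ^+ 2 * (B * a).
    apply: le_trans (ler_wpM2l (sqr_ge0 e) Ba2).
    by rewrite mulrN lerN2 ler_wpM2r // sqr_ge0.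
  clear -h1 h2 eD de0; lra.
have main : 0 < t ^+ 2 - L * t - g2.
  have -> : t ^+ 2 - L * t - g2 = (t - t1) * (t + t1 - L) + (t1 ^+ 2 - L * t1 - g2) by ring.
  by apply: ltr_wpDl => //; apply: mulr_ge0 => //; rewrite subr_ge0.
have t20 : 0 < t ^+ 2 by rewrite exprn_gt0.
rewrite -(ltr_pM2r t20).
have -> : t^-1 * L * t ^+ 2 = L * t by field; rewrite gt_eqF.
have -> : (1 - g2 * t^-1 ^+ 2) * t ^+ 2 = t ^+ 2 - g2 by field; rewrite gt_eqF.
by rewrite -subr_gt0 addrAC.
Qed.

Section Fixed.
Context (z : 'I_n -> R[i] -> R[i]) (u : R[i] -> R[i]) (X : 'I_n -> R[i]) (u1 g : R[i]).
Context (hz : forall i, holo (z i)) (hu : holo u)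
  (dz : forall i, cder (z i) 0 (X i)) (du : cder u 0 u1)
  (neg : forall l, cmod l < 1 -> 2 * Re (u l) + nrm2 (z ^~ l) <= 0)
  (g1 : cmod g < 1)
  (nimp : ~ improvable (z ^~ 0) (mobius g 0 * cexp (u 0)) X
     ((1 - (cmod g ^+ 2)%:C) * cexp (u 0) + mobius g 0 * (cexp (u 0) * u1))).

Let q : R := 1 - cmod g ^+ 2.

Let q_gt0 : 0 < q.
Proof. by rewrite /q subr_gt0 expr_lt1 ?cmod_ge0. Qed.

Let y1 (i : 'I_n) : R[i] := X i - g^* * z i 0.

(* The real value of [c0] that balances [y1]. *)
Let c0 : R[i] := ((- nrm2 X / q - nrm2 (z ^~ 0)) / 2)%:C.

Let us := disk_u g (z ^~ 0) y1 c0.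

Let yX : (fun i => y1 i + g^* * z i 0) = X.
Proof. by apply/funext => i; rewrite /y1 subrK. Qed.

Let A_E : 2 * Re c0 + nrm2 (z ^~ 0) = - nrm2 X / q.
Proof. by rewrite /c0 ReC; field; rewrite gt_eqF. Qed.

Let bal : balanced g (z ^~ 0) y1 c0.
Proof. by rewrite /balanced yX A_E -/q; field; rewrite gt_eqF. Qed.

Let A_le0 : 2 * Re c0 + nrm2 (z ^~ 0) <= 0.
Proof. by rewrite A_E mulNr oppr_le0 divr_ge0 ?nrm2_ge0 // ltW. Qed.

Let g1' : cmod g <= 1. Proof. exact: ltW. Qed.

Let v l := u l - us l.
Let v1 : R[i] := u1 - (g^* * (2 * Re c0)%:C - herm y1 (z ^~ 0)).

Let hus : holo us. Proof. exact: holo_linfrac. Qed.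
Let hv : holo v. Proof. exact: holoB. Qed.
Let dv : cder v 0 v1.
Proof. by apply: derB du _; exact: cder_disk_u. Qed.

Lemma defect_diff : defect g (z ^~ 0) (u 0) X u1 =
  (1 + cmod g ^+ 2) * (2 * Re (v 0)) - 2 * Re (g * v1).
Proof.
have := defect_disk g (z ^~ 0) y1 c0 bal; rewrite yX /defect => E.
rewrite -[LHS]subr0 -E /v /v1 /us disk_u0 [g * (u1 - _)]mulrBr !ReB; ring.
Qed.

(** If the weighted mean value inequality is strict, moving towards the candidate
disk makes the first order data of the zero factor non-extremal. *)
Lemma defect_one_zero : defect g (z ^~ 0) (u 0) X u1 = 0.
Proof.
apply/eqP; rewrite eq_le (defect_le0 z u X u1 hz hu dz du neg g) /= leNgt.
apply/negP => lt0; apply: nimp.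
rewrite defect_diff in lt0.
pose b := Re (g * v1).
have ab : (1 + cmod g ^+ 2) * Re (v 0) < b by rewrite /b; lra.
have qg : q + cmod g ^+ 2 = 1 by rewrite /q; ring.
pose B := cmod (g * v1) ^+ 2 / (2 * q).
have B0 : 0 <= B by rewrite divr_ge0 ?sqr_ge0 // mulr_ge0 // ltW.
have [e /andP[e0 e1] He] := schwarz_pick_small _ _ _ _ _ q_gt0 (sqr_ge0 _) qg B0 ab.
pose ze i l := (1 - e)%:C * z i l + e%:C * disk_z g (z ^~ 0) y1 i l.
pose ue l := u l - e%:C * v l.
pose E := cexp (e%:C * v 0).
pose h0 := mobius g 0 * E; pose h1 := E * (q%:C - e%:C * (g * v1)).
have cE : cmod E = expR (e * Re (v 0)) by rewrite /E cmod_cexp ReCM.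
have hze i : holo (ze i).
  by apply: holoD; apply: holoM => //; [exact: holo_cst|exact: holo_cst|exact: holo_linfrac].
have hue : holo ue by apply: holoB => //; apply: holoM => //; exact: holo_cst.
have dze i : cder (ze i) 0 (X i).
  apply: der_eq (derD (derM (der_cst _ _ _) (dz i))
    (derM (der_cst _ _ _) (cder_disk_z g (z ^~ 0) y1 i))).
  have -> : y1 i + g^* * z i 0 = X i by rewrite /y1 subrK.
  by rewrite RCD RCN; ring.
have due : cder (fun l => cexp (ue l)) 0 (cexp (ue 0) * (u1 - e%:C * v1)).
  apply: der_cexp; apply: der_eq (derB du (derM (der_cst _ _ _) dv)).
  by ring.
have Eue : cexp (ue 0) * E = cexp (u 0) by rewrite /E -cexpD /ue subrK.
have ins : inside ze (fun l => cexp (ue l)).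
  move=> l l1; rewrite cmod_cexp -expRM_natl -expRD -[leRHS]expR0 ler_expR.
  have ue_E : Re (ue l) = (1 - e) * Re (u l) + e * Re (us l).
    by rewrite /ue /v ReB ReCM ReB; ring.
  have e01 : 0 <= e <= 1 by rewrite (ltW e0) (ltW e1).
  have := nrm2_convex e (z ^~ l) ((disk_z g (z ^~ 0) y1) ^~ l) e01.
  have := neg l l1; have := disk_rho g (z ^~ 0) y1 c0 g1' bal l l1.
  rewrite -/us ue_E; set S := (X in _ = X -> _) => hS hN hC.
  have S0 : S <= 0.
    rewrite /S -mulrA; apply: mulr_le0_ge0 => //.
    by rewrite divr_ge0 ?sqr_ge0 // subr_ge0 expr_le1 ?cmod_ge0 // ltW.
  have h1' : (1 - e) * (2 * Re (u l) + nrm2 (z ^~ l)) <= 0.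
    by apply: mulr_ge0_le0 => //; lra.
  have h2' : e * (2 * Re (us l) + nrm2 ((disk_z g (z ^~ 0) y1) ^~ l)) <= 0.
    by apply: mulr_ge0_le0 => //; [exact: ltW|rewrite hS].
  apply: le_trans (lerD (lexx _) hC) _; lra.
have n0 := cexp_neq0 (ue 0).
have -> : mobius g 0 * cexp (u 0) = cexp (ue 0) * h0 by rewrite /h0 -Eue; ring.
have -> : (1 - (cmod g ^+ 2)%:C) * cexp (u 0) + mobius g 0 * (cexp (u 0) * u1) =
    cexp (ue 0) * h1 + cexp (ue 0) * (u1 - e%:C * v1) * h0.
  rewrite /h0 /h1 -Eue mobius0 /q RCD RCN; ring.
have -> : z ^~ 0 = ze ^~ 0.
  by apply/funext => i; rewrite /ze disk_z0 -mulrDl -RCD subrK mul1r.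
have h1lt : cmod h1 < 1 - cmod h0 ^+ 2.
  pose p := q%:C - e%:C * (g * v1).
  have -> : cmod h1 = expR (e * Re (v 0)) * cmod p by rewrite /h1 -/p cmodM cE.
  have -> : cmod h0 ^+ 2 = cmod g ^+ 2 * expR (e * Re (v 0)) ^+ 2.
    by rewrite /h0 mobius0 cmodM cE cmodN exprMn.
  apply: le_lt_trans He; rewrite ler_pM2l ?expR_gt0 //.
  have p2 : cmod p ^+ 2 = q ^+ 2 - 2 * q * (e * b) + e ^+ 2 * cmod (g * v1) ^+ 2.
    by rewrite /p /b !sqr_cmod; move: (g * v1) => k; rewrite !ReImE; ring.
  have -> : q - e * b + e ^+ 2 * B = (cmod p ^+ 2 + q ^+ 2) / (2 * q).
    by rewrite p2 /B; field; rewrite gt_eqF.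
  rewrite ler_pdivlMr ?mulr_gt0 //; have := sqr_ge0 (cmod p - q); lra.
have h0lt : cmod h0 < 1.
  rewrite -(@expr_lt1 _ 2) ?cmod_ge0 //; have := cmod_ge0 h1; lra.
set k := _ + _; apply: (improvable_factor ze (fun l => cexp (ue l)) X _ h0 h1 (k / cexp (ue 0))) => //.
- exact: holo_cexp.
- by rewrite [RHS]mulrC mulfVK.
Qed.

(** As the defect vanishes, the candidate agrees with [z], and the mean of
[|1 - conj g l|^2 Re v], where [v] is the difference of the exponents, tends to zero
as the radius tends to one. At the circle [Re v] is nonpositive in the limit and the
weight is bounded below, so that [Re v 0 = 0] and [v] is constant; an imaginary
constant is absorbed by [c0]. *)
Lemma standard_one_zero : standard g z u.
Proof.
have D0 := defect_one_zero.
have zE i l : cmod l < 1 -> z i l = disk_z g (z ^~ 0) y1 i l.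
  move=> l1; have d0 := mobius_denom g l g1' l1.
  by rewrite /disk_z -(defect0_affine z u X u1 hz hu dz du neg g D0 i l l1) mulrC mulKf.
rewrite defect_diff in D0.
pose K := nrm2 X / q; have K0 : 0 <= K by rewrite divr_ge0 ?nrm2_ge0 // ltW.
have vle l : cmod l < 1 -> cmod (1 - g^* * l) ^+ 2 * (2 * Re (v l)) <= K * (1 - cmod l ^+ 2).
  move=> l1; rewrite (_ : K = - (2 * Re c0 + nrm2 (z ^~ 0))); last first.
    by rewrite A_E mulNr opprK.
  by apply: (weighted_diff_le _ _ _ _ _ _ (z ^~ l)) => // [i|]; [exact: zE|exact: neg].
pose m := (1 - cmod g) ^+ 2; have m0 : 0 < m by rewrite exprn_gt0 // subr_gt0.
have mle l : cmod l < 1 -> m <= cmod (1 - g^* * l) ^+ 2.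
  move=> l1; have g0 := cmod_ge0 g; have l0 := cmod_ge0 l.
  apply: lerXn2r; rewrite ?nnegrE ?cmod_ge0 ?subr_ge0 //.
  by have := cmodB_ge 1 (g^* * l); rewrite cmod1 cmodM cmodJ; nra.
have vup l : cmod l < 1 -> Re (v l) <= K * (1 - cmod l ^+ 2) / m / 2.
  move=> l1; rewrite ler_pdivlMr // ler_pdivlMr //.
  have l2 : 0 <= K * (1 - cmod l ^+ 2).
    by rewrite mulr_ge0 // subr_ge0 expr_le1 ?cmod_ge0 // ltW.
  have [vp|vn] := leP 0 (Re (v l)); last first.
    by apply: le_trans l2; rewrite pmulr_lle0 //; lra.
  by apply: le_trans (vle l l1); rewrite mulrC [Re _ * 2]mulrC ler_wpM2r ?mle //; lra.
have cv r l : r < 1 -> cmod l = r -> ccont v l by move=> r1; exact: holo_circle.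
have Rv_le0 : Re (v 0) <= 0.
  apply: (small_le _ (K / m) 1) => // e /andP[e0 e1].
  have r0 : 0 < 1 - e by lra.
  have r1 : 1 - e < 1 by lra.
  have -> : Re (v 0) = ravg (1 - e) (fun l => Re (v l)).
    by rewrite ravg_Re ?ltW ?mean_holo // => l; exact: cv.
  rewrite -[leRHS](ravg_cst (1 - e)); apply: ravg_le; rewrite ?ltW //.
  - by apply: rccircle_Re => l; exact: cv.
  - exact: rccircle_cst.
  - move=> l lr; have l1 : cmod l < 1 by rewrite lr.
    apply: le_trans (vup l l1) _; rewrite lr.
    have -> : K / m * e = K * (2 * e) / m / 2 by field; rewrite gt_eqF.
    have /andP[_] : 0 < 1 - (1 - e) ^+ 2 <= 2 * (1 - (1 - e)) by apply: sqr_radius; rewrite r0.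
    move=> h; rewrite !ler_pM2r ?invr_gt0 //; apply: ler_wpM2l => //; lra.
have Rv_ge0 : 0 <= Re (v 0).
  rewrite -oppr_le0; apply: (small_le _ ((K - 2 * Re (v 0)) / m) 1) => // e /andP[e0 e1].
  have r0 : 0 < 1 - e by lra.
  have r1 : 1 - e < 1 by lra.
  have r0' := ltW r0.
  have /andP[h0 h] : 0 < 1 - (1 - e) ^+ 2 <= 2 * (1 - (1 - e)) by apply: sqr_radius; rewrite r0.
  pose S l := K * (1 - (1 - e) ^+ 2) - cmod (1 - g^* * l) ^+ 2 * (2 * Re (v l)).
  have W := ravg_weight_Re (1 - e) r0 r1 v v1 g hv dv.
  have cW : rccircle (1 - e) (fun l => cmod (1 - g^* * l) ^+ 2 * (2 * Re (v l))).
    apply: rccircleM.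
      by apply: rccircle_cmod2 => l; apply: holo_circle => //; exact: holo_denom.
    apply: rccircleM; first exact: rccircle_cst.
    by apply: rccircle_Re => l; exact: cv.
  have cS : rccircle (1 - e) (fun l => -1 * (cmod (1 - g^* * l) ^+ 2 * (2 * Re (v l)))).
    by apply: rccircleM => //; exact: rccircle_cst.
  have SE : ravg (1 - e) S = (1 - (1 - e) ^+ 2) * (K - 2 * Re (v 0)).
    rewrite (eq_ravg _ _ (fun l => K * (1 - (1 - e) ^+ 2) +
       -1 * (cmod (1 - g^* * l) ^+ 2 * (2 * Re (v l))))) //; last first.
      by move=> l _; rewrite /S mulN1r.
    rewrite ravgD ?ravg_cst ?ravgZ ?W //; last exact: rccircle_cst.
    have -> : 2 * Re (g * v1) = (1 + cmod g ^+ 2) * (2 * Re (v 0)) by lra.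
    by ring.
  have : ravg (1 - e) (fun l => -1 * (m * 2 * Re (v l))) <= ravg (1 - e) S.
    apply: ravg_le => //.
    - apply: rccircleM; first exact: rccircle_cst.
      by apply: rccircleM; [exact: rccircle_cst|apply: rccircle_Re => l; exact: cv].
    - rewrite (_ : S = fun l => K * (1 - (1 - e) ^+ 2) +
         -1 * (cmod (1 - g^* * l) ^+ 2 * (2 * Re (v l)))).
        by apply: rccircleD => //; exact: rccircle_cst.
      by apply/funext => l; rewrite /S mulN1r.
    - move=> l lr; have l1 : cmod l < 1 by rewrite lr.
      have ml := mle l l1; have vl := vle l l1; rewrite /S.
      have [vp|vn] := leP 0 (Re (v l)).
        rewrite lr in vl; have := mulr_ge0 (ltW m0) vp; lra.
      have := mulr_ge0 K0 (ltW h0).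
      have : 0 <= (cmod (1 - g^* * l) ^+ 2 - m) * (- Re (v l)).
        by rewrite mulr_ge0 ?subr_ge0 ?oppr_ge0 // ltW.
      by lra.
  have -> : ravg (1 - e) (fun l => -1 * (m * 2 * Re (v l))) = - (m * 2 * Re (v 0)).
    have cR : rccircle (1 - e) (fun l => Re (v l)) by apply: rccircle_Re => l; exact: cv.
    rewrite ravgZ //; last by apply: rccircleM => //; exact: rccircle_cst.
    rewrite ravgZ // ravg_Re // ?mean_holo ?mulN1r // => l; exact: cv.
  rewrite SE => H; rewrite mulrAC ler_pdivlMr //.
  have : (1 - (1 - e) ^+ 2) * (K - 2 * Re (v 0)) <= (2 * e) * (K - 2 * Re (v 0)).
    by apply: ler_wpM2r; lra.
  lra.
have Rv0 : Re (v 0) = 0 by apply/eqP; rewrite eq_le Rv_le0.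
have vE w : cmod w < 1 -> v w = v 0.
  move=> w1; apply/eqP; rewrite -subr_eq0 -cmod_eq0 eq_le cmod_ge0 andbT.
  have w0 := cmod_ge0 w.
  pose C := 2 / (1 - cmod w); have C0 : 0 < C by rewrite divr_gt0 //; lra.
  apply: (small_le _ (2 * (K / m) * (1 + C)) ((1 - cmod w) / 2)); first lra.
  move=> e /andP[e0 ew].
  have r0 : 0 < 1 - e by lra.
  have r1 : 1 - e < 1 by lra.
  have wr : cmod w < 1 - e by lra.
  have Km0 : 0 <= K / m by rewrite divr_ge0 // ltW.
  have vr l : cmod l = 1 - e -> Re (v l) <= K / m * e.
    move=> lr; have l1 : cmod l < 1 by rewrite lr.
    apply: le_trans (vup l l1) _; rewrite lr.
    have -> : K / m * e = K * (2 * e) / m / 2 by field; rewrite gt_eqF.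
    have /andP[_] : 0 < 1 - (1 - e) ^+ 2 <= 2 * (1 - (1 - e)) by apply: sqr_radius; rewrite r0.
    move=> h; rewrite !ler_pM2r ?invr_gt0 //; apply: ler_wpM2l => //; lra.
  have := borel_caratheodory _ _ _ _ (holo_holo_le _ _ r1 hv) wr vr Rv0.
  have rC : (1 - e) / (1 - e - cmod w) <= C by exact: ratio_le.
  move=> BC; apply: le_trans BC _.
  have -> : 2 * (K / m) * (1 + C) * e = 2 * (K / m * e) * (1 + C) by ring.
  apply: ler_wpM2l; last by rewrite lerD2l.
  by apply: mulr_ge0 => //; apply: mulr_ge0 => //; exact: ltW.
exists (z ^~ 0), y1, (c0 + v 0).
have Rc : Re (c0 + v 0) = Re c0 by rewrite ReD Rv0 addr0.
split => //; rewrite ?Rc //.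
- by rewrite /balanced Rc.
- by left.
- move=> l l1; split; first by move=> i; exact: zE.
  have d0 := mobius_denom g l g1' l1.
  have v0J : (v 0)^* = - v 0.
    by move: (v 0) Rv0 => k k0; apply: eqReIm; rewrite !ReImE ?k0 ?oppr0.
  have -> : u l = us l + v l by rewrite /v addrC subrK.
  rewrite vE // /us /disk_u conjD v0J; move: (herm y1 (z ^~ 0)) c0 (v 0) => P k w.
  by field.
Qed.

End Fixed.
End OneZero.

(** * From geodesics to jets *)

Section SplitIndex.
Context {R : realType} {n : nat}.
Local Notation last := (rshift n (ord0 : 'I_1)).

Lemma sum_split_last (V : zmodType) (F : 'I_(n + 1) -> V) :
  \sum_j F j = \sum_(i < n) F (lshift 1 i) + F last.
Proof. by rewrite big_split_ord /= big_ord1. Qed.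

Lemma ind_split_last (P : 'I_(n + 1) -> Prop) :
  (forall i, P (lshift 1 i)) -> P last -> forall j, P j.
Proof.
move=> Pl Pr j; rewrite -(splitK j); case: (fintype.split j) => i /=; first exact: Pl.
by rewrite (ord1 i).
Qed.

Definition on_split (f : 'I_n -> R[i]) (x : R[i]) (j : 'I_(n + 1)) : R[i] :=
  match fintype.split j with inl i => f i | inr _ => x end.

Lemma on_split_l f x i : on_split f x (lshift 1 i) = f i.
Proof. by rewrite /on_split -[lshift 1 i]/(unsplit (inl i)) unsplitK. Qed.

Lemma on_split_r f x : on_split f x last = x.
Proof. by rewrite /on_split -[last]/(unsplit (inr ord0)) unsplitK. Qed.

End SplitIndex.

Section Coordinates.
Context {R : realType} {N : nat}.
Implicit Types (f : R[i]^o -> 'rV[R[i]]_N) (l : R[i]).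

Lemma norm_coord_le (v : 'rV[R[i]]_N) i : `|v 0 i| <= `|v|.
Proof.
rewrite [leRHS]/Num.norm /= mx_normE -[leLHS]nngE num_le.
exact: (le_bigmax _ (fun j : 'I_1 * 'I_N => `|v j.1 j.2|%:nng) (0, i)).
Qed.

Lemma norm_le_coord (v : 'rV[R[i]]_N) (e : R[i]) : 0 <= e ->
  (forall i, `|v 0 i| <= e) -> `|v| <= e.
Proof.
move=> e0 H; have [->|v0] := eqVneq `|v| 0; first by [].
have [[i j] E] := mx_norm_neq0 v0; rewrite -[leLHS]/(mx_norm v) E /= ord1; exact: H.
Qed.

Lemma cder_coord f l (d : 'rV[R[i]]_N) i : is_derive (l : R[i]^o) 1 f d ->
  cder (fun x => f x 0 i) l (d 0 i).
Proof.
move=> /is_deriveP H; apply/cder_is_derive/is_deriveP => e e0.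
have [de de0 {}H] := H e e0; exists de => // s hs.
apply: le_trans (H s hs); apply: le_trans (norm_coord_le _ i).
by rewrite !mxE.
Qed.

Lemma is_derive_coord f l (d : 'rV[R[i]]_N) : (forall i, cder (fun x => f x 0 i) l (d 0 i)) ->
  is_derive (l : R[i]^o) 1 f d.
Proof.
move=> H; apply/is_deriveP => e e0.
have [x x0 eE] := complex_gt0 e e0.
have Hi i : exists de : R, 0 < de /\ forall s, cmod (s - l) < de ->
    cmod (f s 0 i - f l 0 i - d 0 i * (s - l)) <= x * cmod (s - l).
  by have [de de0 h] := H i x x0; exists de.
have [F HF] := choice Hi.
pose de := \big[Num.min/1]_i F i.
have de0 : 0 < de.
  by apply/bigmin_gtP; split => // i _; have [] := HF i.
exists de%:C => [|s]; first by rewrite ltRC.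
rewrite normc_cmod ltRC => hs; rewrite eE -RCM.
apply: norm_le_coord => [|i].
  by rewrite -[0]/(0%:C) leRC mulr_ge0 ?cmod_ge0 // ltW.
rewrite !mxE normc_cmod leRC (mulrC _ (d 0 i)).
have [_ h] := HF i; apply: h; apply: lt_le_trans hs _.
exact: bigmin_le.
Qed.

End Coordinates.

Section Geodesic.
Context {R : realType} {n : nat}.
Local Notation D := (@fock_bargmann_hartogs R n 1).

Lemma enorm2 N (v : 'rV[R[i]]_N) : enorm v ^+ 2 = \sum_(j < N) cmod (v 0 j) ^+ 2.
Proof. by rewrite /enorm sqr_sqrtr // sumr_ge0 // => i _; exact: sqr_ge0. Qed.

Lemma fock_bargmann_hartogsE (v : 'rV[R[i]]_(n + 1)) :
  D v <-> cmod (v 0 (rshift n ord0)) ^+ 2 < expR (- nrm2 (fun i => v 0 (lshift 1 i))).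
Proof.
rewrite /fock_bargmann_hartogs /= !enorm2 big_ord1 mxE.
have -> : \sum_(j < n) cmod (lsubmx v 0 j) ^+ 2 = nrm2 (fun i => v 0 (lshift 1 i)).
  by apply: eq_bigr => i _; rewrite mxE.
by [].
Qed.

(** A geodesic through its own jet has [alpha = 1], so the infimum is one, while an
improvement of the jet would make it smaller. *)
Lemma geodesic_not_improvable (phi : R[i]^o -> 'rV[R[i]]_(n + 1)) :
  kobayashi_geodesic D (phi 0) ('D_1 phi 0) phi -> 'D_1 phi 0 != 0 ->
  ~ improvable (fun i => phi 0 0 (lshift 1 i)) (phi 0 0 (rshift n ord0))
      (fun i => ('D_1 phi 0) 0 (lshift 1 i)) (('D_1 phi 0) 0 (rshift n ord0)).
Proof.
move=> [_ _ [alpha [aE aK]]] d0 [t [z [w [t1 [hz hw] ins [z0 w0] [dz dw]]]]].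
have a1 : alpha = 1.
  apply/eqP; rewrite -subr_eq0; have : (alpha - 1) *: 'D_1 phi 0 == 0.
    by rewrite scalerBl aE scale1r subrr.
  by rewrite scaler_eq0 (negPf d0) orbF.
pose f (l : R[i]^o) : 'rV[R[i]]_(n + 1) := \row_j on_split (z ^~ l) (w l) j.
have fl l i : f l 0 (lshift 1 i) = z i l by rewrite mxE on_split_l.
have fr l : f l 0 (rshift n ord0) = w l by rewrite mxE on_split_r.
have flE i : (fun l => f l 0 (lshift 1 i)) = z i by apply/funext => l; exact: fl.
have frE : (fun l => f l 0 (rshift n ord0)) = w by exact/funext.
have df l : cmod l < 1 -> derivable f l 1.
  move=> l1; have [kw dkw] := hw l l1.
  have [kz dkz] := choice (fun i => hz i l l1).
  have H : is_derive (l : R[i]^o) 1 f (\row_j on_split kz kw j).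
    apply: is_derive_coord; apply: ind_split_last => [i|].
      by rewrite mxE on_split_l flE.
    by rewrite mxE on_split_r frE.
  by case: H.
have d0f : is_derive (0 : R[i]^o) 1 f (t%:C *: 'D_1 phi 0).
  apply: is_derive_coord; apply: ind_split_last => [i|].
    by rewrite mxE flE; exact: dz.
  by rewrite mxE frE; exact: dw.
have t0 : 0 < t by lra.
have tC : t%:C != 0 :> R[i] by rewrite RC_eq0 gt_eqF.
suff : kobayashi D (phi 0) ('D_1 phi 0) <= t^-1.
  rewrite -aK a1 cmod1 => H; have : t^-1 < 1 by rewrite invf_lt1.
  by move=> H2; have := le_lt_trans H H2; rewrite ltxx.
apply: ge_inf; first by exists 0 => _ [g [b [_ _ _ ->]]]; exact: cmod_ge0.
exists f, (t^-1)%:C; split.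
- split; last exact: df.
  move=> l l1; apply/fock_bargmann_hartogsE; rewrite fr.
  rewrite (_ : (fun i => f l 0 (lshift 1 i)) = z ^~ l); first exact: ins.
  by apply/funext => i.
- apply/rowP; apply: ind_split_last => [i|]; first by rewrite fl z0.
  by rewrite fr w0.
- by have [_ ->] := d0f; rewrite scalerA -RCM mulVf ?scale1r // gt_eqF.
- by rewrite cmodR_ge0 // invr_ge0 ltW.
Qed.

End Geodesic.

(** * Parameters of the extremal disks *)

Section AffineFactor.
Context {R : realType}.
Implicit Types (a b c l : R[i]).

(** An affine function is a multiple of [l - al] or of [1 - conj al * l], according to
the position of its zero with respect to the circle. *)
Lemma affine_factor b c : b != 0 \/ c != 0 -> exists (r : nat) (a al : R[i]),
  [/\ r = 0%N \/ r = 1%N, r = 1%N -> disk al, a != 0, closed_disk al &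
  [/\ forall l, cmod l < 1 -> mobius al l ^+ r * a * (1 - al^* * l) = b * l + c,
      (cmod a ^+ 2)%:C * al = - (c * b^*),
      cmod a ^+ 2 * (1 + cmod al ^+ 2) = cmod b ^+ 2 + cmod c ^+ 2 &
      forall al0, (if r == 1%N then (al0 + a^*) / (1 + (a * al)^*)
         else (al0 - a^* * al) / (1 - a^*)) = (al0 + b^*) / (1 - c^*)]].
Proof.
move=> bc; have [cb|bltc] := ltP (cmod c) (cmod b).
  have b0 : b != 0 by rewrite -cmod_gt0; apply: le_lt_trans cb; exact: cmod_ge0.
  have bp : 0 < cmod b by rewrite cmod_gt0.
  pose al := - c / b.
  have ba : b * al = - c by rewrite mulrC mulfVK.
  have al1 : cmod al < 1 by rewrite cmodM cmodV cmodN ltr_pdivrMr // mul1r.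
  exists 1%N, b, al; split => //; first by right.
    exact: ltW.
  split.
  - move=> l l1; have d0 := mobius_denom al l (ltW al1) l1.
    rewrite expr1 mobiusE mulrAC mulfVK // mulrC.
    by rewrite mulrBr ba opprK.
  - by rewrite -mulzJ mulrAC ba mulNr.
  - by rewrite mulrDr mulr1 -exprMn -cmodM ba cmodN.
  - by move=> al0 /=; rewrite ba conjN.
have c0 : c != 0.
  case: bc => // b0; rewrite -cmod_gt0; apply: lt_le_trans bltc; by rewrite cmod_gt0.
have cp : 0 < cmod c by rewrite cmod_gt0.
pose al := (- b / c)^*.
have alJ : al^* = - b / c by exact: conjK.
have ca : c * al^* = - b by rewrite alJ mulrC mulfVK.
have caJ : c^* * al = - b^* by rewrite -[al]conjK -conjM ca conjN.
have al1 : cmod al <= 1 by rewrite cmodJ cmodM cmodV cmodN ler_pdivrMr // mul1r.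
exists 0%N, c, al; split => //; first by left.
split.
- by move=> l l1; rewrite expr0 mul1r mulrBr mulr1 mulrA ca; ring.
- by rewrite -mulzJ -mulrA caJ mulrN.
- by rewrite mulrDr mulr1 -(cmodJ al) -exprMn -cmodM ca cmodN addrC.
- by move=> al0 /=; rewrite caJ opprK.
Qed.

End AffineFactor.

Section CayleyTransform.
Context {R : realType} {n : nat}.
Implicit Types (a b c l s : R[i]).
Local Notation last := (rshift n (ord0 : 'I_1)).

(** The Cayley transform sends [2 Re u + |z|^2 < 0] to the unit ball and a standard disk
to the quotient of affine functions by [1 - conj al0 * l]. Adding [2 pi i] to [u] does
not change [cexp u]; it is used to avoid [u = -1/2], which the transform sends to zero. *)
Lemma standard_ball s (z : 'I_n -> R[i] -> R[i]) u : standard s z u ->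
  (forall i, exists l, cmod l < 1 /\ z i l != 0) ->
  exists (b c : 'I_(n + 1) -> R[i]) al0,
  [/\ forall j, b j != 0 \/ c j != 0, cmod al0 < 1,
      al0 = \sum_j - (c j * (b j)^*),
      1 + cmod al0 ^+ 2 = \sum_j (cmod (b j) ^+ 2 + cmod (c j) ^+ 2) &
      (al0 + (b last)^*) / (1 - (c last)^*) = s /\
      forall l, cmod l < 1 ->
        [/\ forall i, z i l = 'i%C * (b (lshift 1 i) * l + c (lshift 1 i)) /
              (1 - al0^* * l - (b last * l + c last)) &
            cexp (u l) = cexp (- (1 / 2%:R) *
              ((1 - al0^* * l + (b last * l + c last)) /
               (1 - al0^* * l - (b last * l + c last))))]].
Proof.
move=> [y0 [y1 [c' [s1 bal' A0' sA' zuE']]]] znz.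
have [c0 [Ic0 Rc0 cE]] : exists c0, [/\ Im c0 != 0, Re c0 = Re c' &
    forall l, cmod l < 1 -> cexp (disk_u s y0 y1 c' l) = cexp (disk_u s y0 y1 c0 l)].
  have [I0|I0] := eqVneq (Im c') 0; last by exists c'.
  exists (c' + (2 * pi)%:C * 'i%C); split.
  - by rewrite !ReImE I0 !(mul0r, mulr1, add0r, addr0) gt_eqF // pi2_gt0.
  - by rewrite !ReImE !(mul0r, mulr0, subr0, addr0).
  - move=> l l1; rewrite -[LHS]mulr1 -cexp_2pi -cexpD; congr cexp.
    have d0 := mobius_denom s l s1 l1.
    rewrite /disk_u !conjE conji; set p := (2 * pi)%:C.
    move: (herm y1 y0) p => P p; by field.
have bal : balanced s y0 y1 c0 by rewrite /balanced Rc0.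
have A0 : 2 * Re c0 + nrm2 y0 <= 0 by rewrite Rc0.
have sA : cmod s < 1 \/ 2 * Re c0 + nrm2 y0 < 0 by rewrite Rc0.
have {}zE l i : cmod l < 1 -> z i l = disk_z s y0 y1 i l by move=> /zuE'[].
have uE l : cmod l < 1 -> cexp (u l) = cexp (disk_u s y0 y1 c0 l).
  by move=> l1; have [_ ->] := zuE' l l1; exact: cE.
pose P := herm y1 y0; pose c1 := s^* * c0^* - P.
pose d := 1 - 2%:R * c0.
have n2 := natRC 2.
have N00 := nrm2_ge0 y0.
have Rd : 1 <= Re d by rewrite /d n2 ReB ReCM Re1; lra.
have d0 : d != 0 by rewrite -cmod_gt0; apply: lt_le_trans (le_trans Rd (Re_le_cmod d)).
have dp : 0 < cmod d ^+ 2 by rewrite exprn_gt0 // cmod_gt0.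
have dJ0 : d^* != 0 by rewrite conjc_eq0.
have dJE : d^* = 1 - 2%:R * c0^*.
  by rewrite /d conjB conjM conj1 n2 conjRC.
(* The transform maps [(z, u)] to [- 2 i z / (1 - 2 u)] and [- (1 + 2 u) / (1 - 2 u)],
   and [1 - 2 u = d (1 - conj al0 l) / (1 - conj s l)]. *)
pose al0 := (s + 2%:R * c1^*) / d^*.
have c1J : c1^* = s * c0 - P^* by rewrite /c1 conjB conjM !conjK.
have al0J : al0^* = (s^* + 2%:R * c1) / d.
  by rewrite /al0 conjM conjV conjD conjM !conjK n2 conjRC.
pose b := on_split (fun i => - (2%:R * 'i%C) * y1 i / d) ((s^* - 2%:R * c1) / d).
pose c := on_split (fun i => - (2%:R * 'i%C) * y0 i / d) (- (1 + 2%:R * c0) / d).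
have c2i : cmod (- (2%:R * 'i%C) : R[i]) = 2 by rewrite cmodN cmodM n2 cmodR_ge0 // cmodi mulr1.
have sumbc : al0 = \sum_j - (c j * (b j)^*).
  rewrite sum_split_last /b /c !on_split_r.
  under eq_bigr => i _ do rewrite !on_split_l.
  have -> : \sum_(i < n) - (- (2%:R * 'i%C) * y0 i / d * (- (2%:R * 'i%C) * y1 i / d)^*) =
      - (4%:R * P^* / (d * d^*)).
    rewrite sumrN; congr (- _); rewrite /P -hermC /herm mulr_sumr mulr_suml.
    apply: eq_bigr => i _; rewrite !conjM conjV conjN conjM conji n2 conjRC.
    have ii : ('i%C : R[i]) * 'i%C = -1 by apply: eqReIm; rewrite !ReImE; ring.
    rewrite -n2; move: (y0 i) ((y1 i)^*) => p q.
    have -> : 4%:R * (p * q) / (d * d^*) = - (4%:R * ('i%C * 'i%C)) * (p * q) / (d * d^*).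
      by rewrite ii; ring.
    by field; rewrite d0 dJ0.
  have -> : ((s^* - 2%:R * c1) / d)^* = (s - 2%:R * c1^*) / d^*.
    by rewrite conjM conjV (conjB (s^*)) (conjM 2%:R) conjK n2 conjRC.
  have PE : P^* = s * c0 - c1^* by rewrite c1J; ring.
  rewrite PE /al0; move: (c1^*) => k; rewrite dJE /d.
  rewrite dJE in dJ0; rewrite /d in d0; move: (c0^*) dJ0 => k0 dJ0.
  by field; rewrite d0 dJ0.
have sum2 : 1 + cmod al0 ^+ 2 = \sum_j (cmod (b j) ^+ 2 + cmod (c j) ^+ 2).
  rewrite sum_split_last /b /c !on_split_r.
  under eq_bigr => i _ do rewrite !on_split_l.
  have -> : \sum_(i < n) (cmod (- (2%:R * 'i%C) * y1 i / d) ^+ 2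
       + cmod (- (2%:R * 'i%C) * y0 i / d) ^+ 2) = 4 * (nrm2 y1 + nrm2 y0) / cmod d ^+ 2.
    rewrite big_split /= mulrDr mulrDl /nrm2 !mulr_sumr !mulr_suml.
    by congr (_ + _); apply: eq_bigr => i _; rewrite !cmodM c2i cmodV; field;
      rewrite -cmod_gt0 in d0; rewrite gt_eqF.
  have cd0 : cmod d != 0 by rewrite cmod_eq0.
  have -> : cmod al0 ^+ 2 = cmod (s^* + 2%:R * c1) ^+ 2 / cmod d ^+ 2.
    by rewrite -(cmodJ al0) al0J cmodM cmodV exprMn exprVn.
  rewrite !cmodM cmodV !cmodN !exprMn !exprVn.
  have D2 : cmod d ^+ 2 != 0 by rewrite gt_eqF.
  apply: (mulIf D2); rewrite !mulrDl mul1r !mulfVK //.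
  rewrite /d /c1 /P !sqr_cmod n2.
  move: bal; rewrite /balanced nrm2D nrm2Z hermZr cmodJ conjK sqr_cmod.
  move: (nrm2 y0) (nrm2 y1) (herm y1 y0) => N0 N1 Q; rewrite !ReImE => B.
  lra.
have cl0 : c last != 0.
  rewrite /c on_split_r mulf_neq0 ?invr_eq0 // oppr_eq0.
  apply: contra_neq Ic0 => E; have := congr1 Im E; rewrite n2 ImD ImCM Im1 Im0 add0r => /eqP.
  by rewrite mulf_eq0 pnatr_eq0 /= => /eqP.
have al01 : cmod al0 < 1.
  have [A_lt0|A_ge0] := ltP (2 * Re c0 + nrm2 y0) 0.
    pose k := - 4 * (2 * Re c0 + nrm2 y0) / cmod d ^+ 2.
    have k0 : 0 < k by rewrite /k divr_gt0 // mulNr oppr_gt0; lra.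
    have cE2 : nrm2 c = 1 - k.
      rewrite /nrm2 sum_split_last /c !on_split_r.
      under eq_bigr => i _ do rewrite !on_split_l.
      have -> : \sum_(i < n) cmod (- (2%:R * 'i%C) * y0 i / d) ^+ 2 = 4 * nrm2 y0 / cmod d ^+ 2.
        rewrite /nrm2 mulr_sumr mulr_suml; apply: eq_bigr => i _.
        by rewrite !cmodM c2i cmodV; field; rewrite gt_eqF // cmod_gt0.
      have D2 : cmod d ^+ 2 != 0 by rewrite gt_eqF.
      rewrite /k cmodM cmodV cmodN exprMn exprVn; apply: (mulIf D2).
      rewrite mulrDl mulrBl mul1r !mulfVK // /d !sqr_cmod n2 !ReImE; ring.
    have bE2 : nrm2 b = cmod al0 ^+ 2 + k.
      have : nrm2 b + nrm2 c = 1 + cmod al0 ^+ 2 by rewrite sum2 big_split.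
      by rewrite cE2; lra.
    have cbE : herm b c = - al0^*.
      rewrite hermC /herm sumbc sumrN conjN opprK; congr (_^*).
    have Eq : nrm2 (fun j => b j + al0^* * c j) = k * (1 - cmod al0 ^+ 2).
      rewrite nrm2D nrm2Z hermZr cbE cmodJ conjK mulrN mulzJ ReN ReC bE2 cE2; ring.
    have := nrm2_ge0 (fun j => b j + al0^* * c j); rewrite Eq pmulr_rge0 // subr_ge0.
    rewrite expr_le1 ?cmod_ge0 // le_eqVlt => /predU1P[E1|//].
    have bc j : b j = - al0^* * c j.
      have E0 : nrm2 (fun j => b j + al0^* * c j) = 0 by rewrite Eq E1 expr1n subrr mulr0.
      have := nrm2_eq0 _ E0 j => /eqP; rewrite addr_eq0 => /eqP ->.
      by rewrite mulNr.
    have : nrm2 b = nrm2 c.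
      have -> : b = (fun j => - al0^* * c j) by apply/funext.
      by rewrite nrm2Z cmodN cmodJ E1 expr1n mul1r.
    by rewrite bE2 cE2 E1 expr1n; lra.
  have A00 : 2 * Re c0 + nrm2 y0 = 0 by apply/eqP; rewrite eq_le A0.
  have s_lt1 : cmod s < 1 by case: sA => // ?; lra.
  have y1E i : y1 i = - s^* * y0 i.
    have E0 : nrm2 (fun i => y1 i + s^* * y0 i) = 0.
      by apply/eqP; rewrite -oppr_eq0 -bal A00 mulr0.
    by have /eqP := nrm2_eq0 _ E0 i; rewrite addr_eq0 mulNr => /eqP.
  suff -> : al0 = s by [].
  rewrite /al0 c1J.
  have -> : P^* = - s * (nrm2 y0)%:C.
    have -> : P = herm (fun i => - s^* * y0 i) y0 by rewrite /P; congr herm; apply/funext.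
    by rewrite hermZl herm_self conjM conjN conjK conjRC.
  have -> : (nrm2 y0)%:C = - (c0 + c0^*).
    by rewrite addzJ -RCN; congr (_%:C); lra.
  rewrite dJE in dJ0 *; move: (c0^*) dJ0 => k0 dJ0; by field.
exists b, c, al0; split => //.
  apply: ind_split_last => [i|]; last by right.
  have [l [l1 zl]] := znz i.
  have den : - (2%:R * 'i%C) != 0 :> R[i].
    by rewrite -cmod_eq0 c2i pnatr_eq0.
  have [b0|b0] := eqVneq (b (lshift 1 i)) 0; last by left.
  right; apply: contra_neq zl => c00.
  move: b0 c00; rewrite /b /c !on_split_l => /eqP; rewrite mulf_eq0 invr_eq0 (negPf d0) orbF.
  rewrite mulf_eq0 (negPf den) /= => /eqP b0 /eqP.
  rewrite mulf_eq0 invr_eq0 (negPf d0) orbF mulf_eq0 (negPf den) /= => /eqP c00.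
  by rewrite zE // /disk_z b0 c00 mul0r addr0 mul0r.
split.
  rewrite /b /c !on_split_r.
  have -> : ((s^* - 2%:R * c1) / d)^* = (s - 2%:R * c1^*) / d^*.
    by rewrite conjM conjV (conjB (s^*)) (conjM 2%:R) conjK n2 conjRC.
  have -> : (- (1 + 2%:R * c0) / d)^* = - (1 + 2%:R * c0^*) / d^*.
    by rewrite conjM conjV conjN (conjD 1) (conjM 2%:R) conj1 n2 conjRC.
  rewrite /al0; move: (c1^*) => k.
  rewrite dJE in dJ0 *; move: (c0^*) dJ0 => k0 dJ0.
  have den : 1 - 2%:R * k0 + (1 + 2%:R * k0) != 0.
    rewrite (_ : _ + _ = (2 : R)%:C) ?RC_eq0 ?pnatr_eq0 // -n2; ring.
  by field; rewrite dJ0 opprK den.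
move=> l l1; have den := mobius_denom s l s1 l1.
have n20 : 2%:R != 0 :> R[i] by rewrite n2 RC_eq0 pnatr_eq0.
have ii : ('i%C : R[i]) * 'i%C = -1 by apply: eqReIm; rewrite !ReImE; ring.
have E1 : 1 - al0^* * l - (b last * l + c last) = 2%:R / d * (1 - s^* * l).
  have alg (k k1 k0 m : R[i]) : 1 - 2%:R * k0 != 0 ->
      1 - (k + 2%:R * k1) / (1 - 2%:R * k0) * m
        - ((k - 2%:R * k1) / (1 - 2%:R * k0) * m + - (1 + 2%:R * k0) / (1 - 2%:R * k0))
      = 2%:R / (1 - 2%:R * k0) * (1 - k * m) by move=> h; field.
  by rewrite al0J /b /c !on_split_r; exact: alg.
have E2 : 1 - al0^* * l + (b last * l + c last) = - 4%:R / d * (c0 + c1 * l).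
  have alg (k k1 k0 m : R[i]) : 1 - 2%:R * k0 != 0 ->
      1 - (k + 2%:R * k1) / (1 - 2%:R * k0) * m
        + ((k - 2%:R * k1) / (1 - 2%:R * k0) * m + - (1 + 2%:R * k0) / (1 - 2%:R * k0))
      = - 4%:R / (1 - 2%:R * k0) * (k0 + k1 * m) by move=> h; field.
  by rewrite al0J /b /c !on_split_r; exact: alg.
split=> [i|].
  have alg (I p q e dd m : R[i]) : I * I = -1 -> dd != 0 -> e != 0 ->
      (p + q * m) / e = I * (- (2%:R * I) * q / dd * m + - (2%:R * I) * p / dd) / (2%:R / dd * e).
    move=> I2 h1 h2; have -> : I * (- (2%:R * I) * q / dd * m + - (2%:R * I) * p / dd) =
       - (I * I) * (2%:R * (p + q * m) / dd) by field.
    by rewrite I2; field; rewrite ?n20 ?h1 ?h2.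
  by rewrite E1 zE // /disk_z /b /c !on_split_l; exact: alg.
have alg (k0 k1 e dd m : R[i]) : dd != 0 -> e != 0 ->
    (k0 + k1 * m) / e = - (1 / 2%:R) * (- 4%:R / dd * (k0 + k1 * m) / (2%:R / dd * e)).
  by move=> h1 h2; field; rewrite ?n20 ?h1 ?h2.
by rewrite uE // E1 E2; congr cexp; rewrite /disk_u -/P -/c1; exact: alg.
Qed.

End CayleyTransform.

Section Dichotomy.
Context {R : realType} {n : nat}.

(** The zeros of the last component: two of them, counted with multiplicity, would
make the jet improvable. When possible the zeros at the origin are used, so that the
remaining factor does not vanish there unless the jet of [w] vanishes. *)
Lemma geodesic_standard (z : 'I_n -> R[i] -> R[i]) (w : R[i] -> R[i]) X w1 :
  (forall i, holo (z i)) -> holo w ->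
  (forall l, cmod l < 1 -> cmod (w l) ^+ 2 < expR (- nrm2 (z ^~ l))) ->
  (forall i, cder (z i) 0 (X i)) -> cder w 0 w1 -> (exists i, X i != 0) \/ w1 != 0 ->
  ~ improvable (z ^~ 0) (w 0) X w1 ->
  exists s u (B : R[i] -> R[i]), [/\ standard s z u,
    forall l, cmod l < 1 -> w l = B l * cexp (u l) &
    (forall l, cmod l < 1 -> B l = 1) \/ (forall l, cmod l < 1 -> B l = mobius s l)].
Proof.
move=> hz hw ins dz dw jet nimp.
have c01 : cmod (0 : R[i]) < 1 by rewrite cmod0.
have expand (u : R[i] -> R[i]) l : cmod (cexp (u l)) ^+ 2 = expR (2 * Re (u l)).
  by rewrite cmod_cexp -expRM_natl.
have [w0|] := pselect (forall l, cmod l < 1 -> w l != 0).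
  have [u hu wE] := holo_log w hw w0.
  have neg l : cmod l < 1 -> 2 * Re (u l) + nrm2 (z ^~ l) < 0.
    by move=> l1; have := ins l l1; rewrite wE // expand ltr_expR; lra.
  have [u1 du] := hu 0 c01.
  have w1E : w1 = cexp (u 0) * u1.
    apply: (cder_uniq w 0) dw _; apply: (der_near _ _ w _ _ 1 ltr01 _ (der_cexp _ _ _ _ du)).
    by move=> l; rewrite subr0 => l1; rewrite wE.
  have [s ss] : exists s, standard s z u.
    apply: (standard_zero_free z u X u1) => //.
    - by move=> l l1; exact: ltW (neg l l1).
    - exact: neg.
    - by case: jet => [|w10]; [left|right; apply: contra_neq w10 => u10; rewrite w1E u10 mulr0].
    - by rewrite -w1E -wE.
  by exists s, u, (fun=> 1); split => //; [move=> l l1; rewrite mul1r wE|left].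
move=> /existsNP[a' /not_implyP[a'1 /negP]]; rewrite negbK => /eqP wa'.
have zero_of (f : R[i] -> R[i]) : (exists a, cmod a < 1 /\ f a = 0) ->
    exists a : R[i], [/\ cmod a < 1, f a = 0 & f 0 = 0 -> a = 0].
  move=> [x [x1 fx]]; have [f0|f0] := eqVneq (f 0) 0; first by exists 0.
  by exists x; split => // E; rewrite E eqxx in f0.
have factor (f : R[i] -> R[i]) : holo f -> (exists a, cmod a < 1 /\ f a = 0) -> exists a g,
    [/\ cmod a < 1, holo g, forall l, cmod l < 1 -> f l = mobius a l * g l & f 0 = 0 -> a = 0].
  move=> hf /zero_of[x [x1 fx f0]]; have [g hg gE] := holo_divide f x hf x1 fx.
  exists x, (fun l => (1 - x^* * l) * g l); split => //.
    apply: holoM => //; exact: holo_denom.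
  move=> l l1; have d0 := mobius_denom x l (ltW x1) l1.
  by rewrite gE // mobiusE mulrA mulfVK.
have [a [g [a1 hg wE wa]]] := factor w hw (ex_intro _ a' (conj a'1 wa')).
have insw l : cmod l < 1 -> cmod (mobius a l * g l) ^+ 2 * expR (nrm2 (z ^~ l)) <= 1.
  move=> l1; rewrite -wE //; have := ins l l1; rewrite expRN => h.
  by rewrite -ler_pdivlMr ?expR_gt0 // div1r ltW.
have dmg : cder (fun l => mobius a l * g l) 0 w1.
  apply: (der_near _ w _ _ _ 1 ltr01 _ dw) => l; rewrite subr0 => l1; exact: wE.
have [g0|] := pselect (forall l, cmod l < 1 -> g l != 0).
  have [u hu gE] := holo_log g hg g0.
  have ing := inside_divide_mobius z g a hz hg a1 insw.
  have neg l : cmod l < 1 -> 2 * Re (u l) + nrm2 (z ^~ l) <= 0.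
    move=> l1; have := ing l l1; rewrite gE // expand -expRD -[leRHS]expR0 ler_expR //.
  have [u1 du] := hu 0 c01.
  have w1E : w1 = (1 - (cmod a ^+ 2)%:C) * cexp (u 0) + mobius a 0 * (cexp (u 0) * u1).
    apply: (cder_uniq _ _ _ _ dmg).
    apply: (der_near _ (fun l => mobius a l * cexp (u l)) _ _ _ 1 ltr01).
      by move=> l; rewrite subr0 => l1; rewrite gE.
    exact: derM (cder_mobius0 a) (der_cexp _ _ _ _ du).
  exists a, u, (mobius a); split => //; last by right.
    apply: (standard_one_zero z u X u1 a) => //.
    by rewrite -w1E -gE // -wE.
  by move=> l l1; rewrite wE // gE.
move=> /existsNP[b' /not_implyP[b'1 /negP]]; rewrite negbK => /eqP gb'.
have [b [h [b1 hh gE gb]]] := factor g hg (ex_intro _ b' (conj b'1 gb')).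
case: nimp; rewrite wE // gE //.
have E l : cmod l < 1 -> mobius a l * g l = mobius a l * (mobius b l * h l).
  by move=> l1; rewrite -gE.
apply: (improvable_two_zeros z h a b X w1) => //.
- by move=> l l1; rewrite -E //; exact: insw.
- apply: (der_near _ _ _ _ _ 1 ltr01 _ dmg) => l; rewrite subr0 => l1; exact: E.
- have [h0|h0] := eqVneq (h 0) 0; last by left.
  right; have g00 : g 0 = 0 by rewrite gE // h0 mulr0.
  by split; [apply: wa; rewrite wE // g00 mulr0|exact: gb].
Qed.

End Dichotomy.

Theorem theorem1p3 (R : realType) (n : nat) (hn : (1 <= n)%N)
    (phi : R[i]^o -> 'rV[R[i]]_(n + 1))
    (hgeo : kobayashi_geodesic (@fock_bargmann_hartogs R n 1)
              (phi 0) ('D_1 phi 0) phi)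
    (hderiv : 'D_1 phi 0 != 0)
    (hnz : forall i : 'I_(n + 1), exists lambda : R[i],
              disk lambda /\ phi lambda 0 i != 0) :
  exists (r : 'I_(n + 1) -> nat) (a alpha : 'I_(n + 1) -> R[i])
         (alpha0 : R[i]) (B : R[i] -> R[i]),
    let last : 'I_(n + 1) := rshift n ord0 in
    let gamma : R[i] :=
      if r last == 1%N then
        (alpha0 + (a last)^*) / (1 + (a last * alpha last)^*)
      else
        (alpha0 - (a last)^* * alpha last) / (1 - (a last)^*) in
    (forall j : 'I_(n + 1), r j = 0%N \/ r j = 1%N)
    /\ (forall j : 'I_(n + 1), r j = 1%N -> disk (alpha j))
    /\ (forall j : 'I_(n + 1), a j != 0)
    /\ (forall j : 'I_(n + 1), closed_disk (alpha j))
    /\ disk alpha0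
    /\ alpha0 = \sum_(j < n + 1) (cmod (a j) ^+ 2)%:C * alpha j
    /\ 1 + cmod alpha0 ^+ 2
         = \sum_(j < n + 1) cmod (a j) ^+ 2 * (1 + cmod (alpha j) ^+ 2)
    /\ (forall lambda : R[i], disk lambda -> forall k : 'I_n,
          let j : 'I_(n + 1) := lshift 1 k in
          phi lambda 0 j =
            mobius (alpha j) lambda ^+ r j
              * ('i%C * a j * (1 - (alpha j)^* * lambda))
            / ((1 - alpha0^* * lambda)
               - mobius (alpha last) lambda ^+ r last
                 * a last * (1 - (alpha last)^* * lambda)))
    /\ (forall lambda : R[i], disk lambda ->
          phi lambda 0 last =
            B lambda * cexp (- (1 / 2%:R) *
              ((1 - alpha0^* * lambda
                + mobius (alpha last) lambda ^+ r last
                  * a last * (1 - (alpha last)^* * lambda))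
               / (1 - alpha0^* * lambda
                  - mobius (alpha last) lambda ^+ r last
                    * a last * (1 - (alpha last)^* * lambda)))))
    /\ ((forall lambda : R[i], disk lambda -> B lambda = 1)
        \/ (forall lambda : R[i], disk lambda ->
              B lambda = mobius gamma lambda)).
Proof.
have nimp := geodesic_not_improvable phi hgeo hderiv.
have [[inD dphi] _ _] := hgeo.
pose z (i : 'I_n) (l : R[i]) : R[i] := phi l 0 (lshift 1 i).
pose w (l : R[i]) : R[i] := phi l 0 (rshift n ord0).
have der_at l : cmod l < 1 -> is_derive (l : R[i]^o) 1 phi ('D_1 phi l).
  by move=> l1; apply: derivableP; exact: dphi.
have hz i : holo (z i).
  by move=> l l1; eexists; exact: cder_coord (der_at l l1).
have hw : holo w by move=> l l1; eexists; exact: cder_coord (der_at l l1).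
have der0 : is_derive (0 : R[i]^o) 1 phi ('D_1 phi 0) by apply: der_at; rewrite cmod0.
have ins l : cmod l < 1 -> cmod (w l) ^+ 2 < expR (- nrm2 (z ^~ l)).
  by move=> /inD/fock_bargmann_hartogsE.
have jet : (exists i : 'I_n, ('D_1 phi 0) 0 (lshift 1 i) != 0) \/
    ('D_1 phi 0) 0 (rshift n ord0) != 0.
  apply: contrapT => /not_orP[H1 H2]; move/negP: hderiv; apply; apply/eqP/rowP.
  apply: ind_split_last => [i|]; rewrite mxE; apply/eqP.
    by apply: contrapT => H; apply: H1; exists i; apply/negP.
  by apply: contrapT => H; apply: H2; apply/negP.
have [s [u [B [std wE BE]]]] := geodesic_standard z w _ _ hz hw ins
  (fun i => cder_coord phi 0 _ (lshift 1 i) der0) (cder_coord phi 0 _ (rshift n ord0) der0)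
  jet nimp.
have [b [c [al0 [bc al01 sum1 sum2 [gammaE form]]]]] :=
  standard_ball s z u std (fun i => hnz (lshift 1 i)).
have [r Hr] := choice (fun j => affine_factor (b j) (c j) (bc j)).
have [a Ha] := choice Hr.
have [al Hal] := choice Ha.
exists r, a, al, al0, B => last gamma.
have gE : gamma = s.
  by rewrite -gammaE; have [_ _ _ _ [_ _ _ H]] := Hal last; exact: H.
have N j l : cmod l < 1 -> mobius (al j) l ^+ r j * a j * (1 - (al j)^* * l) = b j * l + c j.
  by have [_ _ _ _ [H _ _ _]] := Hal j; exact: H.
split; first by move=> j; have [] := Hal j.
split; first by move=> j; have [] := Hal j.
split; first by move=> j; have [] := Hal j.
split; first by move=> j; have [] := Hal j.
split; first exact: al01.
split.
  rewrite {1}sum1; apply: eq_bigr => j _.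
  by have [_ _ _ _ [_ -> _ _]] := Hal j.
split.
  rewrite sum2; apply: eq_bigr => j _.
  by have [_ _ _ _ [_ _ -> _]] := Hal j.
split.
  move=> l l1 k j; have [/(_ k) zk _] := form l l1.
  by rewrite N // -[phi l 0 j]/(z k l) zk -(N j l l1); congr (_ / _); ring.
split; last by rewrite gE.
move=> l l1; rewrite N // -[phi l 0 last]/(w l) wE //.
by have [_ ->] := form l l1.
Qed.
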